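(* Let $n\ge1$ and $k\in\{1,\ldots,n\}$, and write $w(x)=\prod_{i=n-k+1}^{n}x_i$. For all $u\in C_c^\infty(\mathbb{R}^n_{k,+})$, $$\int_{\mathbb{R}^n_{k,+}}|\nabla u|^2dx+\int_{\mathbb{R}^n_{k,+}}|x|^2|u|^2dx-(n+2k)\int_{\mathbb{R}^n_{k,+}}|u|^2dx$$ $$\ge\frac{2}{n+2k+3}\inf_{c\in\mathbb{R}}\left(\int_{\mathbb{R}^n_{k,+}}\left|\nabla\left(u-c\,w\,e^{-\frac12|x|^2}\right)\right|^2dx+\int_{\mathbb{R}^n_{k,+}}|x|^2\left|u-c\,w\,e^{-\frac12|x|^2}\right|^2dx+\int_{\mathbb{R}^n_{k,+}}\left|u-c\,w\,e^{-\frac12|x|^2}\right|^2dx\right).$$ The inequality is sharp, and equality can be attained by nontrivial functions (functions in $S(\mathbb{R}^n_{k,+})$ that are not of the form $c\,w\,e^{-\frac12|x|^2}$, $c\in\mathbb{R}$).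
   Context: $\mathbb{R}^n_{k,+}:=\mathbb{R}^{n-k}\times(0,\infty)^k$. $C_c^\infty(\mathbb{R}^n_{k,+})$ is the space of real-valued smooth functions with compact support in the open orthant, and $S(\mathbb{R}^n_{k,+})$ is its completion under the norm $\left(\int_{\mathbb{R}^n_{k,+}}|\nabla u|^2dx\right)^{1/2}+\left(\int_{\mathbb{R}^n_{k,+}}|x|^2|u|^2dx\right)^{1/2}$; both sides of the inequality make sense for $u\in S(\mathbb{R}^n_{k,+})$. ''Sharp'' means that the constant $\frac{2}{n+2k+3}$ cannot be replaced by a larger one.
   Formalization: Sharpness of the constant and attainment of equality by nontrivial functions are stated only for k<n; for k=n both are false, since the best constant is then 4/(3n+5) > 2/(3n+3). The inequality itself is stated for all 1≤k≤n. *)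

(* Defs.v *)
From HB Require Import structures.
From mathcomp Require Import all_boot all_order all_algebra.
From mathcomp Require Import all_classical all_reals all_analysis.
Import Order.TTheory GRing.Theory Num.Theory.
Import numFieldNormedType.Exports.

Set Implicit Arguments.
Unset Strict Implicit.
Unset Printing Implicit Defensive.

Local Open Scope classical_set_scope.
Local Open Scope ring_scope.

Section LebesgueMeasure.
Context {R : realType}.

Definition consT n (p : n.-tuple R * R) : n.+1.-tuple R :=
  [tuple of p.2 :: p.1].

Lemma measurable_consT n : measurable_fun setT (@consT n).
Proof. exact: (measurable_cons measurable_snd measurable_fst). Qed.

(* The library has no Lebesgue measure on 'rV[R]_n, but n.-tuple R carries the
   product sigma-algebra.  The measure is therefore built on tuples, by
   Lebesgue(n.+1) = Lebesgue(n) \x Lebesgue(1), and [rowT] transports points to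
   'rV[R]_n, which carries the topology and the derivatives. *)
Fixpoint lebesgueT n : {measure set (n.-tuple R) -> \bar R} :=
  if n is m.+1 return {measure set (n.-tuple R) -> \bar R} then
    measure_function_pushforward__canonical__measure_function_Measure
      (lebesgueT m \x (@lebesgue_measure R))%E (@measurable_consT m)
  else \d_ ([tuple] : 0.-tuple R).

Definition rowT n (t : n.-tuple R) : 'rV[R]_n := \row_i tnth t i.

End LebesgueMeasure.

Section Orthant.
Context {R : realType} {n : nat}.
Implicit Types (x : 'rV[R]_n) (u v : 'rV[R]_n -> R) (G : 'rV[R]_n -> 'rV[R]_n).

(* The coordinates are numbered from 0, so the k positive ones are those of
   index n - k, ..., n - 1 (for k <= n). *)
Definition orthant k : set 'rV[R]_n :=
  [set x | forall i : 'I_n, (n - k <= i)%N -> 0 < x 0 i].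

Definition orthant_int k (f : 'rV[R]_n -> R) : \bar R :=
  (\int[lebesgueT n]_(t in @rowT R n @^-1` orthant k) (f (rowT t))%:E)%E.

(* Square of the Euclidean norm; the library norm of 'rV[R]_n is the sup norm. *)
Definition sqnorm x : R := \sum_i x 0 i ^+ 2.

Definition partial (i : 'I_n) u : 'rV[R]_n -> R :=
  fun x => 'D_(delta_mx 0 i) u x.

Definition grad u : 'rV[R]_n -> 'rV[R]_n := fun x => \row_i partial i u x.

Definition smooth u : Prop :=
  forall (s : seq 'I_n) x, differentiable (foldr partial u s) x.

(* C_c^oo of the open orthant, its elements being extended by 0 to R^n. *)
Definition Cc_smooth k u : Prop :=
  let supp := closure [set x | u x != 0] in
  [/\ smooth u, compact supp & supp `<=` orthant k].

Definition weight k x : R := \prod_(i < n | (n - k <= i)%N) x 0 i.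

Definition ground_state k x : R := weight k x * expR (- (sqnorm x / 2)).

(* In the next two definitions G plays the role of the gradient of u. *)
Definition deficit k u G : \bar R :=
  (orthant_int k (fun x => sqnorm (G x))%R
   + orthant_int k (fun x => sqnorm x * u x ^+ 2)%R
   - (n + 2 * k)%:R%:E * orthant_int k (fun x => u x ^+ 2)%R)%E.

Definition energy k u G : \bar R :=
  (orthant_int k (fun x => sqnorm (G x))%R
   + orthant_int k (fun x => sqnorm x * u x ^+ 2)%R
   + orthant_int k (fun x => u x ^+ 2)%R)%E.

(* For k < n the best C is 2 / (n + 2k + 3), attained at
   x_0 * ground_state.  For k = n it is 4 / (3n + 5), which is larger: then all
   eigenfunctions of -Laplace + |x|^2 with Dirichlet conditions are odd in each
   variable, so that the eigenvalues are 3n, 3n + 4, 3n + 8, etc. *)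
Definition stability_ineq k (C : R) : Prop :=
  forall u, Cc_smooth k u ->
  (C%:E * ereal_inf [set energy k (fun x => u x - c * ground_state k x)%R
                      (grad (fun x => u x - c * ground_state k x)%R)
                    | c in setT]
   <= deficit k u (grad u))%E.

(* The completion S of [Cc_smooth k], realised in L^2: a Cauchy sequence for
   the S-norm is a sequence phi_j such that grad phi_j converges in L^2(dx) and
   phi_j converges in L^2(|x|^2 dx); the element of S that it defines is the
   limit u, and G is its (weak) gradient, which u determines almost
   everywhere.  Elements of S are equal when they agree a.e. on the orthant. *)
Definition in_completion k u G : Prop :=
  [/\ measurable_fun setT (u \o @rowT R n),
      forall i, measurable_fun setT (fun t : n.-tuple R => G (rowT t) 0 i)
    & exists phi : nat -> 'rV[R]_n -> R,
      [/\ forall j, Cc_smooth k (phi j),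
          orthant_int k (fun x => sqnorm (grad (phi j) x - G x))
            @[j --> \oo] --> 0%E
        & orthant_int k (fun x => sqnorm x * (phi j x - u x) ^+ 2)
            @[j --> \oo] --> 0%E]].

(* Equality for an element u of S with gradient G; the gradient of
   u - c * ground_state is then G - c * grad ground_state. *)
Definition stability_eq k (C : R) u G : Prop :=
  deficit k u G =
  (C%:E * ereal_inf [set energy k (fun x => u x - c * ground_state k x)%R
                      (fun x => G x - c *: grad (ground_state k) x)%R
                    | c in setT])%E.

Definition ae_on_orthant k u v : Prop :=
  {ae lebesgueT n, forall t, orthant k (rowT t) -> u (rowT t) = v (rowT t)}.

End Orthant.

(* Main.v *)
From HB Require Import structures.
From mathcomp Require Import all_boot all_order all_algebra.
From mathcomp Require Import all_classical all_reals all_analysis.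
From mathcomp Require Import measurable_realfun.
From mathcomp Require Import ring lra.
Require Import Defs.
Import Order.TTheory GRing.Theory Num.Theory.
Import numFieldNormedType.Exports.

Set Implicit Arguments.
Unset Strict Implicit.
Unset Printing Implicit Defensive.

Local Open Scope classical_set_scope.
Local Open Scope ring_scope.

(* The ground state is a product of functions of one variable, e(x) = exp(-x^2/2)
   on the line and e(x) = x exp(-x^2/2) on the half-line.  In one variable, writing
   f = g e turns the gap between the first two eigenvalues into a Poincare
   inequality for the weight e^2, whose constant is at least 2.  An induction on n,
   in which the positivity of (1 - P) (1 - P') for commuting projections plays the
   role of the spectral theorem, gives with L = n + 2k and Phi = ground_state
     (L + 2) |u|^2 <= Q(u) + 2 <u, Phi>^2 / |Phi|^2,
   where Q(u) is the integral of |grad u|^2 + |x|^2 u^2.  As the infimum over c is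
   at most the energy at c = <u, Phi> / |Phi|^2, the inequality follows.  For k < n
   the function x_0 Phi is an eigenfunction for L + 2 which is orthogonal to Phi, so
   it yields equality; smooth cutoffs of it show that the constant is optimal. *)

(** * Functions dominated by an integrable weight *)

(** On an eigenfunction of eigenvalue mu > L the quotient of the deficit by the energy is (mu - L) /
    (mu + 1), which increases with mu, so the first level above L decides. A free coordinate has the
    levels 1, 3, 5, ... and a positive one 3, 7, 11, ...; hence that level is at least L + 2, with
    equality as soon as there is a free coordinate, and L + 2 gives 2 / (L + 3). No completeness of
    the eigenfunctions is used. The price is that the gap must be stated for functions that are not
    orthogonal to Phi: the slices of a function orthogonal to Phi need not be orthogonal to the
    ground states of lower dimension. This is why the squared inner product stands on the right-hand
    side throughout the induction. All integrands are kept in one class, the functions bounded by a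
    multiple of exp(-|x|^2/4). It is stable under products, slices and partial integration, so
    Fubini, integration by parts and dominated convergence apply without separate integrability
    arguments. *)

Section Dominated.
Context d (T : measurableType d) (R : realType).
Variables (mu : {measure set T -> \bar R}) (D : set T) (w : T -> R).

(** Measurability and the bound are asked on [D] only, because partial integrals over a box are
    controlled only there. *)
Definition dominated (f : T -> R) :=
  measurable_fun D f /\ exists M, forall x, D x -> `|f x| <= M * w x.

(** The bound [w x <= 1] gives w^2 <= w, which makes the dominated functions closed under products
    ([dominatedM]). *)
Definition good_weight :=
  [/\ measurable D, mu.-integrable D (EFin \o w)
    & forall x, 0 <= w x <= 1].

Hypothesis gw : good_weight.

Let mD : measurable D. Proof. by case: gw. Qed.
Let iw : mu.-integrable D (EFin \o w). Proof. by case: gw. Qed.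
Let w0 x : 0 <= w x. Proof. by case: gw => _ _ /(_ x)/andP[]. Qed.
Let w1 x : w x <= 1. Proof. by case: gw => _ _ /(_ x)/andP[]. Qed.

Lemma dominated_bound f : dominated f ->
  exists2 M, 0 <= M & forall x, D x -> `|f x| <= M * w x.
Proof.
case=> _ [M fM]; exists `|M|; first exact: normr_ge0.
move=> x Dx; apply: (le_trans (fM x Dx)).
by rewrite ler_wpM2r// ler_norm.
Qed.

Lemma dominated_integrable f : dominated f -> mu.-integrable D (EFin \o f).
Proof.
move=> [mf [M fM]].
apply: (@le_integrable _ _ _ mu D mD _ (fun x => (M * w x)%:E)).
- exact/measurable_EFinP.
- move=> x Dx /=; rewrite lee_fin; apply: (le_trans (fM x Dx)).
  exact: ler_norm.
- have := @integrableZl _ _ _ mu D mD M _ iw.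
  by apply: eq_integrable => // x _; rewrite /= EFinM.
Qed.

Lemma dominatedD f g : dominated f -> dominated g ->
  dominated (fun x => f x + g x).
Proof.
move=> [mf [M fM]] [mg [N gN]]; split; first exact: measurable_funD.
exists (M + N) => x Dx; rewrite mulrDl.
by apply: (le_trans (ler_normD _ _)); rewrite lerD ?fM ?gN.
Qed.

Lemma dominatedZ c f : dominated f -> dominated (fun x => c * f x).
Proof.
move=> [mf [M fM]]; split; first exact: measurable_funM.
exists (`|c| * M) => x Dx; rewrite normrM -mulrA.
by rewrite ler_wpM2l// fM.
Qed.

Lemma dominatedB f g : dominated f -> dominated g ->
  dominated (fun x => f x - g x).
Proof.
move=> df dg; have := dominatedD df (dominatedZ (-1) dg).
by under eq_fun do rewrite mulN1r.
Qed.

Lemma dominatedM f g : dominated f -> dominated g ->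
  dominated (fun x => f x * g x).
Proof.
move=> df dg; split; first by apply: measurable_funM; [case: df|case: dg].
have [M M0 fM] := dominated_bound df; have [N N0 gN] := dominated_bound dg.
exists (M * N) => x Dx; rewrite normrM.
apply: (le_trans (ler_pM _ _ (fM x Dx) (gN x Dx))) => //.
rewrite mulrACA ler_wpM2l ?mulr_ge0//.
by rewrite -[leRHS]mulr1 ler_wpM2l.
Qed.

Lemma dominatedX2 f : dominated f -> dominated (fun x => f x ^+ 2).
Proof. by move=> df; under eq_fun do rewrite expr2; exact: dominatedM. Qed.

Lemma dominated0 : dominated (fun=> 0).
Proof.
split; first exact: measurable_cst.
by exists 0 => x _; rewrite normr0 mul0r.
Qed.

Lemma dominated_sum (I : Type) (r : seq I) (P : pred I) (F : I -> T -> R) :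
  (forall i, dominated (F i)) -> dominated (fun x => \sum_(i <- r | P i) F i x).
Proof.
move=> dF; elim: r => [|i r ih].
  by under eq_fun do rewrite big_nil; exact: dominated0.
under eq_fun do rewrite big_cons.
by case: (P i) => //; exact: dominatedD.
Qed.

Lemma dominated_le (f g : T -> R) : measurable_fun D f -> dominated g ->
  (forall x, D x -> `|f x| <= `|g x|) -> dominated f.
Proof.
move=> mf [_ [M gM]] fg; split => //; exists M => x Dx.
exact: (le_trans (fg x Dx) (gM x Dx)).
Qed.

Lemma eq_dominated (f g : T -> R) : (forall x, D x -> f x = g x) ->
  dominated f -> dominated g.
Proof.
move=> fg [mf [M fM]]; split; last first.
  by exists M => x Dx; rewrite -fg// fM.
by apply: eq_measurable_fun mf => x /set_mem/fg.
Qed.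

Let J (f : T -> R) := \int[mu]_(x in D) f x.

Lemma dominated_intD f g : dominated f -> dominated g ->
  J (fun x => f x + g x) = J f + J g.
Proof. by move=> *; apply: RintegralD => //; exact: dominated_integrable. Qed.

Lemma dominated_intZ c f : dominated f -> J (fun x => c * f x) = c * J f.
Proof. by move=> *; apply: RintegralZl => //; exact: dominated_integrable. Qed.

Lemma dominated_int_le f g : dominated f -> dominated g ->
  (forall x, D x -> f x <= g x) -> J f <= J g.
Proof. by move=> *; apply: le_Rintegral => //; exact: dominated_integrable. Qed.

Lemma dominated_int_fin f : dominated f ->
  (\int[mu]_(x in D) (f x)%:E = (J f)%:E)%E.
Proof.
move=> df; rewrite /J /Rintegral fineK//.
exact: (integrable_fin_num mD (dominated_integrable df)).
Qed.

Lemma dominated_int_cvg (f_ : nat -> T -> R) f M :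
  (forall j, measurable_fun D (f_ j)) ->
  (forall j x, D x -> `|f_ j x| <= M * w x) ->
  (forall x, D x -> f_ ^~ x @ \oo --> f x) ->
  J (f_ j) @[j --> \oo] --> J f.
Proof.
move=> mf_ fM_ f_f.
have mf : measurable_fun D f by apply: measurable_fun_cvg f_f.
have iM : mu.-integrable D (EFin \o (fun x => M * w x)).
  have := @integrableZl _ _ _ mu D mD M _ iw.
  by apply: eq_integrable => // x _; rewrite /= EFinM.
have := @dominated_convergence _ _ _ mu D mD (fun j => EFin \o f_ j)
  (EFin \o f) (EFin \o (fun x => M * w x)).
case.
- by move=> j; exact/measurable_EFinP.
- exact/measurable_EFinP.
- by apply/aeW => x Dx; apply: cvg_EFin; [exact: nearW|exact: f_f].
- exact: iM.
- by apply/aeW => x j Dx /=; rewrite lee_fin fM_.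
- move=> iF _ h; apply: fine_cvg; rewrite fineK//.
  exact: (integrable_fin_num mD iF).
Qed.
End Dominated.

(** * Row vectors: adding a first coordinate, continuity and measurability *)

Section RowVectors.
Context {R : realType}.

Definition consR n (y : R) (x : 'rV[R]_n) : 'rV[R]_n.+1 :=
  \row_i (if unlift ord0 i is Some j then x 0 j else y).

Lemma consR0 n y (x : 'rV[R]_n) : consR y x 0 ord0 = y.
Proof. by rewrite mxE unlift_none. Qed.

Lemma consRS n y (x : 'rV[R]_n) j : consR y x 0 (lift ord0 j) = x 0 j.
Proof. by rewrite mxE liftK. Qed.

Lemma rowT_cons n (p : n.-tuple R * R) :
  rowT (consT p) = consR p.2 (rowT p.1).
Proof.
apply/rowP => i; case: (unliftP ord0 i) => [j ->|->].
  by rewrite consRS !mxE tnthS.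
by rewrite consR0 mxE.
Qed.

Lemma sqnorm_consR n y (x : 'rV[R]_n) :
  sqnorm (consR y x) = y ^+ 2 + sqnorm x.
Proof.
rewrite /sqnorm big_ord_recl consR0; congr (_ + _).
by apply: eq_bigr => i _; rewrite consRS.
Qed.

Lemma sqnorm_ge0 n (x : 'rV[R]_n) : 0 <= sqnorm x.
Proof. by apply: sumr_ge0 => i _; rewrite sqr_ge0. Qed.

Lemma row_norm_lt n (x : 'rV[R]_n) (e : R) :
  0 < e -> (forall i, `|x 0 i| < e) -> `|x| < e.
Proof.
move=> e0 H; rewrite [ltLHS]/Num.norm/= mx_normrE; apply/bigmax_ltP.
by split => // -[i j] _ /=; rewrite (ord1 i).
Qed.

Lemma row_continuous (T : topologicalType) n (f : T -> 'rV[R]_n) :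
  (forall i, continuous (fun t => f t 0 i)) -> continuous f.
Proof.
move=> cf t; apply/cvgrPdist_lt => e e0.
have : \forall s \near t, forall i, `|f t 0 i - f s 0 i| < e.
  apply: filter_forall => i; have := cf i t.
  by move=> /cvgrPdist_lt; exact.
apply: filterS => s H.
by apply: row_norm_lt => // i; rewrite !mxE.
Qed.

Lemma consR_continuousr n y : continuous (@consR n y).
Proof.
apply: row_continuous => i; case: (unliftP ord0 i) => [j ->|->] x.
  by under eq_fun do rewrite consRS; exact: (@coord_continuous R 1 n 0 j).
by under eq_fun do rewrite consR0; exact: cst_continuous.
Qed.

Lemma consR_continuousl n (x : 'rV[R]_n) : continuous (fun y => consR y x).
Proof.
apply: row_continuous => i; case: (unliftP ord0 i) => [j ->|->] y.
  by under eq_fun do rewrite consRS; exact: cst_continuous.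
by under eq_fun do rewrite consR0; exact: cvg_id.
Qed.

(** The product sigma-algebra of tuples is not defined from the topology of row vectors;
    approximation links the two. Rounding each coordinate down to the grid of mesh 1/(m+1) takes
    countably many values, with half-open boxes as level sets, and by continuity [f] at the rounded
    point tends to [f]. *)
Lemma continuous_measurable_rowT n (f : 'rV[R]_n -> R) :
  continuous f -> measurable_fun setT (f \o @rowT R n).
Proof.
move=> cf.
pose gr m (z : 'rV[int]_n) : 'rV[R]_n := \row_i ((z 0 i)%:~R / m.+1%:R).
pose q m (t : n.-tuple R) : 'rV[int]_n :=
  \row_i Num.floor (tnth t i * m.+1%:R).
apply: (@measurable_fun_cvg _ _ _ _ (fun m t => f (gr m (q m t)))).
- move=> m _ Y mY; rewrite setTI.
  rewrite (_ : _ @^-1` _ = \bigcup_(z in [set: 'rV[int]_n])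
      (if f (gr m z) \in Y then
       \bigcap_(i in [set: 'I_n]) [set t : n.-tuple R | tnth t i \in
          `[(z 0 i)%:~R / m.+1%:R, ((z 0 i) + 1)%:~R / m.+1%:R[]
       else set0)); last first.
    have m0 : 0 < m.+1%:R :> R by [].
    apply/seteqP; split => t /=.
      move=> Yt; exists (q m t) => //; rewrite mem_set// => i _ /=.
      rewrite in_itv/= ler_pdivrMr// ltr_pdivlMr// mxE.
      by rewrite floor_le /= floorD1_gt.
    move=> [z _]; case: ifPn => // /set_mem Yz H.
    suff -> : q m t = z by [].
    apply/rowP => i; rewrite mxE; apply: floor_def.
    have := H i Logic.I; rewrite /= in_itv/= ler_pdivrMr// ltr_pdivlMr//.
  apply: countable_bigcupT_measurable; first exact: countableP.
  move=> z; case: ifP => // _; apply: fin_bigcap_measurable => // i _.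
  rewrite -[X in measurable X]setTI.
  apply: (@measurable_tnth _ (measurableTypeR R) n i measurableT
    [set` `[_, _[%R]).
  exact: measurable_itv.
- move=> t _; apply: (@cvg_comp _ _ _ (fun m => gr m (q m t)) f); last exact: cf.
  apply/cvgrPdist_lt => e e0.
  near=> m.
  have me : m.+1%:R^-1 < e.
    by near: m; exact: (near_infty_natSinv_lt (PosNum e0)).
  apply: row_norm_lt => // j; rewrite !mxE.
  have m0 : 0 < m.+1%:R :> R by [].
  set s := tnth t j.
  have -> : s - (Num.floor (s * m.+1%:R))%:~R / m.+1%:R =
     (s * m.+1%:R - (Num.floor (s * m.+1%:R))%:~R) / m.+1%:R.
    by rewrite mulrBl mulfK ?gt_eqF.
  rewrite ger0_norm; last first.
    by rewrite divr_ge0// subr_ge0 floor_le.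
  apply: (@le_lt_trans _ _ (m.+1%:R^-1)) me.
    rewrite ler_pdivrMr// mulVf ?gt_eqF// lerBlDl.
    by rewrite -intrD1 ltW// floorD1_gt.
Unshelve. all: by end_near.
Qed.

End RowVectors.

(** * Lebesgue measure on tuples *)

Section TupleLebesgue.
Context {R : realType}.
Local Notation leb := (@lebesgue_measure R).

Lemma measurable_tuple_prod n (A : 'I_n -> set R) :
  (forall i, measurable (A i)) ->
  measurable [set t : n.-tuple R | forall i, A i (tnth t i)].
Proof.
move=> mA.
rewrite (_ : mkset _ = \bigcap_(i in [set: 'I_n])
    [set t : n.-tuple R | A i (tnth t i)]); last first.
  by apply/seteqP; split => t /= H i; [move=> _|]; exact: H.
apply: fin_bigcap_measurable => // i _; rewrite -[X in measurable X]setTI.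
exact: (@measurable_tnth _ (measurableTypeR R) n i measurableT (A i) (mA i)).
Qed.

Lemma lebesgueT_sigma_finite n : sigma_finite setT (@lebesgueT R n).
Proof.
exists (fun j => [set t : n.-tuple R | forall i, `[- j%:R, j%:R]%classic (tnth t i)]).
  apply/seteqP; split => // t _ /=.
  pose M := \sum_i `|tnth t i|.
  have M0 : 0 <= M by apply: sumr_ge0.
  exists (Num.truncn M).+1 => //= i.
  rewrite in_itv/= -ler_norml; apply: (@le_trans _ _ M).
    by rewrite /M (bigD1 i)//= lerDl sumr_ge0.
  by rewrite ltW// truncnS_gt.
move=> j; split.
  exact: (@measurable_tuple_prod n (fun=> `[- j%:R, j%:R]%classic)).
elim: n => [|n ih] /=.
  by rewrite diracE ltry.
rewrite /pushforward/=.
rewrite (_ : _ @^-1` _ =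
   [set t : n.-tuple R | forall i, `[- j%:R, j%:R]%classic (tnth t i)] `*`
   `[- j%:R, j%:R]%classic); last first.
  apply/seteqP; split => -[t y] /=.
    move=> H; split; last exact: (H ord0).
    by move=> i; have := H (lift ord0 i); rewrite tnthS.
  move=> [Ht Hy] i; case: (unliftP ord0 i) => [k ->|->]; last exact: Hy.
  by rewrite tnthS.
rewrite product_measure1E//=; last first.
  exact: (@measurable_tuple_prod n (fun=> `[- j%:R, j%:R]%classic)).
rewrite lte_mul_pinfty//.
  by rewrite ge0_fin_numE.
by rewrite lebesgue_measure_itv/=; case: ifP => _; rewrite -?EFinB ltry.
Qed.

(** By construction [lebesgueT] is only a measure; the sigma-finite structure that Fubini's theorem
    asks for is packed onto the same function. *)
Definition lebesgueTs n : {sigma_finite_measure set (n.-tuple R) -> \bar R} :=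
  let m := @lebesgueT R n in
  let H1 := isSFinite.Build _ _ _ m
    (sfinite_measure_sigma_finite (lebesgueT_sigma_finite n)) in
  let H2 := isSigmaFinite.Build _ _ _ m (lebesgueT_sigma_finite n) in
  HB.pack_for (SigmaFiniteMeasure.type (n.-tuple R) R) (Measure.sort m) H1 H2.

Local Notation TR n := (n.-tuple R * measurableTypeR R)%type.
Local Notation lebesgueTp n :=
  ([the {measure set _ -> \bar R} of (lebesgueTs n \x leb)%E]).

Let measurable_cons' n : measurable_fun (@setT (TR n)) (@consT R n).
Proof. exact: measurable_consT. Qed.

Lemma ge0_integral_lebesgueTS n (f : n.+1.-tuple R -> \bar R) :
  measurable_fun setT f -> (forall t, 0 <= f t)%E ->
  (\int[lebesgueT n.+1]_t f t = \int[lebesgueTp n]_p f (consT p))%E.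
Proof.
move=> mf f0.
have H := @ge0_integral_pushforward _ _ _ _ R _ (@measurable_cons' n)
  (lebesgueTp n) setT f measurableT mf.
by apply: H => t _; exact: f0.
Qed.

Lemma integrable_lebesgueTS n (f : n.+1.-tuple R -> \bar R) :
  (lebesgueT n.+1).-integrable setT f ->
  (lebesgueTp n).-integrable setT (f \o @consT R n).
Proof.
move=> /integrableP[mf fi]; apply/integrableP; split.
  by apply: measurableT_comp => //; exact: measurable_cons'.
by rewrite -(ge0_integral_lebesgueTS (f := fun t => `|f t|%E))//;
  exact: (measurableT_comp (@abse_measurable R setT) mf).
Qed.

Lemma integral_lebesgueTS n (f : n.+1.-tuple R -> \bar R) :
  (lebesgueT n.+1).-integrable setT f ->
  (\int[lebesgueT n.+1]_t f t = \int[lebesgueTp n]_p f (consT p))%E.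
Proof.
move=> fi;
have mf : measurable_fun setT f by case/integrableP: fi.
exact: (@integral_pushforward _ _ _ _ R _ (@measurable_cons' n)
  (lebesgueTp n) setT f mf (integrable_lebesgueTS fi) measurableT).
Qed.

(* The dominating weight exp(-|x|^2/4) decays slower than the eigenfunctions,
   whose Gaussian is exp(-|x|^2/2): the difference absorbs polynomial factors. *)
Definition gauss4 (y : R) := expR (- (y ^+ 2 / 4)).
Definition gaussn n (x : 'rV[R]_n) := expR (- (sqnorm x / 4)).

Lemma gaussn_consR n y (x : 'rV[R]_n) :
  gaussn (consR y x) = gauss4 y * gaussn x.
Proof. by rewrite /gaussn sqnorm_consR mulrDl opprD expRD. Qed.

Lemma gauss4_01 y : 0 <= gauss4 y <= 1.
Proof.
rewrite expR_ge0/= -[leRHS]expR0 ler_expR oppr_le0.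
by rewrite divr_ge0// sqr_ge0.
Qed.

Lemma gaussn_01 n (x : 'rV[R]_n) : 0 <= gaussn x <= 1.
Proof.
rewrite expR_ge0/= -[leRHS]expR0 ler_expR oppr_le0.
by rewrite divr_ge0// sqnorm_ge0.
Qed.

Lemma continuous_sqnorm n : continuous (@sqnorm R n).
Proof.
apply: continuous_big; first exact: add_continuous.
move=> i _ x; apply: (@cvg_comp _ _ _ (fun x : 'rV[R]_n => x 0 i)
  (fun y : R => y ^+ 2)); last exact: exprn_continuous.
exact: (@coord_continuous R 1 n 0 i).
Qed.

Lemma continuous_gaussn n : continuous (@gaussn n).
Proof.
move=> x; apply: (@continuous_comp _ _ _ (fun x : 'rV[R]_n => - (sqnorm x / 4)) expR);
  last exact: continuous_expR.
apply: continuousN; apply: continuousM; last exact: cst_continuous.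
exact: continuous_sqnorm.
Qed.

Lemma continuous_gauss4 : continuous gauss4.
Proof.
move=> x; apply: (@continuous_comp _ _ _ (fun x : R => - (x ^+ 2 / 4)) expR);
  last exact: continuous_expR.
apply: continuousN; apply: continuousM; last exact: cst_continuous.
exact: exprn_continuous.
Qed.

Lemma integrable_gauss4 : leb.-integrable setT (EFin \o gauss4).
Proof.
(* Up to the constant [normal_peak], exp(-x^2/4) is the density of the centred normal law of
   variance 2. *)
have s0 : Num.sqrt 2 != 0 :> R by rewrite gt_eqF// sqrtr_gt0.
have := @integrable_normal_pdf R 0 (Num.sqrt 2).
rewrite normal_pdfE// => H.
have p0 := normal_peak_gt0 s0.
have := @integrableZl _ _ _ leb _ measurableT (normal_peak (Num.sqrt 2))^-1 _ H.
apply: eq_integrable => // x _.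
rewrite /= -EFinM mulrA mulVf ?gt_eqF// mul1r /gauss4 /normal_fun.
by rewrite subr0 sqr_sqrtr//; congr (expR _)%:E; lra.
Qed.

Lemma integrable_gaussn n :
  (@lebesgueT R n).-integrable setT (EFin \o (@gaussn n \o @rowT R n)).
Proof.
apply/integrableP; split.
  apply/measurable_EFinP.
  exact: (continuous_measurable_rowT (@continuous_gaussn n)).
have mg m : measurable_fun setT (fun t => (@gaussn m (rowT t))%:E).
  apply/measurable_EFinP.
  exact: (continuous_measurable_rowT (@continuous_gaussn m)).
rewrite (_ : (fun t => _) = (fun t => (gaussn (rowT t))%:E)); last first.
  by apply/funext => t /=; rewrite ger0_norm ?expR_ge0.
elim: n => [|n ih].
  have := @integral_dirac _ _ ([tuple] : 0.-tuple R) R setT measurableT _ (mg 0%N).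
  by move=> /= ->; rewrite diracE in_setT mul1e ltry.
rewrite ge0_integral_lebesgueTS//; last by move=> t; rewrite lee_fin expR_ge0.
have := @fubini_tonelli2 _ _ _ _ R (lebesgueTs n) leb
  (fun p => (gaussn (rowT (consT p)))%:E).
move=> -> ; last 2 first.
- exact: measurableT_comp (mg n.+1) (@measurable_cons' n).
- by move=> p; rewrite lee_fin expR_ge0.
pose K := (\int[lebesgueTs n]_t (gaussn (rowT t))%:E)%E.
have K0 : (0 <= K)%E by apply: integral_ge0 => t _; rewrite lee_fin expR_ge0.
have KE : K = (fine K)%:E by rewrite fineK// ge0_fin_numE.
rewrite (eq_integral (fun y : measurableTypeR R => (fine K)%:E * (gauss4 y)%:E)%E); last first.
  move=> y _; rewrite /fubini_G -KE muleC.
  rewrite -ge0_integralZl//; last 2 first.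
  - by move=> t _; rewrite lee_fin expR_ge0.
  - by rewrite lee_fin expR_ge0.
    apply: eq_integral => t _.
    by rewrite rowT_cons gaussn_consR EFinM.
  exact: mg.
have mg4 : measurable_fun (setT : set (measurableTypeR R)) (EFin \o gauss4).
  by apply/measurable_EFinP; exact: (continuous_measurable_fun continuous_gauss4).
rewrite [ltLHS](_ : _ = (fine K)%:E * \int[leb]_y (gauss4 y)%:E)%E; last first.
  apply: ge0_integralZl_EFin => //; last by rewrite fine_ge0.
  by move=> y _; rewrite lee_fin expR_ge0.
rewrite lte_mul_pinfty//; first by rewrite lee_fin fine_ge0.
have /integrableP[_] := integrable_gauss4.
congr (_ < _)%E; apply: eq_integral => y _.
by rewrite /= ger0_norm ?expR_ge0.
Qed.

Definition half (c : bool) : set R := [set y | c -> 0 < y].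
(** The constraints are indexed by [nat] rather than by the ordinals below [n], so that removing the
    first coordinate replaces [b] by [b \o S] without any cast. This family of boxes, unlike the
    orthants alone, is visibly closed under that operation. *)
Definition boxT (b : nat -> bool) n : set (n.-tuple R) :=
  [set t | forall i : 'I_n, half (b i) (tnth t i)].

Lemma measurable_half c : measurable (half c : set (measurableTypeR R)).
Proof.
case: c.
  rewrite (_ : half _ = `]0, +oo[%classic); first exact: measurable_itv.
  by apply/seteqP; split=> y; rewrite /half/= in_itv/= andbT => // /(_ isT).
by rewrite (_ : half _ = setT)//; apply/seteqP; split.
Qed.

Lemma measurable_boxT b n : measurable (@boxT b n).
Proof.
by apply: (@measurable_tuple_prod n (fun i => half (b i))) => i;
  exact: measurable_half.
Qed.

Lemma good_half c : good_weight leb (half c) gauss4.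
Proof.
split; [exact: measurable_half| |exact: gauss4_01].
by apply: (integrableS measurableT) => //; [exact: measurable_half|exact: integrable_gauss4].
Qed.

Lemma good_boxT b n :
  good_weight (lebesgueT n) (@boxT b n) (@gaussn n \o @rowT R n).
Proof.
split; [exact: measurable_boxT| |by move=> t; exact: gaussn_01].
by apply: (integrableS measurableT) => //; [exact: measurable_boxT|exact: integrable_gaussn].
Qed.

Lemma boxT_consT b n t y :
  @boxT b n.+1 (consT (t, y)) <-> half (b 0%N) y /\ @boxT (b \o S) n t.
Proof.
split.
  move=> H; split; first exact: (H ord0).
  by move=> i; have := H (lift ord0 i); rewrite tnthS.
move=> [Hy Ht] i; case: (unliftP ord0 i) => [k ->|->]; last exact: Hy.
by rewrite tnthS; exact: Ht.
Qed.

End TupleLebesgue.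

(** * Iterated integrals *)

Section IteratedIntegrals.
Context {R : realType}.
Local Notation leb := (@lebesgue_measure R).
Local Notation TR n := (n.-tuple R * measurableTypeR R)%type.
Implicit Types (b : nat -> bool) (c : bool).

Definition dom1 c (f : R -> R) :=
  dominated (half c : set (measurableTypeR R)) gauss4 f.
Definition domn b n (F : 'rV[R]_n -> R) :=
  dominated (boxT b (n := n)) (@gaussn R n \o @rowT R n) (F \o @rowT R n).
Definition int1 c (f : R -> R) := \int[leb]_(y in half c) f y.
Definition intn b n (F : 'rV[R]_n -> R) :=
  \int[lebesgueT n]_(t in boxT b (n := n)) F (rowT t).

Lemma dom1_gauss4 c : dom1 c gauss4.
Proof.
split; last by exists 1 => x _; rewrite mul1r ger0_norm ?expR_ge0.
apply: (@measurable_funS _ _ _ _ setT) => //.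
exact: (continuous_measurable_fun (@continuous_gauss4 R)).
Qed.

Lemma domn_gaussn b n : domn b (@gaussn R n).
Proof.
split; last by exists 1 => x _; rewrite mul1r ger0_norm ?expR_ge0.
apply: (@measurable_funS _ _ _ _ setT) => //.
exact: (continuous_measurable_rowT (@continuous_gaussn R n)).
Qed.

Lemma dom1_integral_le c f M : dom1 c f ->
  (forall y, half c y -> `|f y| <= M * gauss4 y) ->
  `|int1 c f| <= M * int1 c gauss4.
Proof.
move=> df fM; have dg := dom1_gauss4 c.
rewrite -(dominated_intZ (good_half c) M dg).
apply: (le_trans (le_normr_Rintegral _ (dominated_integrable (good_half c) df))).
  exact: measurable_half.
apply: (dominated_int_le (good_half c)) => //.
  have [mf fM'] := df; split; first exact: (measurableT_comp (@normr_measurable _ setT) mf).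
  by case: fM' => N H; exists N => y hy; rewrite normr_id H.
exact: dominatedZ.
Qed.

Lemma domn_integral_le b n (F : 'rV[R]_n -> R) M : domn b F ->
  (forall t, boxT b t -> `|F (rowT t)| <= M * gaussn (rowT t)) ->
  `|intn b F| <= M * intn b (@gaussn R n).
Proof.
move=> df fM; have dg := domn_gaussn b n.
rewrite /intn -(dominated_intZ (good_boxT b n) M dg).
apply: (le_trans (le_normr_Rintegral _ (dominated_integrable (good_boxT b n) df))).
  exact: measurable_boxT.
apply: (dominated_int_le (good_boxT b n)) => //.
  have [mf fM'] := df; split; first exact: (measurableT_comp (@normr_measurable _ setT) mf).
  by case: fM' => N H; exists N => y hy; rewrite normr_id H.
exact: dominatedZ.
Qed.

Section Fubini.
Variables (b : nat -> bool) (n : nat) (F : 'rV[R]_n.+1 -> R).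
Hypothesis dF : domn b F.
Let bS := b \o S.
Let f := (F \o @rowT R n.+1) \_ (boxT b (n := n.+1)).
Let g (p : TR n) : \bar R := (f (consT p))%:E.

(** Fubini is applied on the full product space, hence the extension by zero. It splits along the
    two variables because the box is a product. *)
Let fE t y : f (consT (t, y)) =
  ((fun y => (F (consR y (rowT t)))) \_ (half (b 0%N))) y * \1_(boxT bS (n:=n)) t.
Proof.
rewrite /f !patchE indicE /=.
case: (boolP (consT (t, y) \in _)) => [/set_mem/boxT_consT[hy ht]|].
  by rewrite !mem_set// mulr1 rowT_cons.
move=> /negP h; case: (boolP (y \in _)) => [/set_mem hy|]; last by rewrite mul0r.
case: (boolP (t \in _)) => [/set_mem ht|]; last by rewrite mulr0.
by exfalso; apply: h; apply/mem_set/boxT_consT.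
Qed.

Let fi : (lebesgueT n.+1).-integrable setT (EFin \o f).
Proof.
have := dominated_integrable (good_boxT b n.+1) dF.
by move/(integrable_mkcond _ (measurable_boxT b (n:=n.+1))); rewrite restrict_EFin.
Qed.

Let gi : (lebesgueTs n \x leb)%E.-integrable setT g.
Proof. exact: (integrable_lebesgueTS fi). Qed.

Let mg : measurable_fun setT (fun p : TR n => f (consT p)).
Proof. by apply/measurable_EFinP; case/integrableP: gi. Qed.

Lemma domn_slice y : half (b 0%N) y -> domn bS (fun x => F (consR y x)).
Proof.
move=> hy; split.
  apply: (@eq_measurable_fun _ _ _ _ _ (fun t => f (consT (t, y)))).
    move=> t /set_mem ht /=; rewrite fE patchE indicE !mem_set//.
    by rewrite mulr1.
  apply: (@measurable_funS _ _ _ _ setT) => //.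
  exact: (measurableT_comp mg (pair2_measurable y)).
have [_ [M FM]] := dF; exists (M * gauss4 y) => t ht /=.
have := FM (consT (t, y)) (proj2 (boxT_consT _ _ _) (conj hy ht)).
by rewrite /= rowT_cons gaussn_consR mulrA.
Qed.

Lemma dom1_slice t : boxT bS t -> dom1 (b 0%N) (fun y => F (consR y (rowT t))).
Proof.
move=> ht; split.
  apply: (@eq_measurable_fun _ _ _ _ _ (fun y => f (consT (t, y)))).
    move=> y /set_mem hy /=; rewrite fE patchE indicE !mem_set//.
    by rewrite mulr1.
  apply: (@measurable_funS _ _ _ _ setT) => //.
  exact: (measurableT_comp mg (pair1_measurable t)).
have [_ [M FM]] := dF; exists (M * gaussn (rowT t)) => y hy /=.
have := FM (consT (t, y)) (proj2 (boxT_consT _ _ _) (conj hy ht)).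
by rewrite /= rowT_cons gaussn_consR mulrA mulrAC.
Qed.

Let GE y : fubini_G (lebesgueTs n) g y =
  (((fun y => intn bS (fun x => F (consR y x))) \_ (half (b 0%N))) y)%:E.
Proof.
rewrite /fubini_G patchE; case: ifPn => [/set_mem hy|/negP hy].
  rewrite -(dominated_int_fin (good_boxT bS n) (domn_slice hy)).
  rewrite [RHS]integral_mkcond; apply: eq_integral => t _.
  rewrite /g fE patchE indicE mem_set// patchE.
  by case: ifPn => _; rewrite ?mulr1 ?mulr0.
rewrite integral0_eq// => t _; rewrite /g fE patchE.
by case: ifPn => [/hy//|_]; rewrite mul0r.
Qed.

Let FE t : fubini_F leb g t =
  (((fun t => int1 (b 0%N) (fun y => F (consR y (rowT t)))) \_ (boxT bS (n:=n))) t)%:E.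
Proof.
rewrite /fubini_F patchE; case: ifPn => [/set_mem ht|/negP ht].
  rewrite -(dominated_int_fin (good_half _) (dom1_slice ht)).
  rewrite [RHS]integral_mkcond; apply: eq_integral => y _.
  rewrite /g fE !patchE indicE [t \in _]mem_set//= mulr1.
  by case: ifPn.
rewrite integral0_eq// => y _; rewrite /g fE indicE.
by rewrite (negbTE (introN idP ht)) mulr0.
Qed.

(** The weight factors as [gauss4 y * gaussn x]: integrating out x leaves the weight in y,
    multiplied by a constant. *)
Lemma dom1_intn : dom1 (b 0%N) (fun y => intn bS (fun x => F (consR y x))).
Proof.
split.
  apply: (measurable_restrictT _ (measurable_half (b 0%N))).2.
  apply/measurable_EFinP.
  have := measurable_fubini_G gi.
  by apply: eq_measurable_fun => y _; rewrite GE.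
have [M M0 FM] := dominated_bound (good_boxT b n.+1) dF.
exists (M * intn bS (@gaussn R n)) => y hy; rewrite mulrAC.
apply: (domn_integral_le (domn_slice hy)) => t ht.
have := FM (consT (t, y)) (proj2 (boxT_consT _ _ _) (conj hy ht)).
by rewrite /= rowT_cons gaussn_consR mulrA.
Qed.

Lemma domn_int1 : domn bS (fun x => int1 (b 0%N) (fun y => F (consR y x))).
Proof.
split.
  apply: (measurable_restrictT _ (measurable_boxT bS (n:=n))).2.
  apply/measurable_EFinP.
  have := measurable_fubini_F gi.
  by apply: eq_measurable_fun => y _; rewrite FE.
have [M M0 FM] := dominated_bound (good_boxT b n.+1) dF.
exists (M * int1 (b 0%N) gauss4) => t ht; rewrite mulrAC.
apply: (dom1_integral_le (dom1_slice ht)) => y hy.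
have := FM (consT (t, y)) (proj2 (boxT_consT _ _ _) (conj hy ht)).
by rewrite /= rowT_cons gaussn_consR mulrA mulrAC.
Qed.

Let intnE : intn b F = fine (\int[(lebesgueTs n \x leb)%E]_p g p).
Proof.
rewrite /intn Rintegral_mkcond /Rintegral; congr fine.
exact: (integral_lebesgueTS fi).
Qed.

Lemma intn_cons : intn b F =
  int1 (b 0%N) (fun y => intn bS (fun x => F (consR y x))).
Proof.
rewrite intnE -(integral21_prod_meas1 gi) /int1 Rintegral_mkcond.
by congr fine; apply: eq_integral => y _; rewrite GE.
Qed.

Lemma intn_consC : intn b F =
  intn bS (fun x => int1 (b 0%N) (fun y => F (consR y x))).
Proof.
rewrite intnE -(integral12_prod_meas1 gi) [RHS]/intn Rintegral_mkcond.
by congr fine; apply: eq_integral => y _; rewrite FE.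
Qed.

End Fubini.
End IteratedIntegrals.

(** * One-dimensional calculus *)

Section Calculus.
Context {R : realType} {V : normedModType R}.
Implicit Types (f g : V -> R) (x v : V) (a b : R).

(** The rules of calculus are restated for functions written pointwise; [der_eq] then brings the
    computed derivative to the desired form by algebra. *)
Lemma derM f g x v a b : is_derive x v f a -> is_derive x v g b ->
  is_derive x v (fun y => f y * g y) (a * g x + f x * b).
Proof.
move=> df dg; have -> : (fun y => f y * g y) = f * g by [].
by apply: is_derive_eq; rewrite addrC /GRing.scale/= (mulrC a).
Qed.

Lemma derD f g x v a b : is_derive x v f a -> is_derive x v g b ->
  is_derive x v (fun y => f y + g y) (a + b).
Proof. by move=> df dg; exact: is_deriveD. Qed.

Lemma derB f g x v a b : is_derive x v f a -> is_derive x v g b ->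
  is_derive x v (fun y => f y - g y) (a - b).
Proof. by move=> df dg; exact: is_deriveB. Qed.

Lemma derZ f k x v a : is_derive x v f a ->
  is_derive x v (fun y => k * f y) (k * a).
Proof. by move=> df; exact: is_deriveZ. Qed.

Lemma derC (k : R) x v : is_derive x v (fun=> k) 0.
Proof. exact: is_derive_cst. Qed.

Lemma der_eq f x v a b : is_derive x v f a -> a = b -> is_derive x v f b.
Proof. by move=> df <-. Qed.

Lemma continuousMf f g : continuous f -> continuous g ->
  continuous (fun x => f x * g x).
Proof. by move=> cf cg x; apply: continuousM; [exact: cf|exact: cg]. Qed.

Lemma continuousDf f g : continuous f -> continuous g ->
  continuous (fun x => f x + g x).
Proof. by move=> cf cg x; apply: continuousD; [exact: cf|exact: cg]. Qed.

Lemma continuousBf f g : continuous f -> continuous g ->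
  continuous (fun x => f x - g x).
Proof. by move=> cf cg x; apply: continuousB; [exact: cf|exact: cg]. Qed.

Lemma continuousZf k f : continuous f -> continuous (fun x => k * f x).
Proof. by move=> cf x; apply: continuousM; [exact: cst_continuous|exact: cf]. Qed.

Lemma continuousX2f f : continuous f -> continuous (fun x => f x ^+ 2).
Proof. by move=> cf; under eq_fun do rewrite expr2; exact: continuousMf. Qed.

End Calculus.

Section Calculus1.
Context {R : realType}.
Implicit Types (f g : R -> R) (x y a b : R) (c : bool).
Local Notation leb := (@lebesgue_measure R).

Lemma derivable_continuous_at f x a : is_derive x 1 f a -> {for x, continuous f}.
Proof. by case=> df _; exact/differentiable_continuous/derivable1_diffP. Qed.

Lemma derivable_continuous f g : (forall x, is_derive x 1 f (g x)) -> continuous f.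
Proof. by move=> df x; exact: derivable_continuous_at (df x). Qed.

Lemma derivative_off_support f g (A : set R) : closed A ->
  (forall x, f x != 0 -> A x) -> (forall x, is_derive x 1 f (g x)) ->
  forall x, g x != 0 -> A x.
Proof.
move=> cA fA df x; apply: contra_neqP => Ax.
have nA : \forall y \near x, f y = 0.
  have oA : open (~` A) by exact: closed_openC.
  have : \forall y \near x, (~` A) y by exact: open_nbhs_nbhs.
  by apply: filterS => y nAy; apply/eqP/negPn/negP => /fA.
have H : is_derive x 1 f 0.
  apply: (@near_eq_is_derive _ _ _ (cst 0)) => //.
  by apply: filterS nA => y ->.
have [_ <-] := df x; by case: H.
Qed.

Lemma exprn_expR_le m : exists C, forall x, `|x| ^+ m * gauss4 x <= C.
Proof.
case: m => [|m].
  exists 1 => x; rewrite expr0 mul1r.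
  by have /andP[] := gauss4_01 x.
(* [K] splits the Gaussian into m + 1 equal factors exp(-x^2/K), one for each factor |x|. There
   remains |x| <= K exp(x^2/K), which follows from 1 + t <= exp t and K >= 4. *)
pose K : R := 4 * m.+1%:R; exists (K ^+ m.+1) => x.
have K4 : 4 <= K by rewrite /K ler_peMr// ler1n.
have K0 : 0 < K by rewrite (lt_le_trans _ K4).
have -> : gauss4 x = expR (- (x ^+ 2 / K)) ^+ m.+1.
  rewrite /gauss4 -expRM_natl; congr expR; rewrite /K.
  have : m.+1%:R != 0 :> R by rewrite pnatr_eq0.
  by move: (m.+1%:R : R) => k k0; field.
rewrite -exprMn lerXn2r ?nnegrE ?mulr_ge0 ?expR_ge0 ?(ltW K0)//.
rewrite expRN ler_pdivrMr ?expR_gt0//.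
have := expR_ge1Dx (x ^+ 2 / K).
move=> /(ler_wpM2l (ltW K0)); apply: le_trans.
rewrite mulrDr mulr1 mulrC divfK ?gt_eqF//.
have := sqr_ge0 (`|x| - 1); rewrite -[x ^+ 2]real_normK ?num_real//.
by set t := `|x|; have t0 : 0 <= t := normr_ge0 x; nra.
Qed.

(* The lowest eigenfunction of -f'' + x^2 f, with eigenvalue [eigv c]: on the
   half-line with Dirichlet condition at 0 if [c], on the line otherwise. *)
Definition eig c x := (if c then x else 1) * expR (- (x ^+ 2 / 2)).
Definition eig' c x := (if c then 1 - x ^+ 2 else - x) * expR (- (x ^+ 2 / 2)).
Definition eigv c : R := if c then 3 else 1.

Lemma der_gauss x :
  is_derive x 1 (fun x => expR (- (x ^+ 2 / 2))) (- x * expR (- (x ^+ 2 / 2))).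
Proof.
have := @is_derive1_comp _ expR (fun x => - (x ^+ 2 / 2)) x _ (- x)
  (is_derive_expR _).
rewrite /comp mulrC; apply.
have -> : (fun x : R => - (x ^+ 2 / 2)) = fun x => (- 2^-1) * (x * x).
  by apply/funext => y; field.
have H := is_derive_id x (1 : R).
by apply: (der_eq (derZ _ (derM H H))); field.
Qed.

Lemma der_eig c x : is_derive x 1 (eig c) (eig' c x).
Proof.
have H := is_derive_id x (1 : R).
rewrite /eig /eig'; case: c.
  by apply: (der_eq (derM H (der_gauss x))); ring.
have -> : (fun x : R => 1 * expR (- (x ^+ 2 / 2))) = fun x => expR (- (x ^+ 2 / 2)).
  by apply/funext => y; rewrite mul1r.
exact: der_gauss.
Qed.

(** This is the eigenvalue equation, in the form in which it enters every integration by parts. *)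
Lemma der_eig' c x : is_derive x 1 (eig' c) ((x ^+ 2 - eigv c) * eig c x).
Proof.
have H := is_derive_id x (1 : R).
rewrite /eig /eig' /eigv; case: c.
  have -> : (fun x : R => (1 - x ^+ 2) * expR (- (x ^+ 2 / 2))) =
      fun x => (1 - x * x) * expR (- (x ^+ 2 / 2)).
    by apply/funext => y; rewrite expr2.
  apply: (der_eq (derM (derB (derC 1 x 1) (derM H H)) (der_gauss x))).
  by rewrite /=; ring.
have -> : (fun x : R => - x * expR (- (x ^+ 2 / 2))) =
    fun x => (-1 * x) * expR (- (x ^+ 2 / 2)).
  by apply/funext => y; rewrite mulN1r.
by apply: (der_eq (derM (derZ (-1) H) (der_gauss x))); ring.
Qed.

Lemma gauss4_sqr x : expR (- (x ^+ 2 / 2)) = gauss4 x * gauss4 x.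
Proof. by rewrite /gauss4 -expRD; congr expR; field. Qed.

Lemma dom1_monomial c m : dom1 c (fun x => x ^+ m * expR (- (x ^+ 2 / 2))).
Proof.
split.
  apply: (@measurable_funS _ _ _ _ setT) => //.
  apply: continuous_measurable_fun; apply: continuousMf.
    exact: exprn_continuous.
  exact: derivable_continuous der_gauss.
have [C HC] := exprn_expR_le m; exists C => x _.
rewrite normrM normrX [`|expR _|]ger0_norm ?expR_ge0// gauss4_sqr mulrA.
by rewrite ler_wpM2r ?expR_ge0// HC.
Qed.

Lemma dom1_eig (b c : bool) : dom1 b (eig c).
Proof.
by have := dom1_monomial b c; apply: eq_dominated => x _; rewrite /eig; case: c;
  rewrite ?expr1 ?expr0.
Qed.

Lemma dom1_eig' (b c : bool) : dom1 b (eig' c).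
Proof.
case: c; rewrite /eig'.
  have := dominatedB (dom1_monomial b 0) (dom1_monomial b 2).
  by apply: eq_dominated => x _; ring.
have := dominatedZ (-1) (dom1_monomial b 1).
by apply: eq_dominated => x _; ring.
Qed.

(** The product of two dominated functions carries the square of the weight; one of the two copies
    absorbs the growth of x^2. *)
Lemma dom1_sqr_mul c f g : dom1 c f -> dom1 c g ->
  dom1 c (fun x => x ^+ 2 * (f x * g x)).
Proof.
move=> df dg; split.
  apply: measurable_funM; first by [].
  by case: (dominatedM (good_half c) df dg).
have [M M0 fM] := dominated_bound (good_half c) df.
have [N N0 gN] := dominated_bound (good_half c) dg.
have [C HC] := exprn_expR_le 2; exists (C * (M * N)) => x hx.
rewrite normrM normrX normrM.
apply: (@le_trans _ _ (`|x| ^+ 2 * ((M * gauss4 x) * (N * gauss4 x)))).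
  by rewrite ler_wpM2l ?exprn_ge0// ler_pM// ?fM ?gN.
have -> : `|x| ^+ 2 * (M * gauss4 x * (N * gauss4 x)) =
  (`|x| ^+ 2 * gauss4 x) * (M * N * gauss4 x) by ring.
by rewrite -[leRHS]mulrA ler_wpM2r ?HC// !mulr_ge0 ?expR_ge0.
Qed.

Lemma dom1_compact c f M : continuous f -> (forall x, f x != 0 -> `|x| <= M) ->
  dom1 c f.
Proof.
move=> cf fM; split.
  apply: (@measurable_funS _ _ _ _ setT) => //.
  exact: continuous_measurable_fun.
have cg : continuous (fun x => `|f x|).
  by move=> x; apply: (continuous_comp (cf x)); exact: norm_continuous.
have [M0|M0] := leP 0 M; last first.
  exists 0 => x _; rewrite mul0r; have [->|/fM] := eqVneq (f x) 0.
    by rewrite normr0.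
  by rewrite leNgt (lt_le_trans M0)//.
have [||z _ zmax] := @EVT_max R (fun x => `|f x|) (- M) M.
- by rewrite ge0_cp.
- exact: continuous_subspaceT.
exists (`|f z| * expR (M ^+ 2 / 4)) => x _.
have [->|/fM xM] := eqVneq (f x) 0.
  by rewrite normr0 !mulr_ge0 ?expR_ge0.
rewrite -mulrA /gauss4 -expRD; apply: (le_trans (zmax x _)).
  by rewrite in_itv/= -ler_norml.
rewrite ler_peMr// -[leLHS]expR0 ler_expR.
rewrite -mulrBl divr_ge0// subr_ge0 -[x ^+ 2]real_normK ?num_real//.
by rewrite lerXn2r ?nnegrE.
Qed.

Lemma gauss4_cvg0 : gauss4 (j.+1%:R : R) @[j --> \oo] --> (0 : R).
Proof.
have [C HC] := exprn_expR_le 1.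
have C0 : 0 <= C.
  by apply: (le_trans _ (HC 0)); rewrite mulr_ge0 ?expR_ge0 ?exprn_ge0.
apply: (@squeeze_cvgr _ _ _ _ (fun=> 0) (fun j => C * harmonic j)).
- apply: nearW => j; rewrite expR_ge0/=.
  rewrite ler_pdivlMr// mulrC; apply: le_trans (HC j.+1%:R).
  by rewrite expr1 ger0_norm.
- exact: cvg_cst.
- by rewrite -[X in _ --> X](mulr0 C); apply: cvgM; [exact: cvg_cst|exact: cvg_harmonic].
Qed.

(** The source of all integrations by parts: the fundamental theorem on a bounded interval, then
    dominated convergence. The Gaussian bound removes the boundary terms at infinity, and the last
    hypothesis the one at 0 on the half-line. *)
Lemma int1_derive c f g : (forall x, is_derive x 1 f (g x)) -> continuous g ->
  dom1 c g -> (exists M, forall x, half c x -> `|f x| <= M * gauss4 x) ->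
  (c -> f 0 = 0) -> int1 c g = 0.
Proof.
move=> df cg dg [M fM] f0.
(* On the half-line the lower end stays at 0, which is outside [half true]; the null set {0} is
   handled by passing to a half-open interval. *)
pose a (j : nat) : R := if c then 0 else - j.+1%:R.
have aj j : a j < j.+1%:R by rewrite /a; case: (c) => //; rewrite gtrN.
pose I j := `[a j, j.+1%:R]%classic.
have ftc j : \int[leb]_(x in I j) g x = f j.+1%:R - f (a j).
  rewrite /Rintegral /I (@continuous_FTC2 _ g f)//.
  - exact: continuous_subspaceT.
  - split.
    + by move=> x _; case: (df x).
    + exact/cvg_at_right_filter/(derivable_continuous df).
    + exact/cvg_at_left_filter/(derivable_continuous df).
  - by move=> x _; rewrite derive1E; case: (df x).
have gI j : int1 c (g \_ (I j)) = f j.+1%:R - f (a j).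
  rewrite -ftc /int1 -Rintegral_mkcondr.
  rewrite /I /a; move: dg; case: (c) => dg.
    rewrite (_ : _ `&` _ = `]0, j.+1%:R]%classic); last first.
      apply/seteqP; split => x; rewrite /half/= !in_itv/=.
        by move=> [/(_ isT) x0 /andP[_ ->]]; rewrite x0.
      by move=> /andP[x0 ->]; split => //; rewrite ltW.
    rewrite Rintegral_itv_obnd_cbnd//.
    apply: (@integrableS _ _ _ leb (half true : set (measurableTypeR R))) => //.
    - exact: measurable_half.
    - by move=> x; rewrite /half/= in_itv/= => /andP[].
    - exact: (dominated_integrable (good_half true) dg).
  by congr (Rintegral _ _ _); apply/seteqP; split => x //= [].
have cf : f j.+1%:R @[j --> \oo] --> (0 : R).
  have : M * gauss4 j.+1%:R @[j --> \oo] --> (0 : R).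
    by rewrite -[X in _ --> X](mulr0 M); apply: cvgM; [exact: cvg_cst|exact: gauss4_cvg0].
  move=> h; apply/norm_cvg0P; apply: (squeeze_cvgr _ (cvg_cst 0) h).
  by apply: nearW => j; rewrite normr_ge0/= fM// /half; move=> _; exact: ltr0Sn.
have cfa : f (a j) @[j --> \oo] --> (0 : R).
  rewrite /a; move: fM f0; case: (c) => fM f0.
    by rewrite f0//; exact: cvg_cst.
  have : M * gauss4 j.+1%:R @[j --> \oo] --> (0 : R).
    by rewrite -[X in _ --> X](mulr0 M); apply: cvgM; [exact: cvg_cst|exact: gauss4_cvg0].
  move=> h; apply/norm_cvg0P; apply: (squeeze_cvgr _ (cvg_cst 0) h).
  apply: nearW => j; rewrite normr_ge0/=; apply: (le_trans (fM _ _)) => //.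
  by rewrite /gauss4 sqrrN.
have c1 : int1 c (g \_ (I j)) @[j --> \oo] --> (0 : R).
  rewrite (_ : (fun j => _) = fun j => f j.+1%:R - f (a j)); last exact/funext.
  by rewrite -(subr0 (0 : R)); exact: cvgB.
have [K K0 gK] := dominated_bound (good_half c) dg.
have c2 : int1 c (g \_ (I j)) @[j --> \oo] --> int1 c g.
  apply: (@dominated_int_cvg _ _ _ _ _ _ (good_half c) _ _ K).
  - move=> j; apply: (measurable_restrict _ _ _).1.
    + exact: measurable_itv.
    + exact: measurable_half.
    + by apply: (@measurable_funS _ _ _ _ setT) => //;
        exact: continuous_measurable_fun.
  - move=> j x hx; rewrite patchE; case: ifP => _; first exact: gK.
    by rewrite normr0 mulr_ge0// expR_ge0.
  - move=> x hx; apply: cvg_near_cst.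
    near=> j; rewrite patchE mem_set// /I/= in_itv/=.
    have xj : `|x| <= j.+1%:R.
      near: j; exists (Num.truncn `|x|) => // j /= hj.
      apply: (le_trans (ltW (truncnS_gt _))).
      by rewrite ler_nat.
    move: xj; rewrite ler_norml => /andP[x1 ->]; rewrite andbT /a.
    by move: hx; rewrite /half; case: (c) => // /(_ isT) /ltW.
by apply: (cvg_unique _ c2 c1).
Unshelve. all: by end_near. Qed.

End Calculus1.

(** * The one-dimensional spectral gap *)

Section Poincare.
Context {R : realType}.
Implicit Types (f g : R -> R) (x y : R) (c : bool).
Local Notation leb := (@lebesgue_measure R).

Lemma sqr_increment_le c (f f1 h h1 p p1 : R -> R) :
  (forall x, half c x -> is_derive x 1 f (f1 x)) ->
  (forall x, half c x -> is_derive x 1 h (h1 x)) ->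
  (forall x, half c x -> is_derive x 1 p (p1 x)) ->
  (forall x, half c x -> 0 < h1 x) ->
  (forall x, half c x -> f1 x ^+ 2 = h1 x * p1 x) ->
  forall x y : R, half c x -> half c y ->
  (f x - f y) ^+ 2 <= (h x - h y) * (p x - p y).
Proof.
move=> df dh dp h0 fhp x y.
wlog xy : x y / y <= x.
  move=> W; have [|/ltW] := leP y x; first exact: W.
  move=> xy hx hy; have := W y x xy hy hx.
  by rewrite -sqrrN opprB -(mulrNN (h x - _)) !opprB.
move=> hx hy; move: xy; rewrite le_eqVlt => /predU1P[->|yx].
  by rewrite !subrr expr0n mul0r.
have hz z : z \in `[y, x] -> half c z.
  rewrite in_itv/= => /andP[yz _] hc.
  by apply: lt_le_trans yz; exact: hy.
(* This quotient of increments is the [s] at which s^2 (h x - h y) - 2 s (f x - f y) + (p x - p y)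
   is least. *)
have [s Hs] : exists s, s * (h x - h y) = f x - f y /\ 0 < h x - h y.
  have dh' : {in `[y, x], forall z, derivable h z 1}.
    by move=> z hzz; case: (dh z (hz z hzz)).
  have [z zxy E] := MVT yx (fun z hzz => dh z (hz z (subset_itv_oo_cc hzz)))
    (derivable_within_continuous dh').
  have H : 0 < h x - h y.
    rewrite E mulr_gt0 ?subr_gt0//; apply/h0/hz; exact: subset_itv_oo_cc.
  by exists ((f x - f y) / (h x - h y)); rewrite divfK ?gt_eqF.
(* Cauchy-Schwarz without integrals: q' = s^2 h' - 2 s f' + p' is nonnegative
   because f'^2 = h' p', and q(x) >= q(y) is the claim for this s. *)
pose q z := s ^+ 2 * h z - 2 * s * f z + p z.
have dq z : half c z -> is_derive z 1 q (s ^+ 2 * h1 z - 2 * s * f1 z + p1 z).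
  by move=> hc; exact: (derD (derB (derZ _ (dh z hc)) (derZ _ (df z hc))) (dp z hc)).
have dq' : {in `[y, x], forall z, derivable q z 1}.
  by move=> z hzz; case: (dq z (hz z hzz)).
have [z zxy E] := MVT yx (fun z hzz => dq z (hz z (subset_itv_oo_cc hzz)))
  (derivable_within_continuous dq').
have hcz : half c z by apply: hz; exact: subset_itv_oo_cc.
have q1 : 0 <= s ^+ 2 * h1 z - 2 * s * f1 z + p1 z.
  rewrite -(pmulr_rge0 _ (h0 z hcz)).
  have -> : h1 z * (s ^+ 2 * h1 z - 2 * s * f1 z + p1 z) =
     s ^+ 2 * h1 z ^+ 2 - 2 * s * h1 z * f1 z + h1 z * p1 z by ring.
  rewrite -(fhp z hcz).
  have -> : s ^+ 2 * h1 z ^+ 2 - 2 * s * h1 z * f1 z + f1 z ^+ 2 =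
    (s * h1 z - f1 z) ^+ 2 by ring.
  exact: sqr_ge0.
have : 0 <= q x - q y by rewrite E mulr_ge0// subr_ge0 ltW.
case: Hs => Hs H0; rewrite -(pmulr_rge0 _ H0) /q.
have -> : (h x - h y) * (s ^+ 2 * h x - 2 * s * f x + p x - (s ^+ 2 * h y - 2 * s * f y + p y))
  = (s * (h x - h y)) ^+ 2 - 2 * (s * (h x - h y)) * (f x - f y) +
    (h x - h y) * (p x - p y) by ring.
rewrite Hs; lra.
Qed.

(** It supplies the function p with p' = f'^2 / k' of the Poincare inequality. Integrating from -oo
    bounds p by the L^1 norm of [t], so that multiplying by p preserves domination. *)
Lemma bounded_antiderivative (t : R -> R) M : continuous t ->
  (forall x, t x != 0 -> `|x| <= M) ->
  exists p, (forall x, is_derive x 1 p (t x)) /\ exists K, forall x, `|p x| <= K.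
Proof.
move=> ct tM; have dt := dom1_compact false ct tM.
have it : leb.-integrable setT (EFin \o t).
  have := dominated_integrable (good_half false) dt.
  by congr (_.-integrable _ _); apply/seteqP; split.
pose p x := \int[leb]_(y in `]-oo, x]) t y.
have it' x : leb.-integrable `]-oo, x] (EFin \o t).
  by apply: integrableS it.
exists p; split.
  move=> x; have [||d1 d2] := @continuous_FTC1 R t -oo%O x (x + 1) _ (it' _) _ (ct x).
  - by rewrite ltrDl.
  - by rewrite ltNyr.
  - by apply: DeriveDef => //; rewrite -d2 derive1E.
exists (\int[leb]_x `|t x|) => x.
apply: (le_trans (le_normr_Rintegral _ (it' x))) => //.
rewrite Rintegral_mkcond; apply: le_Rintegral => //.
- have mD : measurable (`]-oo, x]%classic : set (measurableTypeR R)).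
    exact: measurable_itv.
  have /integrable_norm := it' x.
  by move/(integrable_mkcond _ mD); rewrite restrict_EFin.
- exact: (integrable_norm it).
- by move=> y _; rewrite patchE; case: ifP => //= _; exact: normr_ge0.
Qed.

Lemma dom1_bounded_mul c (p g : R -> R) K : continuous p ->
  (forall x, `|p x| <= K) -> dom1 c g -> dom1 c (fun x => g x * p x).
Proof.
move=> cp pK [mg [N gN]]; split.
  apply: measurable_funM => //.
  by apply: (@measurable_funS _ _ _ _ setT) => //; exact: continuous_measurable_fun.
exists (N * K) => x hx; rewrite normrM mulrAC.
by rewrite ler_pM// gN.
Qed.

Lemma continuous_near0 (g : R -> R) x : (\forall y \near x, g y = 0) ->
  {for x, continuous g}.
Proof.
move=> g0; have gx := nbhs_singleton g0.
by apply: cvg_near_cst; apply: filterS g0 => y ->.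
Qed.

Lemma dom1D c f g : dom1 c f -> dom1 c g -> dom1 c (fun x => f x + g x).
Proof. exact: dominatedD. Qed.

Lemma dom1B c f g : dom1 c f -> dom1 c g -> dom1 c (fun x => f x - g x).
Proof. exact: dominatedB. Qed.

Lemma dom1M c f g : dom1 c f -> dom1 c g -> dom1 c (fun x => f x * g x).
Proof. exact: (dominatedM (good_half c)). Qed.

Lemma dom1Z c k f : dom1 c f -> dom1 c (fun x => k * f x).
Proof. exact: dominatedZ. Qed.

Lemma dom1X2 c f : dom1 c f -> dom1 c (fun x => f x ^+ 2).
Proof. exact: (dominatedX2 (good_half c)). Qed.

Lemma eq_dom1 c f g : (forall x, half c x -> f x = g x) -> dom1 c f -> dom1 c g.
Proof. exact: eq_dominated. Qed.

Lemma int1D c f g : dom1 c f -> dom1 c g ->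
  int1 c (fun x => f x + g x) = int1 c f + int1 c g.
Proof. exact: dominated_intD (good_half c) _ _. Qed.

Lemma int1Z c k f : dom1 c f -> int1 c (fun x => k * f x) = k * int1 c f.
Proof. exact: dominated_intZ (good_half c) k _. Qed.

Lemma int1_ge0 c f : (forall x, half c x -> 0 <= f x) -> 0 <= int1 c f.
Proof. by move=> f0; apply: Rintegral_ge0 => x /f0. Qed.

Lemma eq_int1 c f g : (forall x, half c x -> f x = g x) -> int1 c f = int1 c g.
Proof. by move=> fg; apply: eq_Rintegral => x /set_mem/fg. Qed.

Lemma int1_eig_gt0 (c e : bool) : 0 < int1 c (fun x : R => eig e x ^+ 2).
Proof.
(* This interval lies both in the line and in the half-line, and on it each of the two
   eigenfunctions is at least exp(-2). *)
pose I := `[1%R, 2%R]%classic : set R.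
have IE : half c `&` I = I.
  apply/seteqP; split => x //=; first by case.
  rewrite /I/= in_itv/= => /andP[x1 x2]; split; last by rewrite x1.
  by move=> _; exact: lt_le_trans x1.
pose d : R := expR (- (2 ^+ 2 / 2)) ^+ 2.
have d0 : 0 < d by rewrite exprn_gt0// expR_gt0.
have le_d x : (cst d \_ I) x <= eig e x ^+ 2.
  rewrite patchE; case: ifPn => [/set_mem|]; last by rewrite sqr_ge0.
  rewrite /I/= in_itv/= => /andP[x1 x2].
  rewrite /d /eig exprMn -[leLHS]mul1r ler_pM ?exprn_ge0 ?expR_ge0//.
    by case: e; rewrite ?expr1n// expr_ge1// ltW// (lt_le_trans _ x1).
  rewrite lerXn2r ?nnegrE ?expR_ge0// ler_expR lerN2 ler_pM2r//.
  by rewrite lerXn2r ?nnegrE// (le_trans _ x1).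
have de : dom1 c (fun x => eig e x ^+ 2) by exact/dom1X2/dom1_eig.
have dI : dom1 c (cst d \_ I).
  apply: (dominated_le _ de).
    apply: (measurable_restrict _ _ _).1.
    - exact: measurable_itv.
    - exact: measurable_half.
    - exact: measurable_cst.
  move=> x _; rewrite ger0_norm; last by rewrite patchE; case: ifP => // _; exact: ltW.
  by rewrite ger0_norm ?sqr_ge0.
apply: (@lt_le_trans _ _ (int1 c (cst d \_ I))).
  have mI : leb I = 1%:E.
    rewrite /I lebesgue_measure_itv/= lte_fin ltr1n/= -EFinB.
    by congr (_%:E); ring.
  rewrite /int1 -Rintegral_mkcondr IE.
  have -> : Rintegral leb I (cst d) = d * fine (leb I).
    by apply: Rintegral_cst; exact: measurable_itv.
  by rewrite mI mulr1.
exact: (dominated_int_le (good_half c) dI de (fun x _ => le_d x)).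
Qed.

Lemma derivative_norm_support f f1 M : (forall x, is_derive x 1 f (f1 x)) ->
  (forall x, f x != 0 -> `|x| <= M) -> forall x, f1 x != 0 -> `|x| <= M.
Proof.
move=> df fM x.
have -> : (`|x| <= M) = (x \in `[- M, M]) by rewrite in_itv/= ler_norml.
apply: (@derivative_off_support _ _ _ `[- M, M]%classic) df x => //.
  exact: interval_closed.
by move=> x /fM; rewrite /= in_itv/= ler_norml.
Qed.

Lemma derivative_ge_support f f1 d : (forall x, is_derive x 1 f (f1 x)) ->
  (forall x, f x != 0 -> d <= x) -> forall x, f1 x != 0 -> d <= x.
Proof.
move=> df fd x f1x.
have := @derivative_off_support _ _ _ `[d, +oo[%classic _ _ df x f1x.
rewrite /= in_itv/= andbT; apply; first exact: interval_closed.
by move=> y /fd; rewrite /= in_itv/= andbT.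
Qed.

Section PoincareProof.
Variables (c : bool) (f f1 : R -> R) (M : R).
Hypothesis df : forall x, is_derive x 1 f (f1 x).
Hypothesis cf1 : continuous f1.
Hypothesis fM : forall x, f x != 0 -> `|x| <= M.
Hypothesis fc : c -> exists2 d, 0 < d & forall x, f x != 0 -> d <= x.

Let f1M : forall x, f1 x != 0 -> `|x| <= M := derivative_norm_support df fM.

Let f1c : c -> exists2 d, 0 < d & forall x, f1 x != 0 -> d <= x.
Proof.
by move=> /fc[d d0 fd]; exists d => //; exact: derivative_ge_support df fd.
Qed.

(* [k] is the second eigenfunction of the operator -rho^-1 (rho f')' for the
   weight [rho], up to a factor; its eigenvalue is [kappa] (see [dH]).  Integrating
   (f x - f y)^2 <= (k x - k y) (p x - p y), where p' = f'^2 / k', against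
   rho x * rho y gives Var f <= int k p rho, and kappa * int k p rho is
   int f'^2 rho by parts. *)
Let k (x : R) := if c then x ^+ 2 - 3 / 2 else x.
Let k1 (x : R) := if c then 2 * x else 1.
Let kappa : R := if c then 4 else 2.
Let t x := f1 x ^+ 2 / k1 x.
Let rho x := eig c x ^+ 2.
Let H x := k1 x * rho x.

(** On the half-line the quotient by 2x is singular at 0 only, and [f1] is identically zero near 0
    since it vanishes below some d > 0. *)
Let ct : continuous t.
Proof.
rewrite /t /k1; case: (c) f1c => [/(_ isT)[d d0 f1d]|_].
  move=> x; have [xd|dx] := ltP x d.
    apply: continuous_near0.
    near=> y; have [->|/f1d] := eqVneq (f1 y) 0; first by rewrite expr0n mul0r.
    rewrite leNgt => /negP[]; near: y; exact: lt_nbhsl.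
  apply: (@continuousM _ _ (fun x => f1 x ^+ 2) (fun x => (2 * x)^-1)).
    exact: continuousX2f.
  apply: continuousV; last by apply: continuousZf => y; exact: cvg_id.
  by rewrite gt_eqF// mulr_gt0// (lt_le_trans d0).
apply: continuousMf; first exact: continuousX2f.
exact: cst_continuous.
Unshelve. all: by end_near. Qed.

Let tM x : t x != 0 -> `|x| <= M.
Proof. by move=> tx; apply: f1M; apply: contra_neq tx => f10; rewrite /t f10 expr0n mul0r. Qed.

Let k1t x : k1 x * t x = f1 x ^+ 2.
Proof.
(* Where [k1] vanishes, that is at 0 on the half-line, [f1] vanishes as well, so the value 0 of a
   division by 0 is the right one. *)
rewrite /t; have [k0|k0] := eqVneq (k1 x) 0; last by rewrite mulrC divfK.
rewrite k0 mul0r; move: k0 f1c; rewrite /k1; case: (c) => [x0 /(_ isT)[d d0 f1d]|].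
  have [->|/f1d] := eqVneq (f1 x) 0; first by rewrite expr0n.
  by move=> dx; lra.
by move=> /eqP; rewrite oner_eq0.
Qed.

Let dk x : is_derive x 1 k (k1 x).
Proof.
have I := is_derive_id x (1 : R); rewrite /k /k1; case: (c); last by [].
under [X in is_derive _ _ X]eq_fun do rewrite expr2.
by apply: (der_eq (derB (derM I I) (derC (3 / 2) x 1))); ring.
Qed.

Let drho x : is_derive x 1 rho (2 * eig c x * eig' c x).
Proof.
rewrite /rho; under [X in is_derive _ _ X]eq_fun do rewrite expr2.
by apply: (der_eq (derM (der_eig c x) (der_eig c x))); ring.
Qed.

Let dH x : is_derive x 1 H (- kappa * (k x * rho x)).
Proof.
have I := is_derive_id x (1 : R).
have dk1 : is_derive x 1 k1 (if c then 2 else 0).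
  rewrite /k1; case: (c); last exact: derC.
  by apply: (der_eq (derZ 2 I)); ring.
apply: (der_eq (derM dk1 (drho x))).
rewrite /rho /k /k1 /kappa /eig /eig'; case: (c).
  by field.
by ring.
Qed.

Let domrho : dom1 c rho.
Proof. exact/dom1X2/dom1_eig. Qed.

Let domkrho : dom1 c (fun x => k x * rho x).
Proof.
rewrite /k /rho; case: (c).
  have := dom1B (dom1M (dom1_monomial true 4) (dom1_monomial true 0))
     (dom1Z (3 / 2) (dom1M (dom1_monomial true 1) (dom1_monomial true 1))).
  by apply: eq_dom1 => x _; rewrite /eig; field.
have := dom1M (dom1_monomial false 1) (dom1_monomial false 0).
by apply: eq_dom1 => x _; rewrite /eig; ring.
Qed.

Let domH : dom1 c H.
Proof.
rewrite /H /k1 /rho; case: (c).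
  have := dom1Z 2 (dom1M (dom1_monomial true 3) (dom1_monomial true 0)).
  by apply: eq_dom1 => x _; rewrite /eig; ring.
have := dom1M (dom1_monomial false 0) (dom1_monomial false 0).
by apply: eq_dom1 => x _; rewrite /eig; ring.
Qed.

Let H0 : c -> H 0 = 0.
Proof. by rewrite /H /k1; case: (c) => // _; rewrite mulr0 mul0r. Qed.

Let ckrho : continuous (fun x => k x * rho x).
Proof.
apply: continuousMf; first exact: derivable_continuous dk.
exact: derivable_continuous drho.
Qed.

(** Up to a constant factor the integrand is the derivative of [H]. Thus [k] is orthogonal to the
    constants for the weight [rho], which removes the cross terms of the double integral. *)
Let int_krho : int1 c (fun x => k x * rho x) = 0.
Proof.
have : int1 c (fun x => - kappa * (k x * rho x)) = 0.
  apply: (@int1_derive _ c H) => //.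
  - exact: continuousZf.
  - exact: dom1Z.
  - by case: domH.
rewrite int1Z// => /eqP; rewrite mulf_eq0 oppr_eq0 => /orP[|/eqP//].
by rewrite /kappa; case: (c); rewrite pnatr_eq0.
Qed.

Let cf : continuous f := derivable_continuous df.

Lemma poincare :
  2 * int1 c (fun x => f x ^+ 2 * rho x) <=
  int1 c (fun x => f1 x ^+ 2 * rho x) +
  2 * int1 c (fun x => f x * rho x) ^+ 2 / int1 c rho.
Proof.
have [p [dp [K pK]]] := bounded_antiderivative ct tM.
have cp : continuous p := derivable_continuous dp.
have dpr : dom1 c (fun x => p x * rho x).
  by under eq_fun do rewrite mulrC; exact: dom1_bounded_mul pK _.
have dkpr : dom1 c (fun x => (k x * p x) * rho x).
  by under eq_fun do rewrite mulrAC; exact: dom1_bounded_mul pK _.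
have domf : dom1 c f by exact: dom1_compact fM.
have dfr : dom1 c (fun x => f x * rho x) by exact: dom1M.
have dffr : dom1 c (fun x => f x ^+ 2 * rho x).
  by apply: dom1M => //; exact: dom1X2.
have domf1 : dom1 c f1 by exact: dom1_compact f1M.
have df1r : dom1 c (fun x => f1 x ^+ 2 * rho x).
  by apply: dom1M => //; exact: dom1X2.
have E2 : kappa * int1 c (fun x => (k x * p x) * rho x) = int1 c (fun x => f1 x ^+ 2 * rho x).
  have : int1 c (fun x => - kappa * ((k x * p x) * rho x) + f1 x ^+ 2 * rho x) = 0.
    apply: (@int1_derive _ c (fun x => H x * p x)).
    - move=> x; apply: (der_eq (derM (dH x) (dp x))).
      by rewrite -k1t /H; ring.
    - apply: continuousDf.
        apply: continuousZf; under eq_fun do rewrite mulrAC.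
        exact: continuousMf.
      apply: continuousMf; first exact: continuousX2f.
      exact: derivable_continuous drho.
    - by apply: dom1D => //; exact: dom1Z.
    - by case: (dom1_bounded_mul cp pK domH).
    - by move=> hc; rewrite H0// mul0r.
  rewrite int1D//; last exact: dom1Z.
  by rewrite int1Z//; lra.
set G := int1 c rho; set A := int1 c (fun x => f x * rho x).
set B := int1 c (fun x => f x ^+ 2 * rho x).
set Kk := int1 c (fun x => k x * p x * rho x) in E2 *.
set P := int1 c (fun x => p x * rho x).
have k1_0 x : half c x -> 0 < k1 x.
  by rewrite /half /k1; case: (c) => // /(_ isT) x0; rewrite mulr_gt0.
(* The increment inequality is integrated in y against [rho] for a fixed x; the term in p x drops
   out by [int_krho]. The integration in x comes next and removes the term in [P] likewise. *)
have step1 x : half c x ->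
    0 <= (k x * p x - f x ^+ 2) * G - k x * P + Kk + 2 * f x * A - B.
  move=> hx.
  have : 0 <= int1 c (fun y => (k x * p x - f x ^+ 2) * rho y +
     ((- k x) * (p y * rho y) + ((- p x) * (k y * rho y) +
     (k y * p y * rho y + (2 * f x * (f y * rho y) + (-1) * (f y ^+ 2 * rho y)))))).
    apply: int1_ge0 => y hy.
    have := @sqr_increment_le c f f1 k k1 p t (fun x _ => df x) (fun x _ => dk x)
      (fun x _ => dp x) k1_0 (fun x _ => esym (k1t x)) x y hx hy.
    rewrite -subr_ge0 => h; have r0 : 0 <= rho y by exact: sqr_ge0.
    have := mulr_ge0 r0 h; congr (0 <= _); ring.
  rewrite !int1D; do ?[exact: dom1Z|exact: dom1D|by []|apply: dom1D].
  rewrite !int1Z//= int_krho -/G -/P -/Kk -/A -/B; lra.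
have : 0 <= int1 c (fun x => G * (k x * p x * rho x) + ((- G) * (f x ^+ 2 * rho x) +
   ((- P) * (k x * rho x) + ((Kk - B) * rho x + (2 * A) * (f x * rho x))))).
  apply: int1_ge0 => x hx; have r0 : 0 <= rho x by exact: sqr_ge0.
  have := mulr_ge0 r0 (step1 x hx); congr (0 <= _); ring.
rewrite !int1D; do ?[exact: dom1Z|exact: dom1D|by []|apply: dom1D].
rewrite !int1Z//= int_krho -/G -/P -/Kk -/A -/B => ineq.
have G0 : 0 < G by exact: int1_eig_gt0.
have f10 : 0 <= kappa * Kk.
  by rewrite E2; apply: int1_ge0 => x _; rewrite mulr_ge0 ?sqr_ge0.
(* The eigenvalue is 2 on the line and 4 on the half-line; the common value 2 suffices. Lowering
   [kappa] to 2 requires Kk >= 0, which comes from [E2]. *)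
have k2 : 2 <= kappa by rewrite /kappa; case: (c) => //; rewrite ler_nat.
have Kk0 : 0 <= Kk by nra.
rewrite -E2 -(ler_pM2r G0) [leRHS]mulrDl divfK ?gt_eqF//.
have h : 2 * Kk * G <= kappa * Kk * G by rewrite !ler_wpM2r// ltW.
lra.
Qed.

End PoincareProof.

Lemma poincare_eig c f f1 M : (forall x, is_derive x 1 f (f1 x)) -> continuous f1 ->
  (forall x, f x != 0 -> `|x| <= M) ->
  (c -> exists2 d, 0 < d & forall x, f x != 0 -> d <= x) ->
  (eigv c + 2) * int1 c (fun x => f x ^+ 2) <=
  int1 c (fun x => f1 x ^+ 2 + x ^+ 2 * f x ^+ 2) +
  2 * int1 c (fun x => f x * eig c x) ^+ 2 / int1 c (fun x => eig c x ^+ 2).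
Proof.
move=> df cf1 fM fc.
have cf := derivable_continuous df.
have ce : continuous (eig c) := derivable_continuous (@der_eig R c).
have ce' : continuous (eig' c) := derivable_continuous (@der_eig' R c).
pose g x := f x / eig c x.
pose g1 x := (f1 x * eig c x - f x * eig' c x) / eig c x ^+ 2.
(* The quotient g = f / e is 0 by convention where e vanishes, and f is zero around such a point;
   hence g is as regular there as elsewhere. *)
have f0 x : eig c x = 0 -> \forall y \near x, f y = 0.
  rewrite /eig; case: (c) fc => [/(_ isT)[d d0 fd]|_].
    move=> /eqP; rewrite mulf_eq0 (gt_eqF (expR_gt0 _)) orbF => /eqP ->.
    near=> y; apply/eqP/negPn/negP => /fd; rewrite leNgt => /negP[].
    by near: y; exact: lt_nbhsl.
  by rewrite mul1r => /eqP; rewrite gt_eqF// expR_gt0.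
have e0 x : half c x -> eig c x != 0.
  rewrite /half /eig; case: (c) => [/(_ isT) x0|_].
    by rewrite gt_eqF// mulr_gt0// expR_gt0.
  by rewrite mul1r gt_eqF// expR_gt0.
have gM x : g x != 0 -> `|x| <= M.
  by move=> gx; apply: fM; apply: contra_neq gx => fx0; rewrite /g fx0 mul0r.
have dg x : is_derive x 1 g (g1 x).
  have [ex|ex] := eqVneq (eig c x) 0.
    have nf := f0 x ex; rewrite /g1 ex expr0n invr0 mulr0.
    apply: (@near_eq_is_derive _ _ _ (cst 0)).
    by apply: filterS nf => y fy; rewrite /g fy mul0r.
  apply: (der_eq (derM (df x) (is_deriveV ex (der_eig c x)))).
  by rewrite /GRing.scale/= /g1; field.
have gc : c -> exists2 d, 0 < d & forall x, g x != 0 -> d <= x.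
  move=> /fc[d d0 fd]; exists d => // x gx; apply: fd.
  by apply: contra_neq gx => fx0; rewrite /g fx0 mul0r.
have cg1 : continuous g1.
  move=> x; have [ex|ex] := eqVneq (eig c x) 0.
    apply: continuous_near0; move: ex gc; rewrite /eig.
    case: (c) => [|]; last by rewrite mul1r => /eqP; rewrite gt_eqF// expR_gt0.
    move=> /eqP; rewrite mulf_eq0 (gt_eqF (expR_gt0 _)) orbF => /eqP -> /(_ isT)[d d0 gd].
    near=> y; apply/eqP/negPn/negP => /(derivative_ge_support dg gd).
    by rewrite leNgt => /negP[]; near: y; exact: lt_nbhsl.
  apply: (@continuousM _ _ (fun x => f1 x * eig c x - f x * eig' c x)
    (fun x => (eig c x ^+ 2)^-1)).
    by apply: continuousBf; exact: continuousMf.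
  apply: continuousV; first by rewrite expf_neq0.
  exact: continuousX2f.
have cg := derivable_continuous dg.
have P := poincare dg cg1 gM gc.
have E1 : int1 c (fun x => g x ^+ 2 * eig c x ^+ 2) = int1 c (fun x => f x ^+ 2).
  by apply: eq_int1 => x /e0 ex; rewrite /g; field.
have E2 : int1 c (fun x => g x * eig c x ^+ 2) = int1 c (fun x => f x * eig c x).
  by apply: eq_int1 => x /e0 ex; rewrite /g; field.
rewrite E1 E2 in P.
have df2 : dom1 c (fun x => f x ^+ 2) by apply: dom1X2; exact: dom1_compact fM.
(* [H'] is the derivative of g^2 e e', rewritten with the eigenvalue equation. It is what remains of
   f'^2 + x^2 f^2 after g'^2 e^2 and [eigv c * f^2] are taken away, and its integral is zero. *)
pose H' x := 2 * g x * g1 x * (eig c x * eig' c x) +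
  g x ^+ 2 * (eig' c x ^+ 2 + (x ^+ 2 - eigv c) * eig c x ^+ 2).
have cH' : continuous H'.
  apply: continuousDf.
    apply: continuousMf; last exact: continuousMf.
    by apply: continuousMf => //; exact: continuousZf.
  apply: continuousMf; first exact: continuousX2f.
  apply: continuousDf; first exact: continuousX2f.
  apply: continuousMf; last exact: continuousX2f.
  by apply: continuousBf; [exact: exprn_continuous|exact: cst_continuous].
have dH' : dom1 c H'.
  apply: (@dom1_compact _ _ _ M) => // x H'x; apply: gM.
  by apply: contra_neq H'x => gx; rewrite /H' gx; ring.
have dg1e : dom1 c (fun x => g1 x ^+ 2 * eig c x ^+ 2).
  apply: dom1M; last exact/dom1X2/dom1_eig.
  apply: dom1X2; apply: (@dom1_compact _ _ _ M) => //.
  exact: derivative_norm_support dg gM.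
have IH : int1 c H' = 0.
  apply: (@int1_derive _ c (fun x => g x ^+ 2 * (eig c x * eig' c x))) => //.
  - move=> x; under [X in is_derive _ _ X]eq_fun do rewrite expr2.
    apply: (der_eq (derM (derM (dg x) (dg x)) (derM (der_eig c x) (der_eig' c x)))).
    by rewrite /H'; ring.
  - have : dom1 c (fun x => g x ^+ 2 * (eig c x * eig' c x)); last by case.
    apply: dom1M; first by apply: dom1X2; apply: (@dom1_compact _ _ _ M).
    by apply: dom1M; [exact: dom1_eig|exact: dom1_eig'].
  - move=> hc; have [d d0 gd] := gc hc.
    have [->|/gd] := eqVneq (g 0) 0; first by rewrite expr0n mul0r.
    by rewrite leNgt d0.
have -> : int1 c (fun x => f1 x ^+ 2 + x ^+ 2 * f x ^+ 2) =
    int1 c (fun x => g1 x ^+ 2 * eig c x ^+ 2 + (eigv c * f x ^+ 2 + H' x)).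
  apply: eq_int1 => x /e0 ex.
  by rewrite /H' /g /g1; field.
have dlf : dom1 c (fun x => eigv c * f x ^+ 2) by exact: dom1Z.
rewrite (int1D dg1e (dom1D dlf dH')) (int1D dlf dH') int1Z// IH.
lra.
Unshelve. all: by end_near. Qed.

End Poincare.

(** * Functions of several variables *)

Section DominatedRows.
Context {R : realType}.
Local Notation leb := (@lebesgue_measure R).
Implicit Types (b : nat -> bool) (n : nat).

Section Wrappers.
Variables (b : nat -> bool) (n : nat).
Implicit Types (F G : 'rV[R]_n -> R) (k : R).

Lemma domnD F G : domn b F -> domn b G -> domn b (fun x => F x + G x).
Proof. exact: dominatedD. Qed.

Lemma domnM F G : domn b F -> domn b G -> domn b (fun x => F x * G x).
Proof. exact: (dominatedM (good_boxT b n)). Qed.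

Lemma domnZ k F : domn b F -> domn b (fun x => k * F x).
Proof. exact: dominatedZ. Qed.

Lemma domnX2 F : domn b F -> domn b (fun x => F x ^+ 2).
Proof. exact: (dominatedX2 (good_boxT b n)). Qed.

Lemma domn_sum (I : Type) (r : seq I) (F : I -> 'rV[R]_n -> R) :
  (forall i, domn b (F i)) -> domn b (fun x => \sum_(i <- r) F i x).
Proof. move=> H; exact: (dominated_sum r predT H). Qed.

Lemma intnD F G : domn b F -> domn b G ->
  intn b (fun x => F x + G x) = intn b F + intn b G.
Proof. exact: dominated_intD (good_boxT b n) _ _. Qed.

Lemma intnZ k F : domn b F -> intn b (fun x => k * F x) = k * intn b F.
Proof. exact: dominated_intZ (good_boxT b n) k _. Qed.

Lemma intn_ge0 F : (forall x, 0 <= F x) -> 0 <= intn b F.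
Proof. by move=> F0; apply: Rintegral_ge0 => t _. Qed.

Lemma intn_le F G : domn b F -> domn b G ->
  (forall x : 'rV[R]_n, (forall i : 'I_n, half (b i) (x 0 i)) -> F x <= G x) ->
  intn b F <= intn b G.
Proof.
move=> dF dG FG; apply: (dominated_int_le (good_boxT b n) dF dG) => t ht.
by apply: FG => i; rewrite mxE.
Qed.

Lemma eq_intn F G :
  (forall x : 'rV[R]_n, (forall i : 'I_n, half (b i) (x 0 i)) -> F x = G x) ->
  intn b F = intn b G.
Proof.
move=> FG; apply: eq_Rintegral => t /set_mem ht.
by apply: FG => i; rewrite mxE.
Qed.

Lemma domn_continuous F M : continuous F ->
  (forall x, `|F x| <= M * gaussn x) -> domn b F.
Proof.
move=> cF FM; split; last by exists M => t _; exact: FM.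
apply: (@measurable_funS _ _ _ _ setT) => //.
exact: (continuous_measurable_rowT cF).
Qed.

Lemma sqnorm_gaussn_le (x : 'rV[R]_n) : sqnorm x * gaussn x <= 4.
Proof.
rewrite /gaussn expRN ler_pdivrMr ?expR_gt0//.
have := expR_ge1Dx (sqnorm x / 4); lra.
Qed.

(** One of the two Gaussian factors absorbs the growth of [m]. A general [m] serves for |x|^2 as
    well as for the parts into which the inductions split it. *)
Lemma domn_sqr_mul (m : 'rV[R]_n -> R) F G : continuous m ->
  (forall x, 0 <= m x <= sqnorm x) -> domn b F -> domn b G ->
  domn b (fun x => m x * (F x * G x)).
Proof.
move=> cm m0 dF dG; split.
  apply: measurable_funM; last by case: (domnM dF dG).
  apply: (@measurable_funS _ _ _ _ setT) => //.
  exact: (continuous_measurable_rowT cm).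
have [M M0 FM] := dominated_bound (good_boxT b n) dF.
have [N N0 GN] := dominated_bound (good_boxT b n) dG.
exists (4 * (M * N)) => t ht; set x := rowT t.
have /andP[m0' m1] := m0 x.
rewrite /= -/x normrM normrM ger0_norm//.
apply: (@le_trans _ _ (sqnorm x * ((M * gaussn x) * (N * gaussn x)))).
  rewrite ler_pM ?mulr_ge0// ler_pM//; [exact: FM|exact: GN].
have -> : sqnorm x * (M * gaussn x * (N * gaussn x)) =
  (sqnorm x * gaussn x) * (M * N * gaussn x) by ring.
by rewrite -[leRHS]mulrA ler_wpM2r ?sqnorm_gaussn_le// !mulr_ge0 ?expR_ge0.
Qed.

End Wrappers.

Definition tailR n (x : 'rV[R]_n.+1) : 'rV[R]_n := \row_j x 0 (lift ord0 j).

Lemma tailR_consR n y (x : 'rV[R]_n) : tailR (consR y x) = x.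
Proof. by apply/rowP => j; rewrite mxE consRS. Qed.

Lemma consR_tailR n (x : 'rV[R]_n.+1) : consR (x 0 ord0) (tailR x) = x.
Proof.
apply/rowP => i; case: (unliftP ord0 i) => [j ->|->]; last by rewrite consR0.
by rewrite consRS mxE.
Qed.

Lemma rowT_behead n (t : n.+1.-tuple R) : tailR (rowT t) = rowT [tuple of behead t].
Proof.
apply/rowP => j; rewrite !mxE tnth_behead; congr tnth.
by apply/val_inj; rewrite /= inordK// ltnS.
Qed.

Lemma boxT_behead b n (t : n.+1.-tuple R) : boxT b t ->
  half (b 0%N) (rowT t 0 ord0) /\ boxT (b \o S) [tuple of behead t].
Proof.
move=> H; split; first by rewrite mxE; exact: (H ord0).
move=> i; have := H (lift ord0 i); congr half; rewrite tnth_behead; congr tnth.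
by apply/val_inj; rewrite /= inordK// ltnS.
Qed.

Lemma measurable_head b n (a : R -> R) :
  measurable_fun (half (b 0%N) : set (measurableTypeR R)) a ->
  measurable_fun (boxT b (n := n.+1)) (fun t => a (rowT t 0 ord0)).
Proof.
move=> ma; apply: (@measurable_comp _ _ _ _ _ _ (half (b 0%N)) a
    (boxT b (n := n.+1)) (fun t => rowT t 0 ord0)) => //.
- exact: measurable_half.
- by move=> _ [t /boxT_behead[ht _] <-].
- apply: (@measurable_funS _ _ _ _ setT) => //.
  under eq_fun do rewrite mxE.
  exact: (@measurable_tnth _ (measurableTypeR R) n.+1 ord0).
Qed.

Lemma measurable_tail b n (A : 'rV[R]_n -> R) :
  measurable_fun (boxT (b \o S) (n := n)) (fun t => A (rowT t)) ->
  measurable_fun (boxT b (n := n.+1)) (fun t => A (tailR (rowT t))).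
Proof.
move=> mA; pose tl (t : n.+1.-tuple R) := [tuple of behead t].
apply: (@eq_measurable_fun _ _ _ _ _ (fun t => A (rowT (tl t)))).
  by move=> t _; rewrite /= rowT_behead.
apply: (@measurable_comp _ _ _ _ _ _ (boxT (b \o S) (n := n)) (fun t => A (rowT t))
    (boxT b (n := n.+1)) tl) => //.
- exact: measurable_boxT.
- by move=> _ [t /boxT_behead[_ ht] <-].
- apply: (@measurable_funS _ _ _ _ setT) => //.
  apply/measurable_fun_tnthP => i /=.
  rewrite (_ : _ \o _ = (fun t : n.+1.-tuple R => tnth t (inord i.+1))).
    exact: (@measurable_tnth _ (measurableTypeR R) n.+1 _).
  by apply/funext => t; rewrite /= tnth_behead.
Qed.

Lemma domn_tensor b n (a : R -> R) (A : 'rV[R]_n -> R) :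
  dom1 (b 0%N) a -> domn (b \o S) A ->
  domn b (fun x : 'rV[R]_n.+1 => a (x 0 ord0) * A (tailR x)).
Proof.
move=> da dA; split.
  by apply: measurable_funM; [apply: measurable_head; case: da|
    apply: measurable_tail; case: dA].
have [M M0 aM] := dominated_bound (good_half _) da.
have [N N0 AN] := dominated_bound (good_boxT _ n) dA.
exists (M * N) => t /boxT_behead[h0 hS] /=.
rewrite -[in gaussn _](consR_tailR (rowT t)) gaussn_consR mulrACA normrM.
by rewrite ler_pM// ?aM// rowT_behead; exact: AN.
Qed.

Lemma domn_mul_head b n (F : 'rV[R]_n.+1 -> R) (a : R -> R) :
  domn b F -> dom1 (b 0%N) a -> domn b (fun x => F x * a (x 0 ord0)).
Proof.
move=> dF da; split.
  by apply: measurable_funM; [case: dF|apply: measurable_head; case: da].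
have [M M0 FM] := dominated_bound (good_boxT _ _) dF.
have [N N0 aN] := dominated_bound (good_half _) da.
exists (M * N) => t ht; have [h0 _] := boxT_behead ht.
rewrite /= normrM mulrAC ler_pM//; first exact: FM.
apply: (le_trans (aN _ h0)); rewrite -[leRHS]mulr1 ler_wpM2l//.
by have /andP[] := gauss4_01 (rowT t 0 ord0).
Qed.

Lemma domn_mul_tail b n (F : 'rV[R]_n.+1 -> R) (A : 'rV[R]_n -> R) :
  domn b F -> domn (b \o S) A -> domn b (fun x => F x * A (tailR x)).
Proof.
move=> dF dA; split.
  by apply: measurable_funM; [case: dF|apply: measurable_tail; case: dA].
have [M M0 FM] := dominated_bound (good_boxT _ _) dF.
have [N N0 AN] := dominated_bound (good_boxT _ n) dA.
exists (M * N) => t ht; have [_ hS] := boxT_behead ht.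
rewrite /= normrM mulrAC ler_pM//; first exact: FM.
rewrite rowT_behead; apply: (le_trans (AN _ hS)); rewrite -[leRHS]mulr1 ler_wpM2l//.
by have /andP[] := gaussn_01 (rowT [tuple of behead t]).
Qed.

Lemma intn0 b (F : 'rV[R]_0 -> R) : intn b F = F 0.
Proof.
have mF : measurable_fun (setT : set (0.-tuple R)) (fun t => (F (rowT t))%:E).
  apply/measurable_EFinP.
  have -> : (fun t : 0.-tuple R => F (rowT t)) = cst (F 0).
    by apply/funext => t /=; congr F; apply/rowP => -[].
  exact: measurable_cst.
rewrite /intn /Rintegral.
have -> : boxT b (n := 0) = setT :> set (0.-tuple R).
  by apply/seteqP; split => // t _ [].
have := @integral_dirac _ _ ([tuple] : 0.-tuple R) R setT measurableT _ mF.
move=> /= ->; rewrite diracE in_setT mul1e /=.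
by congr F; apply/rowP => -[].
Qed.

End DominatedRows.

(** * Partial derivatives, slices and products of one-variable functions *)

Section Gradients.
Context {R : realType}.
Implicit Types (b c : nat -> bool) (n : nat).

(** Restriction to a line reduces directional derivatives to derivatives in one variable, and lets
    them pass to slices. *)
Lemma der_line (V : normedModType R) (F : V -> R) x v d :
  is_derive x v F d <-> is_derive (0 : R) 1 (fun h => F (h *: v + x)) d.
Proof.
have E : (fun h : R => h^-1 *: ((F \o shift x) (h *: v) - F x)) =
  (fun h : R => h^-1 *: (((fun h => F (h *: v + x)) \o shift 0) (h *: 1) -
     F (0 *: v + x))).
  by apply/funext => h /=; rewrite addr0 scale0r add0r [_%:A]mulr1.
by split=> -[dF <-]; apply: DeriveDef; rewrite /derivable /derive ?E// -?E.
Qed.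

(** The partial derivatives are carried explicitly as [D], so that fixing one group of coordinates
    merely restricts the family ([C1_head], [C1_tail]). *)
Definition C1 n (F : 'rV[R]_n -> R) (D : 'I_n -> 'rV[R]_n -> R) :=
  [/\ forall x i, is_derive x (delta_mx 0 i) F (D i x), continuous F
    & forall i, continuous (D i)].

Lemma consR_delta0 n (h y : R) (x : 'rV[R]_n) :
  h *: delta_mx 0 ord0 + consR y x = consR (h + y) x.
Proof.
apply/rowP => i; rewrite !mxE eqxx /=; case: (unliftP ord0 i) => [j ->|->].
  by rewrite mulr0 add0r.
by rewrite mulr1.
Qed.

Lemma consR_deltaS n (h y : R) (x : 'rV[R]_n) i :
  h *: delta_mx 0 (lift ord0 i) + consR y x = consR y (h *: delta_mx 0 i + x).
Proof.
apply/rowP => k; rewrite [RHS]mxE !mxE eqxx /=.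
case: (unliftP ord0 k) => [j ->|->].
  by rewrite !mxE /= (inj_eq lift_inj).
by rewrite mulr0 add0r.
Qed.

Lemma C1_tail n (F : 'rV[R]_n.+1 -> R) D y : C1 F D ->
  C1 (fun x => F (consR y x)) (fun i x => D (lift ord0 i) (consR y x)).
Proof.
move=> [dF cF cD]; split.
- move=> x i; apply/der_line; have /der_line := dF (consR y x) (lift ord0 i).
  by under eq_fun do rewrite consR_deltaS.
- by move=> x; apply: continuous_comp; [exact: consR_continuousr|exact: cF].
- by move=> i x; apply: continuous_comp; [exact: consR_continuousr|exact: cD].
Qed.

Lemma C1_head n (F : 'rV[R]_n.+1 -> R) D x : C1 F D ->
  (forall y : R, is_derive y 1 (fun y : R => F (consR y x)) (D ord0 (consR y x))) /\
  continuous (fun y : R => D ord0 (consR y x)).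
Proof.
move=> [dF cF cD]; split.
  move=> y; apply/der_line; have /der_line := dF (consR y x) ord0.
  by under eq_fun do rewrite consR_delta0; under [X in _ -> is_derive _ _ X _]eq_fun
    do rewrite [_ *: 1]mulr1.
by move=> y; apply: continuous_comp; [exact: consR_continuousl|exact: cD].
Qed.

Definition prodR n (f : 'I_n -> R -> R) (x : 'rV[R]_n) := \prod_i f i (x 0 i).

Lemma continuous_prodR n (f : 'I_n -> R -> R) : (forall i, continuous (f i)) ->
  continuous (prodR f).
Proof.
move=> cf; apply: continuous_big; first exact: mul_continuous.
move=> i _ x; apply: (@continuous_comp _ _ _ (fun x : 'rV[R]_n => x 0 i) (f i)).
  exact: (@coord_continuous R 1 n 0 i).
exact: cf.
Qed.

Lemma der_prodR n (f f' : 'I_n -> R -> R) (i : 'I_n) (x : 'rV[R]_n) :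
  (forall i (y : R), is_derive y 1 (f i) (f' i y)) ->
  is_derive x (delta_mx 0 i) (prodR f)
    (prodR (fun j => if j == i then f' j else f j) x).
Proof.
move=> df; apply/der_line.
rewrite /prodR (bigD1 i)//= eqxx.
have -> : (fun h : R => \prod_j f j ((h *: delta_mx 0 i + x) 0 j)) =
   (fun h : R => (\prod_(j | j != i) f j (x 0 j)) * f i (h *: 1 + x 0 i)).
  apply/funext => h; rewrite (bigD1 i)//= mulrC !mxE !eqxx /=; congr (_ * _).
  apply: eq_bigr => j ji; rewrite !mxE eqxx /= (negbTE ji).
  by rewrite mulr0 add0r.
have /der_line H := df i (x 0 i).
apply: (der_eq (derZ _ H)); rewrite mulrC; congr (_ * _).
by apply: eq_bigr => j /negbTE ->.
Qed.

End Gradients.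

(** * The spectral gap in several variables *)

Section Eigenfunctions.
Context {R : realType}.
Implicit Types (b c : nat -> bool) (n : nat).

(** Unlike domination, this bound holds on the whole space; it passes to all slices and, with
    continuity, gives [domn b] for every [b]. *)
Definition gbd n (F : 'rV[R]_n -> R) := exists M, forall x, `|F x| <= M * gaussn x.

(** The choice [c] of the odd factors is independent of the box [b] of integration: [c = b] gives
    the ground state, and further odd factors give excited states. *)
Definition eign c n : 'rV[R]_n -> R := prodR (fun i : 'I_n => eig (c i)).
Definition eignD c n (i : 'I_n) : 'rV[R]_n -> R :=
  prodR (fun j => if j == i then eig' (c j) else eig (c j)).

Lemma eign_consR c n y (x : 'rV[R]_n) :
  eign c (consR y x) = eig (c 0%N) y * eign (c \o S) x.
Proof.
rewrite /eign /prodR big_ord_recl consR0; congr (_ * _).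
by apply: eq_bigr => i _; rewrite consRS.
Qed.

Lemma eignD_consR0 c n y (x : 'rV[R]_n) :
  eignD c ord0 (consR y x) = eig' (c 0%N) y * eign (c \o S) x.
Proof.
rewrite /eignD /prodR big_ord_recl eqxx consR0; congr (_ * _).
by apply: eq_bigr => i _; rewrite consRS.
Qed.

Lemma eignD_consRS c n i y (x : 'rV[R]_n) :
  eignD c (lift ord0 i) (consR y x) = eig (c 0%N) y * eignD (c \o S) i x.
Proof.
rewrite /eignD /prodR big_ord_recl consR0; congr (_ * _).
by apply: eq_bigr => j _; rewrite consRS (inj_eq lift_inj).
Qed.

Lemma continuous_eig e : continuous (@eig R e).
Proof. exact: derivable_continuous (@der_eig R e). Qed.

Lemma continuous_eig' e : continuous (@eig' R e).
Proof. exact: derivable_continuous (@der_eig' R e). Qed.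

Lemma C1_eign c n : C1 (@eign c n) (@eignD c n).
Proof.
split.
- move=> x i; exact: (@der_prodR R n (fun i => eig (c i)) (fun i => eig' (c i)) i x
    (fun i y => der_eig (c i) y)).
- by apply: continuous_prodR => i; exact: continuous_eig.
- move=> i; apply: continuous_prodR => j.
  by case: ifP => _; [exact: continuous_eig'|exact: continuous_eig].
Qed.

Lemma prodR_bound n (f : 'I_n -> R -> R) K : 0 <= K ->
  (forall i y, `|f i y| <= K * gauss4 y) ->
  forall x, `|prodR f x| <= K ^+ n * gaussn x.
Proof.
move=> K0 fK x; have -> : gaussn x = \prod_i gauss4 (x 0 i).
  by rewrite /gaussn /sqnorm -expR_sum mulr_suml -sumrN.
rewrite /prodR normr_prod -[n in K ^+ n]card_ord -prodr_const -big_split/=.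
by apply: ler_prod => i _; rewrite normr_ge0 fK.
Qed.

Lemma eig_bound : exists2 K : R, 0 <= K &
  forall e y, `|eig e y| <= K * gauss4 y /\ `|eig' e y| <= K * gauss4 y.
Proof.
have B e := dominated_bound (good_half false) (@dom1_eig R false e).
have B' e := dominated_bound (good_half false) (@dom1_eig' R false e).
have [a a0 Ha] := B false; have [a1 a10 Ha1] := B true.
have [a' a'0 Ha'] := B' false; have [a1' a1'0 Ha1'] := B' true.
exists (a + a1 + a' + a1'); first by rewrite !addr_ge0.
have g0 y : 0 <= gauss4 y :> R by exact: expR_ge0.
move=> [] y; split.
- apply: (le_trans (Ha1 y _)) => //; rewrite ler_wpM2r//; lra.
- apply: (le_trans (Ha1' y _)) => //; rewrite ler_wpM2r//; lra.
- apply: (le_trans (Ha y _)) => //; rewrite ler_wpM2r//; lra.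
- apply: (le_trans (Ha' y _)) => //; rewrite ler_wpM2r//; lra.
Qed.

Lemma gbd_eign c n : gbd (@eign c n).
Proof.
have [K K0 HK] := eig_bound; exists (K ^+ n).
by apply: prodR_bound => // i y; case: (HK (c i) y).
Qed.

Lemma gbd_eignD c n i : gbd (@eignD c n i).
Proof.
have [K K0 HK] := eig_bound; exists (K ^+ n).
by apply: prodR_bound => // j y; case: ifP => _; case: (HK (c j) y).
Qed.

Lemma gbd_consR n (F : 'rV[R]_n.+1 -> R) y : gbd F -> gbd (fun x => F (consR y x)).
Proof.
move=> [M FM]; exists (M * gauss4 y) => x.
by rewrite -mulrA -gaussn_consR.
Qed.

Lemma domn_gbd b n (F : 'rV[R]_n -> R) : continuous F -> gbd F -> domn b F.
Proof. by move=> cF [M FM]; exact: domn_continuous FM. Qed.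

Lemma domn_eign b c n : domn b (@eign c n).
Proof. by have [_ ? _] := C1_eign c n; apply: domn_gbd => //; exact: gbd_eign. Qed.

Lemma domn_eignD b c n i : domn b (@eignD c n i).
Proof. by have [_ _ ?] := C1_eign c n; apply: domn_gbd => //; exact: gbd_eignD. Qed.

Lemma sqr_coord_le n (x : 'rV[R]_n) i : 0 <= x 0 i ^+ 2 <= sqnorm x.
Proof.
rewrite sqr_ge0/= /sqnorm (bigD1 i)//= lerDl.
by apply: sumr_ge0 => j _; rewrite sqr_ge0.
Qed.

Lemma domn_coord_sqr_mul b n i (F G : 'rV[R]_n -> R) : domn b F -> domn b G ->
  domn b (fun x => x 0 i ^+ 2 * (F x * G x)).
Proof.
apply: domn_sqr_mul => [|x]; last exact: sqr_coord_le.
by apply: continuousX2f; exact: (@coord_continuous R 1 n 0 i).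
Qed.

Lemma domn_sqnorm_mul b n (F G : 'rV[R]_n -> R) : domn b F -> domn b G ->
  domn b (fun x => sqnorm x * (F x * G x)).
Proof.
apply: domn_sqr_mul => [|x]; first exact: continuous_sqnorm.
by rewrite sqnorm_ge0 lexx.
Qed.

Definition eigvn c n : R := \sum_(i < n) eigv (c i).

Lemma eigvnS c n : eigvn c n.+1 = eigv (c 0%N) + eigvn (c \o S) n.
Proof. by rewrite /eigvn big_ord_recl. Qed.

Lemma dom1_gbd e (f : R -> R) : continuous f ->
  (exists M, forall y, `|f y| <= M * gauss4 y) -> dom1 e f.
Proof.
move=> cf [M fM]; split; last by exists M => x _; exact: fM.
by apply: (@measurable_funS _ _ _ _ setT) => //; exact: continuous_measurable_fun.
Qed.

Lemma gbd_slice n (F : 'rV[R]_n.+1 -> R) x : gbd F ->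
  exists M, forall y, `|F (consR y x)| <= M * gauss4 y.
Proof.
move=> [M FM]; exists (M * gaussn x) => y.
by rewrite -mulrA [gaussn _ * _]mulrC -gaussn_consR.
Qed.

(** Weak form of the eigenvalue equation, from the derivative of f times [eig' e']. The domain [e]
    and the eigenfunction [e'] are unrelated, since f alone kills the boundary term at 0. *)
Lemma int1_eig (e e' : bool) (f f1 : R -> R) :
  (forall y : R, is_derive y 1 f (f1 y)) -> continuous f1 ->
  (exists M, forall y, `|f y| <= M * gauss4 y) ->
  (exists M, forall y, `|f1 y| <= M * gauss4 y) -> (e -> f 0 = 0) ->
  int1 e (fun y => f1 y * eig' e' y + y ^+ 2 * (f y * eig e' y)) =
  eigv e' * int1 e (fun y => f y * eig e' y).
Proof.
move=> df cf1 fM f1M f0.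
have cf := derivable_continuous df.
have dmf := dom1_gbd e cf fM; have dmf1 := dom1_gbd e cf1 f1M.
have d1 : dom1 e (fun y => f1 y * eig' e' y) by apply: dom1M => //; exact: dom1_eig'.
have d2 : dom1 e (fun y => y ^+ 2 * (f y * eig e' y)).
  by apply: dom1_sqr_mul => //; exact: dom1_eig.
have d3 : dom1 e (fun y => f y * eig e' y) by apply: dom1M => //; exact: dom1_eig.
have d4 : dom1 e (fun y => - eigv e' * (f y * eig e' y)) by exact: dom1Z.
have d5 : dom1 e (fun y => f y * eig' e' y) by apply: dom1M => //; exact: dom1_eig'.
have : int1 e (fun y => f1 y * eig' e' y + y ^+ 2 * (f y * eig e' y) +
    - eigv e' * (f y * eig e' y)) = 0.
  apply: (@int1_derive _ e (fun y => f y * eig' e' y)) => //.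
  - by move=> y; apply: (der_eq (derM (df y) (der_eig' e' y))); ring.
  - have cfe : continuous (fun y => f y * eig e' y).
      by apply: continuousMf => //; exact: continuous_eig.
    apply: continuousDf; last exact: continuousZf.
    apply: continuousDf; first by apply: continuousMf => //; exact: continuous_eig'.
    by apply: continuousMf => //; exact: exprn_continuous.
  - by apply: dom1D => //; exact: dom1D.
  - by case: d5.
  - by move=> /f0 ->; rewrite mul0r.
rewrite (int1D (dom1D d1 d2) d4) int1Z//; lra.
Qed.

Lemma continuous_tailR n : continuous (@tailR R n).
Proof.
apply: row_continuous => i x.
under eq_fun do rewrite mxE.
exact: (@coord_continuous R 1 n.+1 0 (lift ord0 i)).
Qed.

Lemma sqnormS n (x : 'rV[R]_n.+1) :
  sqnorm x = x 0 ord0 ^+ 2 + sqnorm (tailR x).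
Proof. by rewrite -{1}(consR_tailR x) sqnorm_consR. Qed.

(** Weak form of the eigenvalue equation in n variables. [F] vanishes on the faces of the box, so no
    boundary term appears, and [c] need not be related to [b]. *)
Lemma energy_eign b c n (F : 'rV[R]_n -> R) D : C1 F D -> gbd F ->
  (forall i, gbd (D i)) ->
  (forall (x : 'rV[R]_n) (i : 'I_n), b i -> x 0 i = 0 -> F x = 0) ->
  intn b (fun x => \sum_i D i x * eignD c i x + sqnorm x * (F x * eign c x)) =
  eigvn c n * intn b (fun x => F x * eign c x).
Proof.
elim: n b c F D => [|n ih] b c F D CF gF gD F0.
  by rewrite !intn0 /eigvn !big_ord0 /sqnorm big_ord0 mul0r addr0.
have [dF cF cD] := CF.
have domF : domn b F by exact: domn_gbd.
have domD i : domn b (D i) by exact: domn_gbd.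
pose e : R -> R := eig (c 0%N); pose e' : R -> R := eig' (c 0%N).
(* [A] collects the first variable and [B] the others. The inner integral is over y for [A], by the
   one-variable case, and over x for [B], by induction. *)
pose A x := D ord0 x * eignD c ord0 x + x 0 ord0 ^+ 2 * (F x * eign c x).
pose B x := \sum_i D (lift ord0 i) x * eignD c (lift ord0 i) x +
  (sqnorm (tailR x)) * (F x * eign c x).
have dFE : domn b (fun x => F x * eign c x) by apply: domnM => //; exact: domn_eign.
have dA : domn b A.
  apply: domnD; first by apply: domnM => //; exact: domn_eignD.
  by apply: domn_coord_sqr_mul => //; exact: domn_eign.
have dB : domn b B.
  apply: domnD.
    by apply: domn_sum => i; apply: domnM => //; exact: domn_eignD.
  apply: domn_sqr_mul => //; last exact: domn_eign.
    move=> x; apply: (@continuous_comp _ _ _ (@tailR R n)).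
      exact: continuous_tailR.
    exact: continuous_sqnorm.
  by move=> x; rewrite sqnorm_ge0 sqnormS lerDr sqr_ge0.
have -> : intn b (fun x => \sum_i D i x * eignD c i x + sqnorm x * (F x * eign c x)) =
    intn b (fun x => A x + B x).
  apply: eq_intn => x _; rewrite /A /B big_ord_recl.
  by rewrite sqnormS; ring.
rewrite (intnD dA dB) eigvnS mulrDl; congr (_ + _).
- rewrite intn_consC// [in RHS]intn_consC// -intnZ; last exact: (domn_int1 dFE).
  apply: eq_intn => x _; rewrite /A.
  have [df cf1] := C1_head x CF.
  have fM := gbd_slice x gF; have f1M := gbd_slice x (gD ord0).
  have cf := derivable_continuous df.
  have f0 : b 0%N -> F (consR 0 x) = 0.
    by move=> b0; apply: (F0 _ ord0) => //; rewrite consR0.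
  have H := int1_eig (c 0%N) df cf1 fM f1M f0.
  have dmf := dom1_gbd (b 0%N) cf fM; have dmf1 := dom1_gbd (b 0%N) cf1 f1M.
  transitivity (eign (c \o S) x * int1 (b 0%N) (fun y => D ord0 (consR y x) * e' y +
     y ^+ 2 * (F (consR y x) * e y))).
    rewrite -int1Z.
      by apply: eq_int1 => y _; rewrite eignD_consR0 eign_consR consR0 /e /e'; ring.
    apply: dom1D; first by apply: dom1M => //; exact: dom1_eig'.
    by apply: dom1_sqr_mul => //; exact: dom1_eig.
  rewrite H mulrCA; congr (_ * _).
  rewrite -int1Z; last by apply: dom1M => //; exact: dom1_eig.
  by apply: eq_int1 => y _; rewrite eign_consR; ring.
- rewrite intn_cons// [in RHS]intn_cons// -int1Z; last exact: (dom1_intn dFE).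
  apply: eq_int1 => y hy; rewrite /B.
  have CT := C1_tail y CF; have [_ cFt cDt] := CT.
  have gFt := gbd_consR y gF.
  have gDt i := gbd_consR y (gD (lift ord0 i)).
  have F0t (x : 'rV[R]_n) (i : 'I_n) : (b \o S) i -> x 0 i = 0 -> F (consR y x) = 0.
    by move=> bi xi; apply: (F0 _ (lift ord0 i)) => //; rewrite consRS.
  have H := ih (b \o S) (c \o S) _ _ CT gFt gDt F0t.
  have dmF : domn (b \o S) (fun x => F (consR y x)) by exact: domn_gbd.
  have dmD i : domn (b \o S) (fun x => D (lift ord0 i) (consR y x)).
    by apply: domn_gbd; [exact: cDt|exact: gDt].
  transitivity (e y * intn (b \o S) (fun x =>
     \sum_i D (lift ord0 i) (consR y x) * eignD (c \o S) i x +
      sqnorm x * (F (consR y x) * eign (c \o S) x))).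
    rewrite -intnZ.
      apply: eq_intn => x _; rewrite tailR_consR mulrDr mulr_sumr; congr (_ + _).
        by apply: eq_bigr => i _; rewrite eignD_consRS mulrCA.
      by rewrite eign_consR /e; ring.
    apply: domnD; last by apply: domn_sqnorm_mul => //; exact: domn_eign.
    by apply: domn_sum => i; apply: domnM => //; exact: domn_eignD.
  rewrite H mulrCA; congr (_ * _).
  rewrite -intnZ; last by apply: domnM => //; exact: domn_eign.
  by apply: eq_intn => x _; rewrite eign_consR /e; ring.
Qed.

Lemma intn_eign_sqr_cons b c n : intn b (fun x : 'rV[R]_n.+1 => eign c x ^+ 2) =
  int1 (b 0%N) (fun y => eig (c 0%N) y ^+ 2) *
  intn (b \o S) (fun x : 'rV[R]_n => eign (c \o S) x ^+ 2).
Proof.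
have dE : domn (b \o S) (fun x : 'rV[R]_n => eign (c \o S) x ^+ 2).
  by apply: domnX2; exact: domn_eign.
rewrite intn_cons; last by apply: domnX2; exact: domn_eign.
rewrite mulrC -int1Z; last by apply: dom1X2; exact: dom1_eig.
apply: eq_int1 => y _; rewrite mulrC -intnZ//.
by apply: eq_intn => x _; rewrite eign_consR exprMn.
Qed.

Lemma intn_eign_sqr_gt0 b c n : 0 < intn b (fun x : 'rV[R]_n => eign c x ^+ 2).
Proof.
elim: n b c => [|n ih] b c.
  by rewrite intn0 /eign /prodR big_ord0 expr1n.
by rewrite intn_eign_sqr_cons mulr_gt0// int1_eig_gt0.
Qed.

(* If P and P' are the orthogonal projections onto [e] in the first variable and
   onto [E] in the others, this is the positivity of (1 - P) (1 - P'), obtained by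
   integrating the square of (1 - P) (1 - P') F. *)
Lemma tensor_projection b n (F : 'rV[R]_n.+1 -> R) (e : R -> R) (E : 'rV[R]_n -> R) :
  domn b F -> dom1 (b 0%N) e -> domn (b \o S) E ->
  let G1 := int1 (b 0%N) (fun y => e y ^+ 2) in
  let G' := intn (b \o S) (fun x => E x ^+ 2) in
  let V x := int1 (b 0%N) (fun y => F (consR y x) * e y) in
  let U y := intn (b \o S) (fun x => F (consR y x) * E x) in
  let T := intn b (fun z => F z * (e (z 0 ord0) * E (tailR z))) in
  0 < G1 -> 0 < G' ->
  intn (b \o S) (fun x => V x ^+ 2) / G1 + int1 (b 0%N) (fun y => U y ^+ 2) / G' <=
  intn b (fun z => F z ^+ 2) + T ^+ 2 / (G1 * G').
Proof.
move=> dF de dE G1 G' V U T G10 G'0.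
have dV : domn (b \o S) V.
  have := domn_int1 (domn_mul_head dF de).
  apply: eq_dominated => t _; rewrite /= /V.
  by apply: eq_int1 => y _; rewrite consR0.
have dU : dom1 (b 0%N) U.
  have := dom1_intn (domn_mul_tail dF dE).
  apply: eq_dom1 => y _; apply: eq_intn => x _; by rewrite tailR_consR.
have dFeE := domnM dF (domn_tensor de dE).
have dFeV := domnM dF (domn_tensor de dV).
have dFF := domnX2 dF.
pose P y := intn (b \o S) (fun x => F (consR y x) * V x).
have IF : int1 (b 0%N) (fun y => intn (b \o S) (fun x => F (consR y x) ^+ 2)) =
    intn b (fun z => F z ^+ 2) by rewrite intn_cons.
have dIF : dom1 (b 0%N) (fun y => intn (b \o S) (fun x => F (consR y x) ^+ 2)).
  exact: dom1_intn dFF.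
have dPe : dom1 (b 0%N) (fun y => P y * e y).
  have := dom1_intn dFeV; apply: eq_dom1 => y hy.
  rewrite mulrC /P -intnZ; last by apply: domnM => //; exact: domn_slice.
  by apply: eq_intn => x _; rewrite consR0 tailR_consR mulrCA.
have IP : int1 (b 0%N) (fun y => P y * e y) = intn (b \o S) (fun x => V x ^+ 2).
  transitivity (intn b (fun z => F z * (e (z 0 ord0) * V (tailR z)))).
    rewrite intn_cons//; apply: eq_int1 => y hy.
    rewrite mulrC /P -intnZ; last by apply: domnM => //; exact: domn_slice.
    by apply: eq_intn => x _; rewrite consR0 tailR_consR mulrCA.
  rewrite intn_consC//; apply: eq_Rintegral => t /set_mem ht.
  transitivity (V (rowT t) * int1 (b 0%N) (fun y => F (consR y (rowT t)) * e y)) => //.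
  rewrite -int1Z.
    by apply: eq_int1 => y _; rewrite consR0 tailR_consR; ring.
  have := dom1_slice (domn_mul_head dF de) ht.
  by apply: eq_dom1 => y _; rewrite consR0.
have IT : int1 (b 0%N) (fun y => U y * e y) = T.
  rewrite /T intn_cons//; apply: eq_int1 => y hy.
  rewrite mulrC /U -intnZ; last by apply: domnM => //; exact: domn_slice.
  by apply: eq_intn => x _; rewrite consR0 tailR_consR mulrCA.
have IVE : intn (b \o S) (fun x => V x * E x) = T.
  rewrite /T intn_consC//; apply: eq_Rintegral => t /set_mem ht.
  transitivity (E (rowT t) * int1 (b 0%N) (fun y => F (consR y (rowT t)) * e y)); first exact: mulrC.
  rewrite -int1Z.
    by apply: eq_int1 => y _; rewrite consR0 tailR_consR; ring.
  have := dom1_slice (domn_mul_head dF de) ht.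
  by apply: eq_dom1 => y _; rewrite consR0.
set Bv := intn (b \o S) (fun x => V x ^+ 2) in IP *.
have step y : half (b 0%N) y ->
    0 <= intn (b \o S) (fun x => F (consR y x) ^+ 2) + (- (2 / G1) * (P y * e y) +
      ((Bv / G1 ^+ 2 - T ^+ 2 / (G1 ^+ 2 * G')) * e y ^+ 2 +
       (- G'^-1 * U y ^+ 2 + (2 * T / (G1 * G')) * (U y * e y)))).
  move=> hy; have dFy := domn_slice dF hy.
  (* With these coefficients [al * V x] is P F and [ka * E x] is P' (F - P F), both at the point (y,
     x). *)
  pose al := e y / G1; pose ka := (U y - al * T) / G'.
  have : 0 <= intn (b \o S) (fun x => F (consR y x) ^+ 2 + (al ^+ 2 * V x ^+ 2 +
     (ka ^+ 2 * E x ^+ 2 + (- (2 * al) * (F (consR y x) * V x) +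
     (- (2 * ka) * (F (consR y x) * E x) + (2 * al * ka) * (V x * E x)))))).
    apply: intn_ge0 => x.
    have := sqr_ge0 (F (consR y x) - al * V x - ka * E x); congr (0 <= _); ring.
  have d1 := domnX2 dFy.
  have d2 := domnZ (al ^+ 2) (domnX2 dV).
  have d3 := domnZ (ka ^+ 2) (domnX2 dE).
  have d4 := domnZ (- (2 * al)) (domnM dFy dV).
  have d5 := domnZ (- (2 * ka)) (domnM dFy dE).
  have d6 := domnZ (2 * al * ka) (domnM dV dE).
  have d56 := domnD d5 d6; have d46 := domnD d4 d56.
  have d36 := domnD d3 d46; have d26 := domnD d2 d36.
  rewrite (intnD d1 d26) (intnD d2 d36) (intnD d3 d46) (intnD d4 d56) (intnD d5 d6).
  rewrite (intnZ _ (domnX2 dV)) (intnZ _ (domnX2 dE)) (intnZ _ (domnM dFy dV)).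
  rewrite (intnZ _ (domnM dFy dE)) (intnZ _ (domnM dV dE)) IVE -/Bv -/G' -/(P y) -/(U y).
  congr (0 <= _); rewrite /ka /al; field.
  by rewrite !gt_eqF.
have : 0 <= int1 (b 0%N) (fun y => intn (b \o S) (fun x => F (consR y x) ^+ 2) +
   (- (2 / G1) * (P y * e y) + ((Bv / G1 ^+ 2 - T ^+ 2 / (G1 ^+ 2 * G')) * e y ^+ 2 +
       (- G'^-1 * U y ^+ 2 + (2 * T / (G1 * G')) * (U y * e y))))).
  exact: int1_ge0.
have d2 := dom1Z (- (2 / G1)) dPe.
have d3 := dom1Z (Bv / G1 ^+ 2 - T ^+ 2 / (G1 ^+ 2 * G')) (dom1X2 de).
have d4 := dom1Z (- G'^-1) (dom1X2 dU).
have d5 := dom1Z (2 * T / (G1 * G')) (dom1M dU de).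
have d45 := dom1D d4 d5; have d35 := dom1D d3 d45; have d25 := dom1D d2 d35.
rewrite (int1D dIF d25) (int1D d2 d35) (int1D d3 d45) (int1D d4 d5).
rewrite (int1Z _ dPe) (int1Z _ (dom1X2 de)) (int1Z _ (dom1X2 dU)) (int1Z _ (dom1M dU de)).
rewrite IF IP IT -/G1 => H; rewrite -subr_ge0; move: H; congr (0 <= _); field.
by rewrite !gt_eqF.
Qed.

(** With P and P' the projections of [tensor_projection], the one-variable gap on slices gives (eigv
    + 2) |F|^2 <= A + 2 |P F|^2, and induction gives the analogue with B and P'. The sum has 2 |F|^2
    to spare on the left, and |P F|^2 + |P' F|^2 <= |F|^2 + |P P' F|^2 uses up exactly this
    surplus. *)
Lemma spectral_gap b n (F : 'rV[R]_n -> R) D (M : R) : C1 F D -> gbd F ->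
  (forall i, gbd (D i)) ->
  (forall (x : 'rV[R]_n) (i : 'I_n), F x != 0 -> `|x 0 i| <= M) ->
  (forall i : 'I_n, b i -> exists2 d, 0 < d &
     forall x : 'rV[R]_n, F x != 0 -> d <= x 0 i) ->
  (eigvn b n + 2) * intn b (fun x => F x ^+ 2) <=
  intn b (fun x => \sum_i D i x ^+ 2 + sqnorm x * F x ^+ 2) +
  2 * intn b (fun x => F x * eign b x) ^+ 2 / intn b (fun x : 'rV[R]_n => eign b x ^+ 2).
Proof.
elim: n b F D => [|n ih] b F D CF gF gD FM Fd.
  rewrite !intn0 /eigvn !big_ord0 /sqnorm big_ord0 mul0r addr0 !add0r.
  by rewrite /eign /prodR big_ord0 mulr1 expr1n divr1.
have [dF cF cD] := CF.
have domF : domn b F by exact: domn_gbd.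
have domD i : domn b (D i) by exact: domn_gbd.
pose e : R -> R := eig (b 0%N).
pose E : 'rV[R]_n -> R := @eign (b \o S) n.
have de : dom1 (b 0%N) e by exact: dom1_eig.
have dE : domn (b \o S) E by exact: domn_eign.
pose A x := D ord0 x ^+ 2 + x 0 ord0 ^+ 2 * (F x * F x).
pose B x := \sum_i D (lift ord0 i) x ^+ 2 + sqnorm (tailR x) * (F x * F x).
have dA : domn b A by apply: domnD; [exact: domnX2|exact: domn_coord_sqr_mul].
have dB : domn b B.
  apply: domnD; first by apply: domn_sum => i; exact: domnX2.
  apply: domn_sqr_mul => //.
    move=> x; apply: (@continuous_comp _ _ _ (@tailR R n)).
      exact: continuous_tailR.
    exact: continuous_sqnorm.
  by move=> x; rewrite sqnorm_ge0 sqnormS lerDr sqr_ge0.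
have -> : intn b (fun x => \sum_i D i x ^+ 2 + sqnorm x * F x ^+ 2) =
    intn b (fun x => A x + B x).
  apply: eq_intn => x _; rewrite /A /B big_ord_recl.
  by rewrite sqnormS; ring.
rewrite (intnD dA dB) eigvnS intn_eign_sqr_cons.
have TP := tensor_projection domF de dE (int1_eig_gt0 _ _) (intn_eign_sqr_gt0 _ _ _).
rewrite -/e -/E.
move: TP; cbv zeta.
set G1 := int1 (b 0%N) (fun y => e y ^+ 2).
set G' := intn (b \o S) (fun x => E x ^+ 2).
set V := fun x => int1 (b 0%N) (fun y => F (consR y x) * e y).
set U := fun y => intn (b \o S) (fun x => F (consR y x) * E x).
set T := intn b (fun z => F z * (e (z 0 ord0) * E (tailR z))).
set N := intn b (fun z => F z ^+ 2).
have -> : intn b (fun x => F x * eign b x) = T.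
  by apply: eq_intn => x _; rewrite -[in eign b x](consR_tailR x) eign_consR.
move=> TP.
have G10 : 0 < G1 by exact: int1_eig_gt0.
have G'0 : 0 < G' by exact: intn_eign_sqr_gt0.
have dFF := domnX2 domF.
have dV : domn (b \o S) V.
  have := domn_int1 (domn_mul_head domF de).
  apply: eq_dominated => t _; rewrite /= /V.
  by apply: eq_int1 => y _; rewrite consR0.
have dU : dom1 (b 0%N) U.
  have := dom1_intn (domn_mul_tail domF dE).
  by apply: eq_dom1 => y _; apply: eq_intn => x _; rewrite tailR_consR.
have HA : (eigv (b 0%N) + 2) * N <= intn b A + 2 / G1 * intn (b \o S) (fun x => V x ^+ 2).
  rewrite /N !intn_consC//.
  have dFFi := domn_int1 dFF; have dAi := domn_int1 dA.
  have dV2 := domnZ (2 / G1) (domnX2 dV).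
  rewrite -(intnZ _ dFFi) -(intnZ _ (domnX2 dV)) -(intnD dAi dV2).
  apply: intn_le; [exact: domnZ|exact: domnD|] => x _.
  have [df cf1] := C1_head x CF.
  have -> : int1 (b 0%N) (fun y => A (consR y x)) =
      int1 (b 0%N) (fun y => D ord0 (consR y x) ^+ 2 + y ^+ 2 * F (consR y x) ^+ 2).
    by apply: eq_int1 => y _; rewrite /A consR0 expr2.
  have -> : 2 / G1 * V x ^+ 2 = 2 * V x ^+ 2 / G1 by rewrite mulrAC.
  apply: (@poincare_eig _ (b 0%N) _ _ M df cf1).
  - by move=> y /(FM _ ord0); rewrite consR0.
  - by move=> /(Fd ord0)[d d0 H]; exists d => // y /H; rewrite consR0.
have HB : (eigvn (b \o S) n + 2) * N <= intn b B + 2 / G' * int1 (b 0%N) (fun y => U y ^+ 2).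
  rewrite /N !intn_cons//.
  have dFFi := dom1_intn dFF; have dBi := dom1_intn dB.
  have dU2 := dom1Z (2 / G') (dom1X2 dU).
  rewrite -(int1Z _ dFFi) -(int1Z _ (dom1X2 dU)) -(int1D dBi dU2).
  apply: (dominated_int_le (good_half (b 0%N))); [exact: dom1Z|exact: dom1D|] => y hy.
  have -> : intn (b \o S) (fun x => B (consR y x)) = intn (b \o S)
      (fun x => \sum_i D (lift ord0 i) (consR y x) ^+ 2 + sqnorm x * F (consR y x) ^+ 2).
    by apply: eq_intn => x _; rewrite /B tailR_consR -expr2.
  have -> : 2 / G' * U y ^+ 2 = 2 * U y ^+ 2 / G' by rewrite mulrAC.
  apply: (ih (b \o S) _ _ (C1_tail y CF) (gbd_consR y gF)
    (fun i => gbd_consR y (gD (lift ord0 i)))).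
  - by move=> x i /(FM _ (lift ord0 i)); rewrite consRS.
  - by move=> i /(Fd (lift ord0 i))[d d0 H]; exists d => // x /H; rewrite consRS.
have -> : 2 * T ^+ 2 / (G1 * G') = 2 * (T ^+ 2 / (G1 * G')) by rewrite mulrA.
lra.
Qed.

End Eigenfunctions.

(** * The stability inequality *)

Section Stability.
Context {R : realType}.
Implicit Types (b c : nat -> bool) (n k : nat).

(** A class that contains both the compactly supported functions and the eigenfunctions: decay
    replaces compactness, and vanishing on the faces replaces support in the open box. *)
Definition adm b n (F : 'rV[R]_n -> R) (D : 'I_n -> 'rV[R]_n -> R) :=
  [/\ C1 F D, gbd F, forall i, gbd (D i)
    & forall (x : 'rV[R]_n) (i : 'I_n), b i -> x 0 i = 0 -> F x = 0].

Lemma adm_eign b c n : (forall i, b i -> c i) -> adm b (@eign R c n) (@eignD R c n).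
Proof.
move=> bc; split; [exact: C1_eign|exact: gbd_eign|exact: gbd_eignD|].
move=> x i /bc ci xi; rewrite /eign /prodR (bigD1 i)//= /eig ci xi.
by rewrite !mul0r.
Qed.

Section Quadratic.
Variables (b : nat -> bool) (n : nat).
Implicit Types (F G : 'rV[R]_n -> R) (D : 'I_n -> 'rV[R]_n -> R).

Definition dirichlet F D := intn b (fun x => \sum_i D i x ^+ 2 + sqnorm x * F x ^+ 2).
Definition mass F := intn b (fun x => F x ^+ 2).

Lemma adm_domn F D : adm b F D -> domn b F.
Proof. by move=> [[_ cF _] gF _ _]; exact: domn_gbd. Qed.

Lemma adm_domnD F D i : adm b F D -> domn b (D i).
Proof. by move=> [[_ _ cD] _ gD _]; exact: domn_gbd. Qed.

Lemma domn_grad F D : adm b F D -> domn b (fun x => \sum_i D i x ^+ 2).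
Proof. by move=> aF; apply: domn_sum => i; apply: domnX2; exact: adm_domnD aF. Qed.

Lemma domn_potential F D : adm b F D -> domn b (fun x => sqnorm x * F x ^+ 2).
Proof.
move=> aF; under eq_fun do rewrite expr2.
by apply: domn_sqnorm_mul; exact: adm_domn aF.
Qed.

Lemma admB F G D D' t : adm b F D -> adm b G D' ->
  adm b (fun x => F x - t * G x) (fun i x => D i x - t * D' i x).
Proof.
have gB (f g : 'rV[R]_n -> R) : gbd f -> gbd g -> gbd (fun x => f x - t * g x).
  move=> [M fM] [N gN]; exists (M + `|t| * N) => x.
  rewrite mulrDl -mulrA; apply: (le_trans (ler_normB _ _)).
  by rewrite normrM lerD// ler_wpM2l.
move=> [[dF cF cD] gF gD F0] [[dG cG cD'] gG gD' G0]; split.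
- split.
  + by move=> x i; exact: (derB (dF x i) (derZ t (dG x i))).
  + by apply: continuousBf => //; exact: continuousZf.
  + by move=> i; apply: continuousBf => //; exact: continuousZf.
- exact: gB.
- by move=> i; exact: gB.
- by move=> x i bi xi; rewrite (F0 x i)// (G0 x i)// mulr0 subr0.
Qed.

Lemma dirichlet_eign c : (forall i, b i -> c i) ->
  dirichlet (@eign R c n) (@eignD R c n) = eigvn c n * mass (@eign R c n).
Proof.
move=> bc; have [CE gE gD E0] := adm_eign n bc.
have := energy_eign c CE gE gD E0.
rewrite /dirichlet /mass => H.
transitivity (intn b (fun x : 'rV[R]_n => \sum_i eignD c i x * eignD c i x +
   sqnorm x * (eign c x * eign c x))).
  by apply: eq_intn => x _; rewrite expr2; congr (_ + _); apply: eq_bigr => i _; rewrite expr2.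
by rewrite H; congr (_ * _); apply: eq_intn => x _; rewrite expr2.
Qed.

Lemma energy_sub_eign F D c t : adm b F D -> (forall i, b i -> c i) ->
  dirichlet (fun x => F x - t * eign c x) (fun i x => D i x - t * eignD c i x) +
  mass (fun x => F x - t * eign c x) =
  dirichlet F D + mass F
  - 2 * t * (eigvn c n + 1) * intn b (fun x => F x * eign c x)
  + t ^+ 2 * (eigvn c n + 1) * intn b (fun x : 'rV[R]_n => eign c x ^+ 2).
Proof.
move=> aF bc; have aE := adm_eign n bc.
have HF : intn b (fun x => \sum_i D i x * eignD c i x + sqnorm x * (F x * eign c x)) =
    eigvn c n * intn b (fun x => F x * eign c x).
  by case: aF => CF gF gD F0; exact: energy_eign.
have dsF := adm_domn aF; have dsE := adm_domn aE.
have dsD i := adm_domnD i aF; have dsDE i := adm_domnD i aE.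
have dB := admB t aF aE.
set E := intn b (fun x : 'rV[R]_n => eign c x ^+ 2).
have dG1 : domn b (fun x => \sum_i D i x ^+ 2 + sqnorm x * F x ^+ 2).
  exact: (domnD (domn_grad aF) (domn_potential aF)).
have dG2 : domn b (fun x : 'rV[R]_n => \sum_i eignD c i x ^+ 2 + sqnorm x * eign c x ^+ 2).
  exact: (domnD (domn_grad aE) (domn_potential aE)).
have dG3 : domn b (fun x => \sum_i D i x * eignD c i x + sqnorm x * (F x * eign c x)).
  have h1 : domn b (fun x => \sum_i D i x * eignD c i x).
    by apply: domn_sum => i; exact: domnM.
  exact: (domnD h1 (domn_sqnorm_mul dsF dsE)).
have -> : dirichlet (fun x => F x - t * eign c x) (fun i x => D i x - t * eignD c i x) =
    dirichlet F D + (- (2 * t) * (eigvn c n * intn b (fun x => F x * eign c x)) +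
      t ^+ 2 * (eigvn c n * E)).
  rewrite -HF -[eigvn c n * E](dirichlet_eign bc) /dirichlet.
  rewrite -(intnZ _ dG3) -(intnZ _ dG2).
  rewrite -(intnD (domnZ _ dG3) (domnZ _ dG2)) -(intnD dG1 (domnD (domnZ _ dG3) (domnZ _ dG2))).
  apply: eq_intn => x _.
  have -> : \sum_i (D i x - t * eignD c i x) ^+ 2 =
      \sum_i D i x ^+ 2 - 2 * t * (\sum_i D i x * eignD c i x)
      + t ^+ 2 * (\sum_i eignD c i x ^+ 2).
    rewrite !mulr_sumr -sumrN -!big_split/=; apply: eq_bigr => i _; ring.
  by ring.
have -> : mass (fun x => F x - t * eign c x) =
    mass F + (- (2 * t) * intn b (fun x => F x * eign c x) + t ^+ 2 * E).
  rewrite /mass /E -(intnZ _ (domnM dsF dsE)) -(intnZ _ (domnX2 dsE)).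
  rewrite -(intnD (domnZ _ (domnM dsF dsE)) (domnZ _ (domnX2 dsE))).
  rewrite -(intnD (domnX2 dsF) (domnD (domnZ _ (domnM dsF dsE)) (domnZ _ (domnX2 dsE)))).
  by apply: eq_intn => x _; ring.
by ring.
Qed.

End Quadratic.

Definition positive k n : nat -> bool := fun i => (n - k <= i)%N.

Lemma orthantE k n : @rowT R n @^-1` orthant k = boxT (positive k n) (n := n).
Proof.
by apply/seteqP; split => t /= H i; have := H i; rewrite /half/= mxE.
Qed.

Lemma orthant_intE k n (f : 'rV[R]_n -> R) : domn (positive k n) f ->
  orthant_int k f = (intn (positive k n) f)%:E.
Proof.
move=> df; rewrite /orthant_int orthantE.
exact: (dominated_int_fin (good_boxT (positive k n) n) df).
Qed.

Lemma ground_stateE k n : @ground_state R n k = @eign R (positive k n) n.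
Proof.
apply/funext => x; rewrite /ground_state /weight /eign /prodR /eig.
rewrite big_split/=; congr (_ * _); first by rewrite big_mkcond.
by rewrite -expR_sum /sqnorm mulr_suml -sumrN.
Qed.

Lemma grad_C1 n (F : 'rV[R]_n -> R) D : C1 F D -> grad F = fun x => \row_i D i x.
Proof.
move=> [dF _ _]; apply/funext => x; apply/rowP => i; rewrite !mxE.
by rewrite /partial; have [_ ->] := dF x i.
Qed.

(** Each of the n - k free coordinates contributes 1, and each of the k positive ones contributes
    3. *)
Lemma eigvn_positive k n : (k <= n)%N -> eigvn (positive k n) n = (n + 2 * k)%:R :> R.
Proof.
move=> kn; rewrite /eigvn -(big_mkord xpredT (fun i => eigv (positive k n i))).
rewrite (@big_cat_nat _ _ _ (n - k))//= ?leq_subr//.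
rewrite (eq_big_nat _ _ (F2 := fun=> 1)); last first.
  by move=> i /andP[_ ik]; rewrite /positive /eigv leqNgt ik.
rewrite [X in _ + X](eq_big_nat _ _ (F2 := fun=> 3)); last first.
  by move=> i /andP[ik _]; rewrite /positive /eigv ik.
rewrite !big_const_nat !iter_addr_0 subn0 subKn//.
rewrite -[3 *+ k]mulr_natr -natrM -natrD; congr _%:R.
by rewrite mulSn addnA subnK.
Qed.

Section Energies.
Variables (k n : nat).
Hypothesis kn : (k <= n)%N.
Let b := positive k n.
Variables (F : 'rV[R]_n -> R) (D : 'I_n -> 'rV[R]_n -> R).
Hypothesis aF : adm b F D.

Let gE : orthant_int k (fun x => sqnorm (\row_i D i x)) =
  (intn b (fun x => \sum_i D i x ^+ 2))%:E.
Proof.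
rewrite -orthant_intE; last exact: domn_grad aF.
by congr orthant_int; apply/funext => x; apply: eq_bigr => i _; rewrite mxE.
Qed.

Let dE : (intn b (fun x => \sum_i D i x ^+ 2) + intn b (fun x => sqnorm x * F x ^+ 2)) =
  dirichlet b F D.
Proof. by rewrite -intnD//; [exact: domn_grad aF|exact: domn_potential aF]. Qed.

Lemma deficitE : deficit k F (fun x => \row_i D i x) =
  (dirichlet b F D - eigvn b n * mass b F)%:E.
Proof.
rewrite /deficit gE !orthant_intE; last 2 first.
- by apply: domnX2; exact: adm_domn aF.
- exact: domn_potential aF.
by rewrite -EFinD dE eigvn_positive.
Qed.

Lemma energyE : energy k F (fun x => \row_i D i x) = (dirichlet b F D + mass b F)%:E.
Proof.
rewrite /energy gE !orthant_intE; last 2 first.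
- by apply: domnX2; exact: adm_domn aF.
- exact: domn_potential aF.
by rewrite -!EFinD dE.
Qed.

End Energies.

Lemma row_coord_le_norm n (x : 'rV[R]_n) i : `|x 0 i| <= `|x|.
Proof.
rewrite [leRHS]/Num.norm/= mx_normrE.
exact: (@le_bigmax _ _ _ _ (fun ij : 'I_1 * 'I_n => `|x ij.1 ij.2|) (0, i)).
Qed.

(** * Compactly supported functions are admissible *)

Section CompactSupport.
Variables (n k : nat) (u : 'rV[R]_n -> R).
Hypothesis Cu : Cc_smooth k u.
Let supp := closure [set x | u x != 0].
Let su : smooth u. Proof. by case: Cu. Qed.
Let csupp : compact supp. Proof. by case: Cu. Qed.
Let subo : supp `<=` orthant k. Proof. by case: Cu. Qed.

Let usupp x : u x != 0 -> supp x. Proof. by move=> ux; exact: subset_closure. Qed.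

Lemma Cc_smooth_C1 : C1 u (fun i => partial i u).
Proof.
have D0 x : differentiable u x := su [::] x.
have D1 i x : differentiable (partial i u) x := su [:: i] x.
split.
- by move=> x i; apply: derivableP; exact: diff_derivable.
- by move=> x; exact: differentiable_continuous.
- by move=> i x; exact: differentiable_continuous.
Qed.

(** Divided by the positive Gaussian, [f] is still continuous, hence bounded on the compact
    support. *)
Lemma gbd_supp (f : 'rV[R]_n -> R) : continuous f ->
  (forall x, f x != 0 -> supp x) -> gbd f.
Proof.
move=> cf fs; pose g x := f x * (gaussn x)^-1.
have g0 (x : 'rV[R]_n) : 0 < gaussn x by exact: expR_gt0.
have cg : continuous g.
  move=> x; apply: (@continuousM _ _ f (fun x => (gaussn x)^-1)); first exact: cf.
  by apply: continuousV; [rewrite gt_eqF|exact: continuous_gaussn].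
have /ex_strict_bound_gt0[K K0 /= HK] : bounded_set (g @` supp).
  by apply/compact_bounded/continuous_compact => //; exact: continuous_subspaceT.
exists K => x; have [->|/fs sx] := eqVneq (f x) 0.
  by rewrite normr0 mulr_ge0// ltW.
have := HK (g x) (imageP _ sx).
by rewrite /g normrM normfV (gtr0_norm (g0 x)) ltr_pdivrMr// => /ltW.
Qed.

Let dsupp i x : partial i u x != 0 -> supp x.
Proof.
apply: contra_neqP => sx.
have nA : \forall y \near x, u y = 0.
  have oA : open (~` supp) by apply: closed_openC; exact: closed_closure.
  have : \forall y \near x, (~` supp) y by exact: open_nbhs_nbhs.
  by apply: filterS => y nAy; apply/eqP/negPn/negP => /usupp.
transitivity ('D_(delta_mx 0 i) (cst (0 : R)) x); last exact: derive_cst.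
exact: near_eq_derive.
Qed.

Lemma Cc_smooth_adm : adm (positive k n) u (fun i => partial i u).
Proof.
have C := Cc_smooth_C1; have [_ cu cd] := C; split => //.
- exact: gbd_supp.
- by move=> i; apply: gbd_supp => //; exact: dsupp.
- move=> x i bi xi; apply/eqP/negPn/negP => /usupp /subo /(_ i bi).
  by rewrite xi ltxx.
Qed.

Lemma Cc_smooth_bounded : exists M, forall (x : 'rV[R]_n) (i : 'I_n),
  u x != 0 -> `|x 0 i| <= M.
Proof.
have /ex_strict_bound_gt0[K K0 /= HK] := compact_bounded csupp.
exists K => x i /usupp sx; apply: (le_trans (row_coord_le_norm x i)).
exact/ltW/HK.
Qed.

(** The coordinate attains its minimum on the compact support, inside the open orthant. This margin
    is what allows the division by the eigenfunction in [poincare_eig]. *)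
Lemma Cc_smooth_margin (i : 'I_n) : positive k n i -> exists2 d, 0 < d &
  forall x : 'rV[R]_n, u x != 0 -> d <= x 0 i.
Proof.
move=> bi; have [s0|] := pselect (supp !=set0); last first.
  move=> s0; exists 1 => // x /usupp sx; exfalso; apply: s0; by exists x.
have cc : {within supp, continuous (fun x : 'rV[R]_n => x 0 i)}.
  by apply: continuous_subspaceT; exact: (@coord_continuous R 1 n 0 i).
have [z /set_mem sz zmin] := compact_EVT_min s0 csupp cc.
exists (z 0 i); first exact: (subo sz bi).
by move=> x /usupp sx; apply: zmin; exact: mem_set.
Qed.

End CompactSupport.

Lemma stability k n : (k <= n)%N -> @stability_ineq R n k (2 / (n + 2 * k + 3)%:R).
Proof.
move=> kn u Cu; set b := positive k n; set L := (n + 2 * k)%:R : R.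
have aF := Cc_smooth_adm Cu; rewrite -/b in aF.
have [C1u gu gd _] := aF.
have LE : eigvn b n = L by exact: eigvn_positive.
have bb i : b i -> b i by [].
pose G := intn b (fun x : 'rV[R]_n => eign b x ^+ 2).
have G0 : 0 < G by exact: intn_eign_sqr_gt0.
pose S := intn b (fun x => u x * eign b x).
pose t := S / G.
have [M uM] := Cc_smooth_bounded Cu.
have gap := spectral_gap C1u gu gd uM (Cc_smooth_margin Cu).
have aS := admB t aF (adm_eign n bb).
rewrite (grad_C1 C1u) (deficitE kn aF) -/b.
have L0 : 0 <= L by rewrite ler0n.
have C0E : (2 / (n + 2 * k + 3)%:R : R) = 2 / (L + 3) by rewrite natrD.
have C00 : 0 <= 2 / (n + 2 * k + 3)%:R :> R by rewrite divr_ge0.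
apply: (@le_trans _ _ ((2 / (n + 2 * k + 3)%:R)%:E *
   energy k (fun x => u x - t * ground_state k x)%R
     (grad (fun x => u x - t * ground_state k x)%R))%E).
  by apply: lee_wpmul2l => //; apply: ereal_inf_lbound; exists t.
have [CS _ _ _] := aS.
rewrite ground_stateE (grad_C1 CS) (energyE aS) -EFinM lee_fin.
rewrite (energy_sub_eign t aF bb) -/G -/S LE C0E.
have tG : t * G = S by rewrite /t divfK// gt_eqF.
have -> : dirichlet b u (fun i => partial i u) + mass b u - 2 * t * (L + 1) * S +
   t ^+ 2 * (L + 1) * G = dirichlet b u (fun i => partial i u) + mass b u - (L + 1) * (t * S).
  by rewrite -tG; ring.
rewrite mulrAC ler_pdivrMr ?ltr_wpDl//.
move: gap; rewrite -/(dirichlet b u _) -/(mass b u) -/b -/S -/G LE.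
have -> : 2 * S ^+ 2 / G = 2 * (t * S) by rewrite /t; field; rewrite gt_eqF.
set Q := dirichlet _ _ _; set N := mass _ _; set p := t * S => gap.
(* The factor L + 1 comes from the identity (L + 3) (Q - L N) - 2 (Q + N - (L + 1) p) = (L + 1) (Q +
   2 p - (L + 2) N). *)
have := ler_wpM2l (_ : 0 <= L + 1) gap.
rewrite addr_ge0// => /(_ isT).
nra.
Qed.

End Stability.

(** * Smooth cutoff functions *)

Section Bump.
Context {R : realType}.
Implicit Types (x y s : R) (p : nat).

(* The powers s^-p make the family stable under differentiation ([der_bump]). *)
Definition bump p s := if 0 < s then s ^- p * expR (- s^-1) else 0.

Lemma bump_ge0 p s : 0 <= bump p s.
Proof. by rewrite /bump; case: ifP => // s0; rewrite mulr_ge0 ?expR_ge0// invr_ge0 exprn_ge0// ltW. Qed.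

Lemma bumpS p s : bump p s = s * bump p.+1 s.
Proof.
rewrite /bump; case: ifP => s0; last by rewrite mulr0.
by rewrite mulrA exprS invfM mulrA divff ?mul1r// gt_eqF.
Qed.

Lemma bump_le p : exists2 C, 0 <= C & forall s, bump p s <= C.
Proof.
have [C HC] := @exprn_expR_le R (2 * p).
exists `|C|; first exact: normr_ge0.
move=> s; rewrite /bump; case: ifP => s0; last exact: normr_ge0.
(* At the point x = 2 / sqrt s the weight exp(-x^2/4) is exp(-1/s), and x^(2p) is 4^p s^-p. *)
apply: (le_trans _ (ler_norm C)); apply: (le_trans _ (HC (2 * Num.sqrt s^-1))).
have s0' : 0 <= s^-1 by rewrite invr_ge0 ltW.
have E : (2 * Num.sqrt s^-1) ^+ 2 = 4 * s^-1.
  by rewrite exprMn sqr_sqrtr//; ring.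
have -> : gauss4 (2 * Num.sqrt s^-1) = expR (- s^-1).
  by rewrite /gauss4 E; congr expR; rewrite mulrAC divff// mul1r.
rewrite exprM -normrX E ger0_norm ?mulr_ge0//.
rewrite ler_wpM2r ?expR_ge0// exprMn -exprVn ler_peMl ?exprn_ge0//.
by rewrite exprn_ege1//; lra.
Qed.

Lemma der_quadratic_bound (f : R -> R) C : (forall x, `|f x| <= C * x ^+ 2) ->
  is_derive (0 : R) 1 f 0.
Proof.
move=> fC; have f0 : f 0 = 0.
  by apply/eqP; rewrite -normr_le0; apply: (le_trans (fC 0)); rewrite expr0n mulr0.
have C0 : 0 <= C.
  by have := fC 1; rewrite expr1n mulr1; apply: le_trans; exact: normr_ge0.
have H : (fun h : R => h^-1 *: ((f \o shift 0) (h *: 1) - f 0)) @ 0^' --> (0 : R).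
  apply/norm_cvg0P.
  have c0 : (fun h : R => C * `|h|) @ 0^' --> (0 : R).
    rewrite -[X in _ --> X](mulr0 C) -{2}(normr0 R).
    apply: cvgM; first exact: cvg_cst.
    apply: (@cvg_within_filter _ _ _ (nbhs (0 : R))).
    exact: norm_continuous.
  apply: (squeeze_cvgr _ (cvg_cst 0) c0).
  apply: filterS (nbhs_dnbhs_neq (0 : R)) => h h0.
  rewrite normr_ge0/= f0 subr0 addr0 normrZ [h%:A]mulr1 normfV.
  rewrite ler_pdivrMl ?normr_gt0//; apply: (le_trans (fC h)).
  by rewrite -[h ^+ 2]real_normK ?num_real// expr2 mulrCA.
apply: DeriveDef; first by apply/cvg_ex; exists 0.
exact: (cvg_lim _ H).
Qed.

Lemma der_bump p x : is_derive x 1 (bump p) (bump p.+2 x - p%:R * bump p.+1 x).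
Proof.
have [x0|x0|->] := ltgtP x 0.
- rewrite /bump ltNge (ltW x0)/= mulr0 subr0.
  apply: (@near_eq_is_derive _ _ _ (cst 0)).
  near=> y; have y0 : y < 0 by near: y; exact: lt_nbhsl.
  by rewrite ltNge (ltW y0).
- pose e y : R := y ^- p * expR (- y^-1).
  apply: (@near_eq_is_derive _ _ _ e).
    near=> y; rewrite /bump (_ : 0 < y)//; near: y; exact: lt_nbhsr.
  have xn : x != 0 by rewrite gt_eqF.
  have I := is_derive_id x (1 : R).
  have dV : is_derive x 1 (fun y : R => y^-1) (- (x ^- 2)).
    by apply: (der_eq (is_deriveV xn I)); rewrite /GRing.scale/= mulr1.
  have dE : is_derive x 1 (fun y => expR (- y^-1)) (expR (- x^-1) * x ^- 2).
    have -> : (fun y : R => expR (- y^-1)) = fun y => expR (-1 * y^-1).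
      by apply/funext => y; rewrite mulN1r.
    apply: (der_eq (is_derive1_comp (is_derive_expR _) (derZ (-1) dV))).
    by rewrite mulN1r; ring.
  have dP : is_derive x 1 (fun y : R => y ^- p) (- p%:R * x ^- p.+1).
    elim: p {e} => [|p ih].
      rewrite mulNr mul0r oppr0.
      have -> : (fun y : R => y ^- 0) = fun=> 1 by apply/funext => y; rewrite invr1.
      exact: derC.
    have -> : (fun y : R => y ^- p.+1) = fun y => y ^- p * y^-1.
      by apply/funext => y; rewrite exprSr invfM.
    apply: (der_eq (derM ih dV)); rewrite -natr1 !exprSr; field.
    by rewrite xn expf_neq0.
  apply: (der_eq (derM dP dE)); rewrite /bump x0 !exprSr; field.
  by rewrite xn expf_neq0.
(* At 0, two uses of [bumpS] write [bump p y] as y^2 times the bounded function [bump p.+2], so the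
   derivative is 0. *)
- have [C C0 HC] := bump_le p.+2.
  have -> : bump p.+2 0 - p%:R * bump p.+1 0 = 0 :> R by rewrite /bump ltxx mulr0 subr0.
  apply: (@der_quadratic_bound _ C) => y.
  rewrite bumpS bumpS mulrA -expr2 normrM ger0_norm ?sqr_ge0// mulrC ler_wpM2r ?sqr_ge0//.
  by rewrite ger0_norm ?bump_ge0.
Unshelve. all: by end_near. Qed.

(** A syntactic class closed under derivation ([elem_derive]). The iterated partial derivatives of a
    product of such functions are again products of this kind, which settles all the conditions of
    [smooth] by one induction. *)
Inductive elem : (R -> R) -> Prop :=
| elem_cst k : elem (fun=> k)
| elem_id : elem (fun x => x)
| elem_exp : elem expR
| elem_bump p : elem (bump p)
| elem_add f g : elem f -> elem g -> elem (fun x => f x + g x)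
| elem_mul f g : elem f -> elem g -> elem (fun x => f x * g x)
| elem_comp f g : elem f -> elem g -> elem (fun x => f (g x)).

Lemma elem_derive f : elem f -> exists2 f', elem f' &
  forall x, is_derive x 1 f (f' x).
Proof.
move=> ef; elim: f / ef => [k||||||].
- by exists (fun=> 0) => [|x]; [exact: elem_cst|exact: derC].
- by exists (fun=> 1) => [|x]; [exact: elem_cst|exact: is_derive_id].
- by exists expR => [|x]; [exact: elem_exp|exact: is_derive_expR].
- move=> p; exists (fun x => bump p.+2 x + (- p%:R) * bump p.+1 x) => [|x].
    apply: elem_add; first exact: elem_bump.
    by apply: elem_mul; [exact: elem_cst|exact: elem_bump].
  by rewrite mulNr; exact: der_bump.
- move=> f g _ [f' ef' df] _ [g' eg' dg]; exists (fun x => f' x + g' x) => [|x].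
    exact: elem_add.
  exact: derD.
- move=> f g ef [f' ef' df] eg [g' eg' dg].
  exists (fun x => f' x * g x + f x * g' x) => [|x].
    by apply: elem_add; exact: elem_mul.
  exact: derM.
- move=> f g ef [f' ef' df] eg [g' eg' dg].
  exists (fun x => f' (g x) * g' x) => [|x].
    by apply: elem_mul => //; exact: elem_comp.
  exact: (is_derive1_comp (df (g x)) (dg x)).
Qed.

Lemma differentiable_prodR n (f : 'I_n -> R -> R) (x : 'rV[R]_n) :
  (forall i, elem (f i)) -> differentiable (prodR f) x.
Proof.
move=> ef; rewrite /prodR; elim: (index_enum _) => [|i r ih].
  by under eq_fun do rewrite big_nil; exact: differentiable_cst.
under eq_fun do rewrite big_cons.
apply: differentiableM => //.
apply: (@differentiable_comp _ _ _ _ (fun x : 'rV[R]_n => x 0 i) (f i)).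
  exact: differentiable_coord.
by apply/derivable1_diffP; have [f' _ df] := elem_derive (ef i); case: (df (x 0 i)).
Qed.

Lemma smooth_prodR n (f : 'I_n -> R -> R) :
  (forall i, elem (f i)) -> smooth (prodR f).
Proof.
move=> ef s x.
suff [f' ef' ->] : exists2 f', (forall i, elem (f' i)) &
    foldr partial (prodR f) s = prodR f'.
  exact: differentiable_prodR.
elim: s => [|i s [f' ef' IH]] /=; first by exists f.
have ex j : exists f'', elem f'' /\ forall y : R, is_derive y 1 (f' j) (f'' y).
  by have [h eh dh] := elem_derive (ef' j); exists h.
have [g Hg] := choice ex.
exists (fun j => if j == i then g j else f' j).
  by move=> j; case: ifP => // _; case: (Hg j).
apply/funext => y; rewrite IH /partial.
by have [_ ->] := @der_prodR _ n f' g i y (fun j => (Hg j).2).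
Qed.

End Bump.

(** * Truncated eigenfunctions in one variable *)

Section Cutoff.
Context {R : realType}.
Implicit Types (x J s : R) (b c : bool).

(* Supported in x^2 <= J and, if [b], x >= 1/J; tends to 1 as J goes to infinity. *)
Definition cut b J x := bump 0 (J - x ^+ 2) * (if b then bump 0 (J * x - 1) else 1).
Definition cut' b J x :=
  - (2 * x * bump 2 (J - x ^+ 2)) * (if b then bump 0 (J * x - 1) else 1) +
  bump 0 (J - x ^+ 2) * (if b then J * bump 2 (J * x - 1) else 0).
Definition wave b c J x := cut b J x * eig c x.
Definition wave' b c J x := cut' b J x * eig c x + cut b J x * eig' c x.

Lemma elem_wave b c J : elem (wave b c J).
Proof.
have X : @elem R (fun x => x) by exact: elem_id.
have XX : @elem R (fun x => x ^+ 2).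
  by under eq_fun do rewrite expr2; exact: elem_mul.
have K k : @elem R (fun=> k) by exact: elem_cst.
have ecut : elem (cut b J).
  apply: elem_mul.
    apply: (elem_comp (elem_bump 0) (g := fun x => J - x ^+ 2)).
    under eq_fun do rewrite -mulN1r.
    by apply: elem_add => //; exact: elem_mul.
  case: b => //; apply: (elem_comp (elem_bump 0) (g := fun x => J * x - 1)).
  by apply: elem_add => //; exact: elem_mul.
apply: elem_mul => //; apply: elem_mul; first by case: c.
apply: (elem_comp elem_exp (g := fun x => - (x ^+ 2 / 2))).
under eq_fun do rewrite -mulN1r.
by do 2 apply: elem_mul => //.
Qed.

Lemma der_bump0 x : is_derive x 1 (@bump R 0) (bump 2 x).
Proof. by apply: (der_eq (der_bump 0 x)); rewrite mul0r subr0. Qed.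

Lemma der_cut b J x : is_derive x 1 (cut b J) (cut' b J x).
Proof.
have I := is_derive_id x (1 : R).
have d1 : is_derive x 1 (fun x => bump 0 (J - x ^+ 2)) (- (2 * x * bump 2 (J - x ^+ 2))).
  have -> : (fun x => bump 0 (J - x ^+ 2)) = (@bump R 0) \o (fun x => J - x * x).
    by apply/funext => y; rewrite /= expr2.
  apply: (der_eq (is_derive1_comp (der_bump0 _) (derB (derC J x 1) (derM I I)))).
  by rewrite expr2; ring.
have d2 : is_derive x 1 (fun x => if b then bump 0 (J * x - 1) else 1)
    (if b then J * bump 2 (J * x - 1) else 0).
  case: b; last exact: derC.
  have -> : (fun x => if true then bump 0 (J * x - 1) else 1) =
      (@bump R 0) \o (fun x => J * x - 1) by [].
  apply: (der_eq (is_derive1_comp (der_bump0 _) (derB (derZ J I) (derC 1 x 1)))).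
  by ring.
exact: (derM d1 d2).
Qed.

Lemma der_wave b c J x : is_derive x 1 (wave b c J) (wave' b c J x).
Proof. exact: (derM (der_cut b J x) (der_eig c x)). Qed.

Lemma bump0_le1 s : bump 0 s <= 1.
Proof.
rewrite /bump; case: ifP => s0 //.
by rewrite expr0 invr1 mul1r -[leRHS]expR0 ler_expR oppr_le0 invr_ge0 ltW.
Qed.

Lemma cut_01 b J x : 0 <= cut b J x <= 1.
Proof.
have h2 : 0 <= (if b then bump 0 (J * x - 1) else 1) <= 1.
  by case: b; rewrite ?bump_ge0 ?bump0_le1 ?ler01 ?lexx.
have /andP[h20 h21] := h2.
by rewrite /cut mulr_ge0 ?bump_ge0//= mulr_ile1 ?bump_ge0 ?bump0_le1.
Qed.

(** The difficulty is uniformity in [J], since the cutoff at 0 has a derivative of order [J]. When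
    [b] holds the eigenfunction is odd and provides a factor x, and J x [bump 2] is
    [bump 2 + bump 1] at J x - 1, which is bounded. *)
Lemma wave_bound b c : (b -> c) -> exists2 K, 0 <= K &
  forall J x, `|wave b c J x| <= K * gauss4 x /\ `|wave' b c J x| <= K * gauss4 x.
Proof.
move=> bc.
have [K K0 HK] := @eig_bound R.
have [C1 C10 HC1] := @bump_le R 1.
have [C2 C20 HC2] := @bump_le R 2.
have Hm m : exists2 M, 0 <= M & forall x : R, `|x ^+ m * expR (- (x ^+ 2 / 2))| <= M * gauss4 x.
  have [M M0 HM] := dominated_bound (good_half false) (@dom1_monomial R false m).
  by exists M => // x; exact: HM.
have [M0 M00 HM0] := Hm 0%N.
have [M M_0 HM] := Hm c.+1.
have g0 x : 0 <= gauss4 x by exact: expR_ge0.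
exists (K + (2 * C2 * M + (C1 + C2) * M0)).
  by rewrite !addr_ge0 ?mulr_ge0// addr_ge0.
move=> J x; have /andP[c0 c1] := cut_01 b J x; have [eK e'K] := HK c x.
have T0 : 0 <= 2 * C2 * M + (C1 + C2) * M0 by rewrite addr_ge0 ?mulr_ge0// addr_ge0.
split.
  rewrite /wave normrM ger0_norm//; apply: (@le_trans _ _ (1 * `|eig c x|)).
    by rewrite ler_wpM2r.
  by rewrite mul1r (le_trans eK)// ler_wpM2r// lerDl.
rewrite /wave' [X in `|X|]addrC [leRHS]mulrDl; apply: (le_trans (ler_normD _ _)); apply: lerD.
  rewrite normrM ger0_norm//; apply: (le_trans _ e'K).
  by rewrite ler_piMl.
rewrite /cut' mulrDl [leRHS]mulrDl; apply: (le_trans (ler_normD _ _)); apply: lerD.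
  have q01 : `|if b then bump 0 (J * x - 1) else 1| <= 1.
    case: (b); last by rewrite normr1.
    by rewrite ger0_norm ?bump_ge0// bump0_le1.
  have -> : - (2 * x * bump 2 (J - x ^+ 2)) * (if b then bump 0 (J * x - 1) else 1) * eig c x =
     (- 2 * (if b then bump 0 (J * x - 1) else 1)) * (bump 2 (J - x ^+ 2) * (x * eig c x)) by ring.
  (* The factor x, which comes from differentiating J - x^2, is joined to the eigenfunction to form
     a monomial of degree one higher. *)
  have xe : x * eig c x = x ^+ c.+1 * expR (- (x ^+ 2 / 2)).
    by rewrite /eig; case: (c); rewrite exprS ?expr1 ?expr0; ring.
  have -> : 2 * C2 * M * gauss4 x = 2 * 1 * (C2 * (M * gauss4 x)) by ring.
  rewrite xe normrM; apply: ler_pM; [exact: normr_ge0|exact: normr_ge0| |].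
    by rewrite normrM normrN (ger0_norm (ler0n _ 2)) ler_wpM2l.
  rewrite normrM; apply: ler_pM; [exact: normr_ge0|exact: normr_ge0| |].
    by rewrite ger0_norm ?bump_ge0.
  exact: HM.
move: bc; case: (b) => [/(_ isT) -> | _]; last first.
  by rewrite mulr0 mul0r normr0 !mulr_ge0// addr_ge0.
have -> : bump 0 (J - x ^+ 2) * (J * bump 2 (J * x - 1)) * eig true x =
   (bump 0 (J - x ^+ 2) * (bump 2 (J * x - 1) + (J * x - 1) * bump 2 (J * x - 1))) *
   (x ^+ 0 * expR (- (x ^+ 2 / 2))).
  by rewrite /eig; ring.
rewrite -bumpS normrM -[leRHS]mulrA ler_pM ?HM0//.
rewrite normrM !ger0_norm ?addr_ge0 ?bump_ge0//.
rewrite -[leRHS]mul1r ler_pM ?addr_ge0 ?bump_ge0 ?bump0_le1//.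
by rewrite [leRHS]addrC lerD.
Qed.

Lemma bump_cvgy : bump 0 s @[s --> +oo] --> (1 : R) /\
  (forall p, bump p.+1 s @[s --> +oo] --> (0 : R)).
Proof.
have V0 : s^-1 @[s --> +oo] --> (0 : R).
  by apply/gtr0_cvgV0; [exact: nbhs_pinfty_gt|exact: cvg_id].
split.
  have V1 : 1 - s^-1 @[s --> +oo] --> (1 : R).
    by rewrite -[X in _ --> X](subr0 1); apply: cvgB => //; exact: cvg_cst.
  apply: (@squeeze_cvgr _ _ _ _ (fun s => 1 - s^-1) (fun=> 1)) => //; last exact: cvg_cst.
  near=> s; have s0 : 0 < s by near: s; exact: nbhs_pinfty_gt.
  rewrite bump0_le1 andbT /bump s0 expr0 invr1 mul1r.
  exact: expR_ge1Dx.
move=> p; apply: (@squeeze_cvgr _ _ _ _ (fun=> 0) (fun s => s^-1)) => //; last exact: cvg_cst.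
near=> s; have s1 : 1 <= s by near: s; exact: nbhs_pinfty_ge.
have s0 : 0 < s by rewrite (lt_le_trans ltr01).
rewrite bump_ge0/= /bump s0 -[leRHS]mulr1 ler_pM ?invr_ge0 ?exprn_ge0 ?expR_ge0 ?(ltW s0)//.
  rewrite lef_pV2 ?posrE ?exprn_gt0// exprS ler_peMr ?(ltW s0)//.
  exact: exprn_ege1.
by rewrite -[leRHS]expR0 ler_expR oppr_le0 invr_ge0 ltW.
Unshelve. all: by end_near. Qed.

Lemma cvgy_sub x : (fun j => j.+1%:R - x ^+ 2) @ \oo --> +oo.
Proof.
apply/cvgryPge => A; near=> j.
rewrite lerBrDr; apply: (le_trans (ler_norm _)).
apply: (le_trans (ltW (truncnS_gt _))); rewrite ler_nat ltnS.
by near: j; exact: nbhs_infty_ge.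
Unshelve. all: by end_near. Qed.

Lemma cvgy_mul x : 0 < x -> (fun j => j.+1%:R * x - 1) @ \oo --> +oo.
Proof.
move=> x0; apply/cvgryPge => A; near=> j.
rewrite lerBrDr -ler_pdivrMr//; apply: (le_trans (ler_norm _)).
apply: (le_trans (ltW (truncnS_gt _))); rewrite ler_nat ltnS.
by near: j; exact: nbhs_infty_ge.
Unshelve. all: by end_near. Qed.

Lemma cut_cvg b x : half b x -> cut b j.+1%:R x @[j --> \oo] --> (1 : R).
Proof.
move=> hx; have [B0 _] := bump_cvgy.
suff : cut b j.+1%:R x @[j --> \oo] --> (1 * 1 : R) by rewrite mulr1.
apply: cvgM; first exact: (cvg_comp _ _ (cvgy_sub x) B0).
case: b hx => [/(_ isT) x0|_]; last exact: cvg_cst.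
exact: (cvg_comp _ _ (cvgy_mul x0) B0).
Qed.

Lemma cut'_cvg b x : half b x -> cut' b j.+1%:R x @[j --> \oo] --> (0 : R).
Proof.
move=> hx; have [B0 Bp] := bump_cvgy.
have -> : (0 : R) = - (2 * x * 0) * 1 + 1 * 0 by ring.
apply: cvgD; apply: cvgM.
- apply: (@cvgN _ R^o); apply: cvgM; first exact: cvg_cst.
  exact: (cvg_comp _ _ (cvgy_sub x) (Bp 1%N)).
- case: b hx => [/(_ isT) x0|_]; last exact: cvg_cst.
  exact: (cvg_comp _ _ (cvgy_mul x0) B0).
- exact: (cvg_comp _ _ (cvgy_sub x) B0).
- case: b hx => [/(_ isT) x0|_]; last exact: cvg_cst.
  (* The growing factor is traded for a division by the fixed x > 0; both bumps on the right then
     tend to 0. *)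
  have E (j : nat) : j.+1%:R * bump 2 (j.+1%:R * x - 1) =
     (bump 2 (j.+1%:R * x - 1) + bump 1 (j.+1%:R * x - 1)) / x.
    by rewrite [bump 1 _]bumpS; field; rewrite gt_eqF.
  have H : (fun j : nat => (bump 2 (j.+1%:R * x - 1) + bump 1 (j.+1%:R * x - 1)) / x)
      @ \oo --> ((0 + 0) / x : R).
    apply: cvgM; last exact: cvg_cst.
    apply: cvgD.
      exact: (cvg_comp _ _ (cvgy_mul x0) (Bp 1%N)).
    exact: (cvg_comp _ _ (cvgy_mul x0) (Bp 0%N)).
  rewrite addr0 mul0r in H; apply: cvg_trans H.
  by apply: near_eq_cvg; apply: nearW => j; rewrite E.
Qed.

Lemma wave_cvg b c x : half b x -> wave b c j.+1%:R x @[j --> \oo] --> eig c x.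
Proof.
move=> hx; rewrite -[X in _ --> X]mul1r.
by apply: cvgM; [exact: cut_cvg|exact: cvg_cst].
Qed.

Lemma wave'_cvg b c x : half b x -> wave' b c j.+1%:R x @[j --> \oo] --> eig' c x.
Proof.
move=> hx; have -> : eig' c x = 0 * eig c x + 1 * eig' c x by ring.
apply: cvgD; apply: cvgM; try exact: cvg_cst; [exact: cut'_cvg|exact: cut_cvg].
Qed.

Lemma wave_support b c (j : nat) x : wave b c j.+1%:R x != 0 ->
  x \in `[(if b then j.+1%:R^-1 else - j.+1%:R), j.+1%:R].
Proof.
have j0 : 0 < j.+1%:R :> R by [].
rewrite /wave /cut !mulf_eq0 !negb_or => /andP[/andP[h1 h2] _].
have {}h1 : x ^+ 2 < j.+1%:R.
  by move: h1; rewrite /bump; case: ifPn => [|_]; rewrite ?eqxx// subr_gt0.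
have : `|x| <= j.+1%:R.
  (* Since j + 1 >= 1, the bound x^2 < j + 1 yields |x| <= j + 1, which is crude but avoids square
     roots. *)
  rewrite leNgt; apply/negP => jx.
  have : j.+1%:R ^+ 2 < `|x| ^+ 2 by rewrite ltrXn2r.
  rewrite real_normK ?num_real// => /lt_trans /(_ h1).
  by rewrite expr2 gtr_pMr// ltNge ler1n.
rewrite ler_norml in_itv/= => /andP[x1 ->]; rewrite andbT.
case: b h2 => // h2; move: h2; rewrite /bump; case: ifPn => [|_]; rewrite ?eqxx//.
rewrite subr_gt0 => h _; rewrite -[leLHS]mulr1 ler_pdivrMl//; exact: ltW.
Qed.

End Cutoff.

(** * Sharpness and equality *)

Section Sharpness.
Context {R : realType}.
Implicit Types (b c : nat -> bool) (n k : nat).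

Definition truncated b c n (j : nat) : 'rV[R]_n -> R :=
  prodR (fun i : 'I_n => wave (b i) (c i) j.+1%:R).
Definition truncatedD b c n (j : nat) (i : 'I_n) : 'rV[R]_n -> R :=
  prodR (fun l : 'I_n => if l == i then wave' (b l) (c l) j.+1%:R
                         else wave (b l) (c l) j.+1%:R).

Lemma der_truncated b c n j x i :
  is_derive x (delta_mx 0 i) (@truncated b c n j) (@truncatedD b c n j i x).
Proof.
exact: (@der_prodR R n (fun i => wave (b i) (c i) j.+1%:R)
  (fun i => wave' (b i) (c i) j.+1%:R) i x (fun i y => der_wave _ _ _ y)).
Qed.

Lemma partial_truncated b c n j i : partial i (@truncated b c n j) = truncatedD b c j i.
Proof. by apply/funext => x; rewrite /partial; have [_ ->] := der_truncated b c j x i. Qed.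

Lemma Cc_smooth_truncated c n k j : Cc_smooth k (@truncated (positive k n) c n j).
Proof.
set b := positive k n.
pose A (i : 'I_n) : set R := `[(if b i then j.+1%:R^-1 else - j.+1%:R), j.+1%:R]%classic.
have cA : compact [set v : 'rV[R]_n | forall i, A i (v 0 i)].
  by apply: (@rV_compact R n A) => i; exact: segment_compact.
have clA : closed [set v : 'rV[R]_n | forall i, A i (v 0 i)].
  by apply: compact_closed => //; exact: norm_hausdorff.
have sA : closure [set x | @truncated b c n j x != 0] `<=`
    [set v : 'rV[R]_n | forall i, A i (v 0 i)].
  rewrite [X in _ `<=` X](closure_id _).1//; apply: closureS => x /= ux i.
  apply: (@wave_support R (b i) (c i)); apply: contra_neq ux => wx.
  by rewrite /truncated /prodR (bigD1 i)//= wx mul0r.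
split.
- by apply: smooth_prodR => i; exact: elem_wave.
- by apply: (subclosed_compact _ cA sA); exact: closed_closure.
- move=> x /sA H i bi; have := H i; rewrite /A /b /positive bi /= in_itv/= => /andP[+ _].
  by apply: lt_le_trans; rewrite invr_gt0.
Qed.

(** The bound does not depend on [j]: it is the majorant for the passages to the limit below. *)
Lemma truncated_bound b c n : (forall i, b i -> c i) -> exists2 M, 0 <= M &
  forall j (x : 'rV[R]_n), `|truncated b c j x| <= M * gaussn x /\
    forall i, `|truncatedD b c j i x| <= M * gaussn x.
Proof.
move=> bc.
have [K00 K00_ H00] := @wave_bound R false false id.
have [K01 K01_ H01] := @wave_bound R false true (fun _ => isT).
have [K11 K11_ H11] := @wave_bound R true true id.
pose K := K00 + K01 + K11.
have g0 y : 0 <= gauss4 y :> R by exact: expR_ge0.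
have H (i : nat) J y : `|wave (b i) (c i) J y| <= K * gauss4 y /\
    `|wave' (b i) (c i) J y| <= K * gauss4 y.
  have := bc i; case: (b i) (c i) => [] [] // => [_|/(_ isT)//|_|_].
  - by have [h1 h2] := H11 J y; split; [apply: (le_trans h1)|apply: (le_trans h2)];
      rewrite ler_wpM2r// /K; lra.
  - by have [h1 h2] := H01 J y; split; [apply: (le_trans h1)|apply: (le_trans h2)];
      rewrite ler_wpM2r// /K; lra.
  - by have [h1 h2] := H00 J y; split; [apply: (le_trans h1)|apply: (le_trans h2)];
      rewrite ler_wpM2r// /K; lra.
have K0 : 0 <= K by rewrite /K !addr_ge0.
exists (K ^+ n); first exact: exprn_ge0.
move=> j x; split; first by apply: prodR_bound => // i y; case: (H i j.+1%:R y).
by move=> i; apply: prodR_bound => // l y; case: ifP => _; case: (H l j.+1%:R y).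
Qed.

Lemma prodR_cvg n (f : nat -> 'I_n -> R -> R) (g : 'I_n -> R -> R) (x : 'rV[R]_n) :
  (forall i, f j i (x 0 i) @[j --> \oo] --> g i (x 0 i)) ->
  prodR (f j) x @[j --> \oo] --> prodR g x.
Proof.
move=> H; apply: (@cvg_big _ _ _ _ xpredT (@mul_continuous R) _ _ _
  (fun i j => f j i (x 0 i)) (fun i => g i (x 0 i))).
by move=> i _; exact: H.
Qed.

Lemma truncated_cvg b c n (x : 'rV[R]_n) : (forall i : 'I_n, half (b i) (x 0 i)) ->
  (truncated b c j x @[j --> \oo] --> eign c x) /\
  (forall i, truncatedD b c j i x @[j --> \oo] --> eignD c i x).
Proof.
move=> hx; split.
  by apply: prodR_cvg => i; exact: wave_cvg.
move=> i; apply: prodR_cvg => l.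
by case: ifP => _; [exact: wave'_cvg|exact: wave_cvg].
Qed.

Lemma intn_cvg b n (F : nat -> 'rV[R]_n -> R) G M :
  (forall j, domn b (F j)) -> (forall j x, `|F j x| <= M * gaussn x) ->
  (forall x : 'rV[R]_n, (forall i : 'I_n, half (b i) (x 0 i)) ->
     F j x @[j --> \oo] --> G x) ->
  intn b (F j) @[j --> \oo] --> intn b G.
Proof.
move=> dF FM FG.
apply: (@dominated_int_cvg _ _ _ _ _ _ (good_boxT b n) (fun j => F j \o @rowT R n) _ M).
- by move=> j; case: (dF j).
- by move=> j t _; exact: FM.
- by move=> t ht; apply: FG => i; rewrite mxE; exact: ht.
Qed.

Lemma eign_bound c n : exists2 M, 0 <= M & forall x : 'rV[R]_n,
  `|eign c x| <= M * gaussn x /\ forall i, `|eignD c i x| <= M * gaussn x.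
Proof.
have [K K0 HK] := @eig_bound R; exists (K ^+ n); first exact: exprn_ge0.
move=> x; split; first by apply: prodR_bound => // i y; case: (HK (c i) y).
by move=> i; apply: prodR_bound => // j y; case: ifP => _; case: (HK (c j) y).
Qed.

Lemma mul_bound n (x : 'rV[R]_n) (p q M N : R) : 0 <= M -> 0 <= N ->
  `|p| <= M * gaussn x -> `|q| <= N * gaussn x -> `|p * q| <= M * N * gaussn x.
Proof.
move=> M0 N0 hp hq; have /andP[g0 g1] := gaussn_01 x.
rewrite normrM; apply: (le_trans (ler_pM _ _ hp hq)) => //.
by rewrite mulrACA ler_wpM2l ?mulr_ge0// ler_piMl.
Qed.

Lemma quadratic_bound n (x : 'rV[R]_n) (d : 'I_n -> R) f M : 0 <= M ->
  (forall i, `|d i| <= M * gaussn x) -> `|f| <= M * gaussn x ->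
  `|\sum_i d i ^+ 2 + sqnorm x * f ^+ 2| <= (n%:R * (M * M) + 4 * (M * M)) * gaussn x.
Proof.
move=> M0 hd hf; have /andP[g0 g1] := gaussn_01 x.
rewrite mulrDl; apply: (le_trans (ler_normD _ _)); apply: lerD.
  rewrite ger0_norm; last by apply: sumr_ge0 => i _; rewrite sqr_ge0.
  apply: (@le_trans _ _ (\sum_(i < n) (M * M * gaussn x))).
    apply: ler_sum => i _; rewrite expr2.
    exact: (le_trans (ler_norm _) (mul_bound M0 M0 (hd i) (hd i))).
  by rewrite sumr_const card_ord -[leLHS]mulr_natl !mulrA.
rewrite normrM ger0_norm ?sqnorm_ge0// expr2 normrM.
apply: (@le_trans _ _ (sqnorm x * ((M * gaussn x) * (M * gaussn x)))).
  by rewrite ler_wpM2l ?sqnorm_ge0// ler_pM.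
have -> : sqnorm x * (M * gaussn x * (M * gaussn x)) =
  (sqnorm x * gaussn x) * (M * M * gaussn x) by ring.
by rewrite -[leRHS]mulrA ler_wpM2r ?sqnorm_gaussn_le// !mulr_ge0.
Qed.

Section Limit.
Variables (k n : nat) (c : nat -> bool).
Let b := positive k n.
Hypothesis bc : forall i, b i -> c i.
Let u j := @truncated b c n j.
Let Du j (i : 'I_n) := @truncatedD b c n j i.

Lemma adm_truncated j : adm b (u j) (Du j).
Proof.
have := Cc_smooth_adm (Cc_smooth_truncated c n k j).
by congr adm; apply/funext => i; exact: partial_truncated.
Qed.

Let aE : adm b (@eign R c n) (@eignD R c n). Proof. exact: adm_eign. Qed.

Let cvg_sqr (f : nat -> R) (l : R) : f j @[j --> \oo] --> l ->
  f j ^+ 2 @[j --> \oo] --> l ^+ 2.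
Proof. by move=> fl; under eq_cvg do rewrite expr2; rewrite expr2; exact: cvgM. Qed.

Let cvg_sqrB0 (f : nat -> R) (l : R) : f j @[j --> \oo] --> l ->
  (f j - l) ^+ 2 @[j --> \oo] --> (0 : R).
Proof.
move=> fl; have : (f j - l) ^+ 2 @[j --> \oo] --> (l - l) ^+ 2.
  by apply: cvg_sqr; apply: cvgB => //; exact: cvg_cst.
by rewrite subrr expr0n.
Qed.

Let cvg_sum (f : nat -> 'I_n -> R) (l : 'I_n -> R) :
  (forall i, f j i @[j --> \oo] --> l i) ->
  \sum_i f j i @[j --> \oo] --> \sum_i l i.
Proof.
move=> H; apply: (@cvg_big R _ +%R 0 xpredT _ _ _ _ (fun i j => f j i) l).
  exact: add_continuous.
by move=> i _; exact: H.
Qed.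

Lemma mass_truncated_cvg : mass b (u j) @[j --> \oo] --> mass b (@eign R c n).
Proof.
have [M M0 HM] := @truncated_bound b c n bc.
apply: (@intn_cvg _ _ (fun j x => u j x ^+ 2) _ (M * M)).
- by move=> j; apply: domnX2; exact: adm_domn (adm_truncated j).
- by move=> j x; rewrite expr2; have [h _] := HM j x; exact: mul_bound.
- by move=> x hx; apply: cvg_sqr; have [h _] := truncated_cvg c hx.
Qed.

Lemma dirichlet_truncated_cvg :
  dirichlet b (u j) (Du j) @[j --> \oo] --> dirichlet b (@eign R c n) (@eignD R c n).
Proof.
have [M M0 HM] := @truncated_bound b c n bc.
apply: (@intn_cvg _ _ (fun j x => \sum_i Du j i x ^+ 2 + sqnorm x * u j x ^+ 2) _
  (n%:R * (M * M) + 4 * (M * M))).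
- move=> j; have a := adm_truncated j.
  exact: (domnD (domn_grad a) (domn_potential a)).
- by move=> j x; have [h h'] := HM j x; exact: quadratic_bound.
- move=> x hx; have [h h'] := truncated_cvg c hx.
  apply: cvgD; first by apply: cvg_sum => i; exact: cvg_sqr.
  by apply: cvgM; [exact: cvg_cst|exact: cvg_sqr].
Qed.

Lemma inner_truncated_cvg : intn b (fun x => u j x * eign b x) @[j --> \oo] -->
  intn b (fun x : 'rV[R]_n => eign c x * eign b x).
Proof.
have [M M0 HM] := @truncated_bound b c n bc.
have [N N0 HN] := eign_bound b n.
apply: (@intn_cvg _ _ (fun j x => u j x * eign b x) _ (M * N)).
- move=> j; apply: domnM; [exact: adm_domn (adm_truncated j)|exact: domn_eign].
- by move=> j x; have [h _] := HM j x; have [h' _] := HN x; exact: mul_bound.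
- move=> x hx; have [h h'] := truncated_cvg c hx.
  by apply: cvgM => //; exact: cvg_cst.
Qed.

(** The coefficient 1 is kept so that the differences have the shape of [admB] with [t = 1]. *)
Let bound_sub : exists2 M, 0 <= M & forall j (x : 'rV[R]_n),
  `|u j x - 1 * eign c x| <= M * gaussn x /\
  forall i, `|Du j i x - 1 * eignD c i x| <= M * gaussn x.
Proof.
have [M M0 HM] := @truncated_bound b c n bc.
have [N N0 HN] := eign_bound c n.
exists (M + N); first exact: addr_ge0.
move=> j x; have [h1 h2] := HM j x; have [h3 h4] := HN x.
split=> [|i]; rewrite mul1r mulrDl (le_trans (ler_normB _ _))// lerD//.
Qed.

Lemma gradB_truncated_cvg :
  intn b (fun x => \sum_i (Du j i x - 1 * eignD c i x) ^+ 2) @[j --> \oo] --> (0 : R).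
Proof.
have [M M0 HM] := bound_sub.
have E0 : (0 : R) = intn b (fun _ : 'rV[R]_n => 0).
  by rewrite /intn Rintegral_cst ?mul0r//; exact: measurable_boxT.
rewrite [X in _ --> X]E0.
apply: (@intn_cvg _ _ (fun j x => \sum_i (Du j i x - 1 * eignD c i x) ^+ 2) _
  (n%:R * (M * M) + 4 * (M * M))).
- by move=> j; exact: domn_grad (admB 1 (adm_truncated j) aE).
- move=> j x; have [h h'] := HM j x.
  (* A potential term with f = 0 is added to give the expression the form required by
     [quadratic_bound]. *)
  rewrite -[X in `|X|]addr0 -[X in _ + X](mulr0 (sqnorm x)).
  rewrite -[X in _ * X](expr0n R 2) /=; apply: quadratic_bound => //.
  by rewrite normr0 mulr_ge0// expR_ge0.
- move=> x hx; have [h h'] := truncated_cvg c hx.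
  have S0 : (0 : R) = \sum_(i < n) 0 by rewrite big1.
  rewrite [X in _ --> X]S0.
  by apply: cvg_sum => i; rewrite mul1r; exact: cvg_sqrB0.
Qed.

Lemma potentialB_truncated_cvg :
  intn b (fun x => sqnorm x * (u j x - 1 * eign c x) ^+ 2) @[j --> \oo] --> (0 : R).
Proof.
have [M M0 HM] := bound_sub.
have E0 : (0 : R) = intn b (fun _ : 'rV[R]_n => 0).
  by rewrite /intn Rintegral_cst ?mul0r//; exact: measurable_boxT.
rewrite [X in _ --> X]E0.
apply: (@intn_cvg _ _ (fun j x => sqnorm x * (u j x - 1 * eign c x) ^+ 2) _
  (n%:R * (M * M) + 4 * (M * M))).
- by move=> j; exact: domn_potential (admB 1 (adm_truncated j) aE).
- move=> j x; have [h h'] := HM j x.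
  have g : `|0 : R| <= M * gaussn x by rewrite normr0 mulr_ge0// expR_ge0.
  have := quadratic_bound M0 (d := fun=> 0) (fun _ => g) h.
  by rewrite big1 ?add0r// => i _; rewrite expr0n.
- move=> x hx; have [h h'] := truncated_cvg c hx.
  rewrite -[X in _ --> X](mulr0 (sqnorm x)).
  by apply: cvgM; [exact: cvg_cst|rewrite mul1r; exact: cvg_sqrB0].
Qed.

End Limit.

(** Both eigenfunctions vanish on the faces of the box, so each weak equation can be tested against
    the other function; the two eigenvalues then multiply the same inner product. *)
Lemma eign_orthogonal b c n : (forall i, b i -> c i) -> eigvn b n != eigvn c n :> R ->
  intn b (fun x : 'rV[R]_n => eign c x * eign b x) = 0.
Proof.
move=> bc L.
have [CE gE gDE E0] := adm_eign (R := R) n bc.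
have [CB gB gDB B0] := adm_eign (R := R) n (fun i (h : b i) => h).
have H1 := energy_eign b CE gE gDE E0.
have H2 := energy_eign c CB gB gDB B0.
have : eigvn b n * intn b (fun x : 'rV[R]_n => eign c x * eign b x) =
    eigvn c n * intn b (fun x : 'rV[R]_n => eign b x * eign c x).
  rewrite -H1 -H2; apply: eq_intn => x _; rewrite [eign c x * _]mulrC; congr (_ + _).
  by apply: eq_bigr => i _; rewrite mulrC.
have -> : intn b (fun x : 'rV[R]_n => eign b x * eign c x) =
    intn b (fun x : 'rV[R]_n => eign c x * eign b x).
  by apply: eq_intn => x _; rewrite mulrC.
move=> /eqP; rewrite -subr_eq0 -mulrBl mulf_eq0 subr_eq0 (negbTE L) /=.
by move=> /eqP.
Qed.

End Sharpness.

(** Making the even first factor odd raises its eigenvalue from 1 to 3. *)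
Lemma eigvn_first_odd (R : realType) (b : nat -> bool) n : b 0%N = false -> (0 < n)%N ->
  eigvn (fun i => b i || (i == 0%N)) n = eigvn b n + 2 :> R.
Proof.
case: n => // n b0 _; rewrite !eigvnS b0/= /eigv.
rewrite (_ : _ \o S = b \o S); last by apply/funext => i /=; rewrite orbF.
by ring.
Qed.

(** * The first excited state when there is a free coordinate *)

Section Attained.
Context {R : realType}.
Variables (n k : nat).
Hypothesis kn : (k < n)%N.
Let b := positive k n.
(* [eign c] is x_0 times the ground state [eign b]. *)
Let c i := b i || (i == 0%N).

Let bc i : b i -> c i. Proof. by rewrite /c => ->. Qed.

Let L : R := (n + 2 * k)%:R.

Let eigvb : eigvn b n = L. Proof. exact/eigvn_positive/ltnW. Qed.

Let eigvc : eigvn c n = L + 2.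
Proof.
rewrite -eigvb; apply: eigvn_first_odd; last exact: leq_ltn_trans kn.
by rewrite /b /positive leqn0 subn_eq0 leqNgt kn.
Qed.

Let orth : intn b (fun x : 'rV[R]_n => eign c x * eign b x) = 0.
Proof.
apply: eign_orthogonal => //; rewrite eigvb eigvc.
by rewrite lt_eqF// ltrDl.
Qed.

Let L0 : 0 <= L. Proof. by rewrite ler0n. Qed.

Let N := mass b (@eign R c n).
Let N0 : 0 < N. Proof. exact: intn_eign_sqr_gt0. Qed.

Let QE : dirichlet b (@eign R c n) (@eignD R c n) = (L + 2) * N.
Proof. by rewrite dirichlet_eign// eigvc. Qed.

Let G := intn b (fun x : 'rV[R]_n => eign b x ^+ 2).
Let G0 : 0 < G. Proof. exact: intn_eign_sqr_gt0. Qed.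

(** The truncations [u j] are admissible but not orthogonal to the ground state, so their inner
    products [p j] must be kept until they vanish in the limit, where the inequality reads C (L + 3)
    N <= 2 N. *)
Lemma stability_sharp (C : R) : 2 / (n + 2 * k + 3)%:R < C -> ~ @stability_ineq R n k C.
Proof.
move=> C0C ineq.
have C0E : (2 / (n + 2 * k + 3)%:R : R) = 2 / (L + 3) by rewrite natrD.
have L3 : 0 < L + 3 by rewrite ltr_wpDl.
have C0 : 0 < C by apply: le_lt_trans C0C; rewrite divr_ge0.
pose u j := @truncated R b c n j; pose Du j := @truncatedD R b c n j.
pose Q j := dirichlet b (u j) (Du j); pose m j := mass b (u j).
pose p j := intn b (fun x => u j x * eign b x).
(* The bracket is the minimum over t of the energy of [u j] minus t times the ground state;
   completing the square shows that it bounds the infimum from below. *)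
have H j : C * (Q j + m j - (L + 1) * (p j ^+ 2 / G)) <= Q j - L * m j.
  have aj : adm b (u j) (Du j) := adm_truncated k n c j.
  have [Cj _ _ _] := aj.
  have := ineq (u j) (Cc_smooth_truncated c n k j).
  rewrite (grad_C1 Cj) (deficitE (ltnW kn) aj) -/b eigvb -/(Q j) -/(m j).
  rewrite -lee_fin EFinM; apply: le_trans; apply: lee_wpmul2l; first by rewrite lee_fin ltW.
  apply: le_ereal_inf_tmp => _ [t _ <-].
  have aB := admB t aj (adm_eign n (fun i (h : b i) => h)).
  have [CB _ _ _] := aB.
  rewrite ground_stateE (grad_C1 CB) (energyE aB) lee_fin.
  rewrite (energy_sub_eign t aj (fun i (h : b i) => h)) -/b -/(Q j) -/(m j) -/(p j) -/G eigvb.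
  rewrite -subr_ge0.
  have -> : Q j + m j - 2 * t * (L + 1) * p j + t ^+ 2 * (L + 1) * G -
     (Q j + m j - (L + 1) * (p j ^+ 2 / G)) = (L + 1) * (t * G - p j) ^+ 2 / G.
    by field; rewrite gt_eqF.
  by rewrite divr_ge0 ?(ltW G0)// mulr_ge0 ?sqr_ge0// addr_ge0.
have Qc : Q j @[j --> \oo] --> (L + 2) * N by rewrite -QE; exact: dirichlet_truncated_cvg.
have mc : m j @[j --> \oo] --> N by exact: mass_truncated_cvg.
have pc : p j @[j --> \oo] --> (0 : R) by rewrite -orth; exact: inner_truncated_cvg.
have lhs : C * (Q j + m j - (L + 1) * (p j ^+ 2 / G)) @[j --> \oo] -->
    C * ((L + 2) * N + N - (L + 1) * (0 * 0 / G)).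
  apply: cvgM; first exact: cvg_cst.
  apply: cvgB; first exact: cvgD.
  apply: cvgM; first exact: cvg_cst.
  apply: cvgM; last exact: cvg_cst.
  by under eq_cvg do rewrite expr2; exact: cvgM.
have rhs : Q j - L * m j @[j --> \oo] --> (L + 2) * N - L * N.
  by apply: cvgB => //; apply: cvgM => //; exact: cvg_cst.
have : C * ((L + 2) * N + N - (L + 1) * (0 * 0 / G)) <= (L + 2) * N - L * N.
  by apply: (ler_cvg_to lhs rhs); exact: nearW.
rewrite !mul0r mulr0 subr0.
have -> : (L + 2) * N - L * N = 2 * N by ring.
have -> : C * ((L + 2) * N + N) = C * (L + 3) * N by ring.
rewrite ler_pM2r// -ler_pdivlMr// -C0E.
by rewrite leNgt C0C.
Qed.

Let U := @eign R c n.
Let DU : 'rV[R]_n -> 'rV[R]_n := fun x => \row_i eignD c i x.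

(** The truncations serve as approximating sequence; their pointwise limits and uniform majorant
    turn into the two L^2 limits. *)
Lemma in_completion_eign : in_completion k U DU.
Proof.
have [_ cU cDU] := @C1_eign R c n; split.
- exact: continuous_measurable_rowT.
- move=> i; under eq_fun do rewrite mxE.
  exact: (continuous_measurable_rowT (cDU i)).
exists (fun j => @truncated R b c n j).
have aB j := admB (1 : R) (adm_truncated k n c j) (adm_eign n bc).
split.
- by move=> j; exact: Cc_smooth_truncated.
- have E j : orthant_int k (fun x => sqnorm (grad (@truncated R b c n j) x - DU x)) =
    (intn b (fun x : 'rV[R]_n => \sum_i (truncatedD b c j i x - 1 * eignD c i x) ^+ 2))%:E.
    rewrite -(orthant_intE (domn_grad (aB j))).
    congr orthant_int; apply/funext => x; apply: eq_bigr => i _.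
    by rewrite !mxE partial_truncated mul1r.
  under eq_cvg do rewrite E.
  by apply: cvg_EFin; [exact: nearW|exact: gradB_truncated_cvg].
- have E j : orthant_int k (fun x => sqnorm x * (@truncated R b c n j x - U x) ^+ 2) =
    (intn b (fun x : 'rV[R]_n => sqnorm x * (truncated b c j x - 1 * eign c x) ^+ 2))%:E.
    rewrite -(orthant_intE (domn_potential (aB j))).
    by congr orthant_int; apply/funext => x; rewrite mul1r.
  under eq_cvg do rewrite E.
  by apply: cvg_EFin; [exact: nearW|exact: potentialB_truncated_cvg].
Qed.

(** By orthogonality the squared L^2 distance from [U] to t times the ground state is N + t^2 G,
    which is positive. *)
Lemma eign_not_ground_state (t : R) :
  ~ ae_on_orthant k U (fun x => t * ground_state k x).
Proof.
move=> ae; have aB := admB t (adm_eign n bc) (adm_eign n (fun i (h : b i) => h)).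
have dsq : domn b (fun x => (U x - t * eign b x) ^+ 2) by exact/domnX2/(adm_domn aB).
have Z : intn b (fun x => (U x - t * eign b x) ^+ 2) = 0.
  rewrite /intn /Rintegral (ae_eq_integral (cst 0%E)) ?integral0//.
  - exact: measurable_boxT.
  - by apply/measurable_EFinP; case: dsq.
  - move: ae; apply: filterS => x Hx bx; rewrite /= ground_stateE in Hx *.
    rewrite Hx ?subrr ?expr0n// => i ki; have := bx i; rewrite mxE; exact.
have dUU : domn b (fun x => U x ^+ 2) by exact/domnX2/domn_eign.
have dUE : domn b (fun x => U x * eign b x) by apply: domnM; exact: domn_eign.
have dEE : domn b (fun x : 'rV[R]_n => eign b x ^+ 2) by exact/domnX2/domn_eign.
have : intn b (fun x => (U x - t * eign b x) ^+ 2) = N + (- (2 * t) * 0 + t ^+ 2 * G).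
  rewrite -orth /N /mass /G -(intnZ _ dUE) -(intnZ _ dEE).
  rewrite -(intnD (domnZ _ dUE) (domnZ _ dEE)) -(intnD dUU (domnD (domnZ _ dUE) (domnZ _ dEE))).
  by apply: eq_intn => x _; rewrite /U; ring.
rewrite Z mulr0 add0r => E; have : 0 < N + t ^+ 2 * G.
  by rewrite ltr_wpDr// mulr_ge0 ?sqr_ge0// ltW.
by rewrite -E ltxx.
Qed.

(** By orthogonality the energy is (L + 3) N + t^2 (L + 1) G, so that the infimum is reached at t =
    0; the deficit is 2 N. *)
Lemma stability_eq_eign : stability_eq k (2 / (n + 2 * k + 3)%:R) U DU.
Proof.
have aU := adm_eign (R := R) n bc.
have C0E : (2 / (n + 2 * k + 3)%:R : R) = 2 / (L + 3) by rewrite natrD.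
have L3 : 0 < L + 3 by rewrite ltr_wpDl.
have E t : energy k (fun x => U x - t * ground_state k x)%R
    (fun x => DU x - t *: grad (ground_state k) x)%R =
    ((L + 2) * N + N + t ^+ 2 * (L + 1) * G)%:E.
  have aB := admB t aU (adm_eign n (fun i (h : b i) => h)).
  have -> : (fun x => DU x - t *: grad (ground_state k) x) =
      fun x => \row_i (eignD c i x - t * eignD b i x).
    apply/funext => x; apply/rowP => i; rewrite ground_stateE (grad_C1 (C1_eign b n)).
    by rewrite !mxE.
  rewrite ground_stateE (energyE aB).
  rewrite (energy_sub_eign t aU (fun i (h : b i) => h)) QE orth mulr0 subr0 eigvb.
  by [].
rewrite /stability_eq (deficitE (ltnW kn) aU) QE -/b eigvb.
rewrite (_ : ereal_inf _ = ((L + 2) * N + N)%:E); last first.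
  apply/eqP; rewrite eq_le; apply/andP; split.
    apply: ereal_inf_lbound; exists 0 => //.
    by rewrite E expr0n !mul0r addr0.
  apply: le_ereal_inf_tmp => _ [t _ <-].
  by rewrite E lee_fin lerDl mulr_ge0 ?(ltW G0)// mulr_ge0 ?sqr_ge0// addr_ge0.
rewrite -EFinM C0E -/N; congr (_%:E); field.
by rewrite gt_eqF.
Qed.

End Attained.

(** Optimality and equality are asserted for k < n, where a free coordinate x_0 exists. For k = n
    every coordinate is positive and the first excited level is L + 4 instead of L + 2. *)
Theorem theorem5p3 (R : realType) (n k : nat)
    (hn : (1 <= n)%N) (hk1 : (1 <= k)%N) (hkn : (k <= n)%N) :
  let C0 : R := 2 / (n + 2 * k + 3)%:R in
  @stability_ineq R n k C0 /\
  ((k < n)%N ->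
   (forall C : R, C0 < C -> ~ @stability_ineq R n k C) /\
   exists (u : 'rV[R]_n -> R) (G : 'rV[R]_n -> 'rV[R]_n),
     [/\ in_completion k u G,
         forall c : R, ~ ae_on_orthant k u (fun x => c * ground_state k x)
       & stability_eq k C0 u G]).
Proof.
split; first exact: stability.
move=> kn; split; first exact: stability_sharp.
exists (@eign R (fun i => positive k n i || (i == 0%N)) n).
exists (fun x => \row_i eignD (fun i => positive k n i || (i == 0%N)) i x).
split; [exact: in_completion_eign|exact: eign_not_ground_state|].
exact: stability_eq_eign.
Qed.
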